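(* Let $s\in(0,1)$. Given $n\ge 3$ and $0\le\beta<1$, then for any $q$ with $2+\beta<q<2^*$ there exists $\alpha^*>0$ such that, provided $\alpha>\alpha^*$, no ground state of the problem $$(1-\beta)(-\Delta)u+\beta(-\Delta)^s u=|x|^\alpha u^{q-1}\ \text{ in } B,\qquad u>0\ \text{ in } B,$$ with $u=0$ on $\partial B$ if $\beta=0$ and $u=0$ in $\mathbb{R}^n\setminus B$ if $\beta\in(0,1)$, is radial.
   Context: $B$ is the unit ball of $\mathbb{R}^n$ centered at the origin, and $2^*=\frac{2n}{n-2}$. Let $X_2(B)=\{u\in W^{1,2}(\mathbb{R}^n): u=0\text{ a.e. on }\mathbb{R}^n\setminus B\}$, identified with $W^{1,2}_0(B)$ via extension by zero. The Gagliardo seminorm is $$[u]_{s,2}=K(n,s)\left(\iint_{\mathbb{R}^{2n}}\frac{|u(x)-u(y)|^2}{|x-y|^{n+2s}}\,dx\,dy\right)^{1/2},$$ where $K(n,s)>0$ is a constant depending only on $n$ and $s$ such that $[u]_{s,2}^2\to\|\nabla u\|_{L^2}^2$ as $s\to1$. The operator $(-\Delta)^s$ is the fractional Laplacian with quadratic form $[u]_{s,2}^2$, so that the operator $(1-\beta)(-\Delta)+\beta(-\Delta)^s$ has quadratic form $(1-\beta)\|\nabla u\|_{L^2(B)}^2+\beta[u]_{s,2}^2$. A ground state of the problem is a function $u\in X_2(B)$, positive in $B$, that minimizes over $0\ne u\in X_2(B)$ the quotient $$\frac{(1-\beta)\|\nabla u\|_{L^2(B)}^2+\beta[u]_{s,2}^2}{\left(\int_B|x|^\alpha|u|^q\,dx\right)^{2/q}}.$$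 *)

(* Defs.v *)
From HB Require Import structures.
From mathcomp Require Import all_boot all_order all_algebra.
From mathcomp Require Import all_classical all_reals all_analysis.

Set Implicit Arguments.
Unset Strict Implicit.
Unset Printing Implicit Defensive.

Import Order.TTheory GRing.Theory Num.Theory.
Import numFieldNormedType.Exports.

Local Open Scope classical_set_scope.
Local Open Scope ring_scope.

(* R^n is the topological vector space 'rV[R]_n, equipped with the product
   (equivalently Borel) sigma-algebra generated by the coordinates. *)

Definition rV_display : measure_display. Proof. exact: default_measure_display. Qed.

Section rV_measurable.
Context {R : realType}.
Variable n : nat.

Let coord (i : 'I_n) (x : 'rV[R]_n) : measurableTypeR R := x 0 i.

Let rV_set0 : g_sigma_preimage coord set0.
Proof. exact: sigma_algebra0. Qed.

Let rV_setC A : g_sigma_preimage coord A -> g_sigma_preimage coord (~` A).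
Proof. exact: sigma_algebraC. Qed.

Let rV_bigcup (F : _^nat) : (forall i, g_sigma_preimage coord (F i)) ->
  g_sigma_preimage coord (\bigcup_i (F i)).
Proof. exact: sigma_algebra_bigcup. Qed.

HB.instance Definition _ := @isMeasurable.Build rV_display
  'rV[R]_n (g_sigma_preimage coord) rV_set0 rV_setC rV_bigcup.

Lemma measurable_rV_coord (i : 'I_n) :
  measurable_fun [set: 'rV[R]_n] (fun x : 'rV[R]_n => x 0 i : measurableTypeR R).
Proof.
move=> _ Y mY; rewrite setTI; apply: sub_sigma_algebra => /=.
rewrite -bigcup_seq/=; exists i => /=; first by rewrite mem_index_enum.
by exists Y => //; rewrite setTI.
Qed.

Lemma measurable_fun_rV d (T : measurableType d) (f : T -> 'rV[R]_n) :
  (forall i, measurable_fun [set: T] (fun t => f t 0 i : measurableTypeR R)) ->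
  measurable_fun [set: T] f.
Proof.
move=> mf _ A mA; rewrite setTI.
suff : g_sigma_preimage coord `<=` [set B | measurable (f @^-1` B)] by exact.
apply: smallest_sub.
  split => /=.
  - by rewrite preimage_set0.
  - by move=> B mB; rewrite setTD preimage_setC; exact: measurableC.
  - by move=> F mF; rewrite preimage_bigcup; exact: bigcup_measurable.
rewrite -bigcup_seq => B [i _ [C mC <-]] /=.
by have := mf i measurableT _ mC; rewrite !setTI.
Qed.

End rV_measurable.

(* Needed because no canonical instance is inferred for the product of two
   sigma-finite measures. *)
Lemma sigma_finite_product d1 d2 (T1 : measurableType d1)
    (T2 : measurableType d2) (R : realType)
    (m1 : {sigma_finite_measure set T1 -> \bar R})
    (m2 : {sigma_finite_measure set T2 -> \bar R}) :
  sigma_finite setT (m1 \x m2)%E.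
Proof.
have /sigma_finiteP[F [TF ndF Foo]] := sigma_finiteT m1.
have /sigma_finiteP[G [TG ndG Goo]] := sigma_finiteT m2.
exists (fun n => F n `*` G n).
  rewrite -setXTT TF TG predeqE => -[x y]; split.
    move=> [/= [n _ Fnx] [k _ Gky]]; exists (maxn n k) => //; split.
    - by move: x Fnx; exact/subsetPset/ndF/leq_maxl.
    - by move: y Gky; exact/subsetPset/ndG/leq_maxr.
  by move=> [n _ []/= ? ?]; split; exists n.
move=> k; have [? ?] := Foo k; have [? ?] := Goo k.
split; first exact: measurableX.
by rewrite product_measure1E// lte_mul_pinfty// ge0_fin_numE.
Qed.

Section lebesgue_rV.
Context {R : realType}.

Definition rV_cons n (p : measurableTypeR R * 'rV[R]_n) : 'rV[R]_n.+1 :=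
  \row_i if unlift ord0 i is Some j then p.2 0 j else p.1.

Definition rV_uncons n (x : 'rV[R]_n.+1) : measurableTypeR R * 'rV[R]_n :=
  (x 0 ord0, \row_j x 0 (lift ord0 j)).

Lemma rV_consK n : cancel (@rV_cons n) (@rV_uncons n).
Proof.
case=> a x; rewrite /rV_uncons /rV_cons !mxE unlift_none /=; congr pair.
by apply/rowP => j; rewrite !mxE liftK.
Qed.

Lemma rV_unconsK n : cancel (@rV_uncons n) (@rV_cons n).
Proof.
move=> x; apply/rowP => i; rewrite /rV_cons !mxE.
by case: unliftP => [j|] -> /=; rewrite ?mxE.
Qed.

Lemma measurable_rV_cons n : measurable_fun setT (@rV_cons n).
Proof.
apply: measurable_fun_rV => i; rewrite /rV_cons.
under eq_fun do rewrite mxE.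
case: (unlift ord0 i) => [j|]; last exact: measurable_fst.
exact: (measurableT_comp (measurable_rV_coord j) measurable_snd).
Qed.

Lemma measurable_rV_uncons n : measurable_fun setT (@rV_uncons n).
Proof.
apply/measurable_fun_pairP; split; first exact: measurable_rV_coord.
apply: measurable_fun_rV => j /=.
under eq_fun do rewrite mxE.
exact: measurable_rV_coord.
Qed.

Section step.
Variables (n : nat) (m : {sigma_finite_measure set 'rV[R]_n -> \bar R}).

Definition lebesgue_rV_step : set 'rV[R]_n.+1 -> \bar R :=
  pushforward (lebesgue_measure \x m)%E (@rV_cons n).

Let measurable_preimage (A : set 'rV[R]_n.+1) :
  measurable A -> measurable (@rV_cons n @^-1` A).
Proof.
by move=> mA; rewrite -[X in measurable X]setTI; exact: measurable_rV_cons.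
Qed.

Let step0 : lebesgue_rV_step set0 = 0%E.
Proof. by rewrite /lebesgue_rV_step /pushforward preimage_set0 measure0. Qed.

Let step_ge0 A : (0 <= lebesgue_rV_step A)%E.
Proof. by rewrite /lebesgue_rV_step /pushforward; exact: measure_ge0. Qed.

Let step_sigma_additive : semi_sigma_additive lebesgue_rV_step.
Proof.
move=> F mF tF mUF; rewrite /lebesgue_rV_step /pushforward preimage_bigcup.
apply: measure_semi_sigma_additive.
- by move=> k; exact: measurable_preimage.
- apply/trivIsetP => /= i j _ _ ij; rewrite -preimage_setI.
  by move/trivIsetP : tF => /(_ _ _ _ _ ij) ->//; rewrite preimage_set0.
- by rewrite -preimage_bigcup; exact: measurable_preimage.
Qed.

HB.instance Definition _ := isMeasure.Build _ _ _ lebesgue_rV_step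
  step0 step_ge0 step_sigma_additive.

Let step_sigma_finite : sigma_finite setT lebesgue_rV_step.
Proof.
have [F FT Foo] := sigma_finite_product
  (@lebesgue_measure R) m.
exists (fun k => @rV_uncons n @^-1` F k).
  by rewrite -preimage_bigcup -FT preimage_setT.
move=> k; have [mF Fk] := Foo k; split.
  by rewrite -[X in measurable X]setTI; exact: measurable_rV_uncons.
rewrite /lebesgue_rV_step /pushforward -comp_preimage.
rewrite (_ : @rV_uncons n \o @rV_cons n = id) //.
by apply/funext => p /=; rewrite rV_consK.
Qed.

HB.instance Definition _ :=
  Measure_isSigmaFinite.Build _ _ _ lebesgue_rV_step step_sigma_finite.

End step.

(* n-dimensional Lebesgue measure, as the n-fold product of the
   one-dimensional one; see lebesgue_rV_box. *)
Fixpoint lebesgue_rV (n : nat) : {sigma_finite_measure set 'rV[R]_n -> \bar R} :=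
  match n with
  | 0 => [the {sigma_finite_measure set _ -> \bar R} of \d_(0 : 'rV[R]_0)]
  | k.+1 => [the {sigma_finite_measure set _ -> \bar R} of
              lebesgue_rV_step (lebesgue_rV k)]
  end.

Lemma lebesgue_rV_box n (A : 'I_n -> set (measurableTypeR R)) :
  (forall i, measurable (A i)) ->
  lebesgue_rV n [set x | forall i, A i (x 0 i)] =
  (\prod_(i < n) lebesgue_measure (A i))%E.
Proof.
elim: n A => [A mA|n IH A mA].
  rewrite big_ord0 /= diracE mem_set//= => -[].
  by [].
rewrite big_ord_recl -IH//.
have mB : measurable [set x : 'rV[R]_n | forall i, A (lift ord0 i) (x 0 i)].
  rewrite (_ : mkset _ = \bigcap_(i in [set: 'I_n])
      ((fun x : 'rV[R]_n => x 0 i) @^-1` A (lift ord0 i))).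
    apply: fin_bigcap_measurable => // i _.
    by rewrite -[X in measurable X]setTI; exact: measurable_rV_coord.
  by apply/seteqP; split=> x /= h i; [move=> _; exact: h|exact: (h i I)].
rewrite /= /lebesgue_rV_step /pushforward.
rewrite -(product_measure1E lebesgue_measure (lebesgue_rV n) (mA ord0) mB).
congr (_ _); apply/seteqP; split => [[a x]/= h|[a x]/= [h0 h] i].
  split; first by have := h ord0; rewrite mxE unlift_none.
  by move=> i; have := h (lift ord0 i); rewrite mxE liftK.
by rewrite mxE; case: unliftP => [j|] ->.
Qed.

End lebesgue_rV.

Section sobolev.
Context {R : realType} {n : nat}.
Local Notation mu := (@lebesgue_rV R n).
Implicit Types (u v phi : 'rV[R]_n -> R) (Du Dv : 'rV[R]_n -> 'rV[R]_n).

(* The library norm on 'rV[R]_n is the sup norm, hence this definition. *)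
Definition enorm (x : 'rV[R]_n) : R := Num.sqrt (\sum_(i < n) x 0 i ^+ 2).

Definition unit_ball : set 'rV[R]_n := [set x | enorm x < 1].

Definition partial (i : 'I_n) phi : 'rV[R]_n -> R :=
  fun x => 'D_(delta_mx 0 i) phi x.

Definition smooth phi : Prop := forall l : seq 'I_n,
  continuous (foldr partial phi l) /\
  forall (i : 'I_n) (x : 'rV[R]_n), derivable (foldr partial phi l) x (delta_mx 0 i).

Definition test_function phi : Prop :=
  smooth phi /\ compact (closure [set x | phi x != 0]).

(* Du is a weak gradient of u lying in L^2; it is unique up to null sets. *)
Definition weak_gradient u Du : Prop := forall i : 'I_n,
  (fun x => Du x 0 i) \in Lfun mu 2%:E /\
  forall phi, test_function phi ->
    (\int[mu]_x (u x * partial i phi x)%:E =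
     - \int[mu]_x (Du x 0 i * phi x)%:E)%E.

Definition W12 u : Prop :=
  u \in Lfun mu 2%:E /\ exists Du, weak_gradient u Du.

(* W^{1,2}_0 of the unit ball, through extension by zero. *)
Definition X2 u : Prop :=
  W12 u /\ {ae mu, forall x, ~ unit_ball x -> u x = 0}.

(* The squared L^2(D) norm of the gradient Du. *)
Definition dirichlet (D : set 'rV[R]_n) Du : \bar R :=
  (\int[mu]_(x in D) (enorm (Du x) ^+ 2)%:E)%E.

(* The argument K is the value K(n,s) of the normalizing constant. *)
Definition gagliardo (K s : R) u : \bar R :=
  (K%:E *
   (\int[mu \x mu]_z
      (`|u z.1 - u z.2| ^+ 2 / (enorm (z.1 - z.2) `^ (n%:R + 2 * s)))%:E) `^ 2^-1)%E.

(* [u]_{s,2}^2 tends to the squared L^2 norm of the gradient as s -> 1. *)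
Definition gagliardo_normalization (K : R -> R) : Prop :=
  (forall s : R, 0 < s < 1 -> 0 < K s) /\
  (forall u Du, W12 u -> weak_gradient u Du ->
     (gagliardo (K s) s u ^+ 2)%E @[s --> 1^'-] --> dirichlet setT Du).

(* Valued in \bar R; Du is meant to be the weak gradient of u. *)
Definition quotient (K s beta alpha q : R) u Du : \bar R :=
  (((1 - beta)%:E * dirichlet unit_ball Du + beta%:E * gagliardo K s u ^+ 2) /
   (\int[mu]_(x in unit_ball) (enorm x `^ alpha * `|u x| `^ q)%:E) `^ (2 / q))%E.

Definition ground_state (K s beta alpha q : R) u : Prop :=
  [/\ X2 u,
      {ae mu, forall x, unit_ball x -> 0 < u x} &
      exists2 Du, weak_gradient u Du &
        forall v Dv, X2 v -> ~ {ae mu, forall x, v x = 0} -> weak_gradient v Dv ->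
          (quotient K s beta alpha q u Du <= quotient K s beta alpha q v Dv)%E].

(* Elements of X2 represent classes of functions modulo null sets, hence the
   almost-everywhere formulation. *)
Definition radial u : Prop :=
  exists g : R -> R, {ae mu, forall x, u x = g (enorm x)}.

End sobolev.

(* Main.v *)
(* The quotient of a radial function is compared with that of a bump near the
   boundary. Let D be the Dirichlet energy of a radial u in X_2(B). Testing its
   weak gradient against x * eta(|x|^(2n)), where eta is a smooth step across a
   thin spherical shell, and shrinking the shell to a Lebesgue point of u gives
   u(x)^2 <= C D (1 - |x|^n) / |x|^(2n) almost everywhere. The weight |x|^alpha
   only sees a shell of width 1/alpha, where u^2 is O(D / alpha); hence the
   weighted integral of u^q is at most (C / alpha) (D / alpha)^(q/2) and, as the
   fractional term is nonnegative, the quotient of u is at least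
   c alpha^(1 + 2/q). A bump of size 1/alpha at distance 3/alpha from the sphere
   has Dirichlet and Gagliardo energies O(alpha^(2 - n)) and weighted integral
   at least c alpha^(-n), so its quotient is O(alpha^(2 - n + 2n/q)). As q > 2,
   the first power of alpha exceeds the second, and a radial u is no minimizer
   for large alpha. *)

From HB Require Import structures.
Require Import Defs.
From mathcomp Require Import all_boot all_order all_algebra.
From mathcomp Require Import all_classical all_reals all_analysis.
From mathcomp Require Import measurable_realfun ring lra.

Set Implicit Arguments.
Unset Strict Implicit.
Unset Printing Implicit Defensive.

Import Order.TTheory GRing.Theory Num.Theory.
Import numFieldNormedType.Exports.

Local Open Scope classical_set_scope.
Local Open Scope ring_scope.

(** * Lebesgue measure on R^n *)

(** The classical bound for radial functions integrates a derivative along a ray. A weak gradient is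
    only known through integrals against test functions, so the bound is obtained by duality. The
    field is [x] times an increasing function of |x|^(2n): its divergence in the ball is a sum of
    two nonnegative terms, so for [u >= 0] the shell alone bounds the integral from below. Young's
    inequality leaves the Dirichlet energy and the volume of the part of the ball outside the inner
    sphere; this volume is the origin of the factor 1 - |x|^n. The exponent 2n makes |x|^(2n) a
    polynomial for every n, while |x|^n is the variable in which Lebesgue measure becomes
    one-dimensional. The field must also be cut off beyond the unit sphere, in a layer whose measure
    tends to zero. Smoothness of all the functions used comes from one class generated by the
    coordinates and exp(-1/t) and closed under differentiation. For the competitor, the singular
    kernel is dominated by indicators of cubes, so that its integral reduces to two geometric
    series. *)

Section lebesgue_rV_theory.
Context {R : realType}.

Lemma lebesgue_measure_symitv (r : R) : 0 <= r ->
  lebesgue_measure `[- r, r]%classic = (2 * r)%:E.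
Proof.
move=> r0; rewrite lebesgue_measure_itv/= lte_fin.
case: ifPn => [_|]; first by rewrite -EFinD opprK mulr2n mulrDl mul1r.
rewrite -leNgt => rr; have -> : r = 0 by apply/eqP; rewrite eq_le r0 andbT; lra.
by rewrite mulr0.
Qed.

Definition rV_box n (A : 'I_n -> set (measurableTypeR R)) : set 'rV[R]_n :=
  [set x : 'rV[R]_n | forall i, A i (x 0 i)].

Lemma measurable_rV_box n (A : 'I_n -> set (measurableTypeR R)) :
  (forall i, measurable (A i)) -> measurable (rV_box A).
Proof.
move=> mA.
rewrite (_ : rV_box A = \bigcap_(i in [set: 'I_n])
    ((fun x : 'rV[R]_n => x 0 i) @^-1` A i)).
  apply: fin_bigcap_measurable => // i _.
  by rewrite -[X in measurable X]setTI; exact: measurable_rV_coord.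
by apply/seteqP; split=> x /= h i; [move=> _; exact: h|exact: (h i I)].
Qed.

Lemma lebesgue_rV_boxE n (A : 'I_n -> set (measurableTypeR R)) :
  (forall i, measurable (A i)) ->
  lebesgue_rV n (rV_box A) = (\prod_(i < n) lebesgue_measure (A i))%E.
Proof. exact: lebesgue_rV_box. Qed.

Lemma lebesgue_rV_cube n (r : R) : 0 <= r ->
  lebesgue_rV n (rV_box (fun=> `[- r, r]%classic)) = ((2 * r) ^+ n)%:E.
Proof.
move=> r0; rewrite lebesgue_rV_boxE//.
under eq_bigr do rewrite lebesgue_measure_symitv//.
by rewrite prodEFin prodr_const card_ord.
Qed.

(** Boxes form a generating pi-system and the integer cubes exhaust the space with finite measure.
    The choice of the coordinate split off and the scaling law both follow from this criterion. *)
Lemma lebesgue_rV_unique n (m : {measure set 'rV[R]_n -> \bar R}) :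
  (forall A : 'I_n -> set (measurableTypeR R), (forall i, measurable (A i)) ->
    m (rV_box A) = (\prod_(i < n) lebesgue_measure (A i))%E) ->
  forall X, measurable X -> lebesgue_rV n X = m X.
Proof.
move=> mbox.
pose G : set (set 'rV[R]_n) := [set rV_box A |
  A in [set A : 'I_n -> set (measurableTypeR R) | forall i, measurable (A i)]].
pose g (k : nat) : set 'rV[R]_n := rV_box (fun=> `[- k%:R, k%:R]%classic).
apply: (@measure_unique _ R _ G g).
- apply/seteqP; split.
    apply: smallest_sub; first exact: smallest_sigma_algebra.
    rewrite -bigcup_seq => B [i _ [C mC <-]] /=; apply: sub_sigma_algebra.
    exists (fun j => if j == i then C else setT) => /=.
      by move=> j; case: ifPn.
    rewrite setTI; apply/seteqP; split => x /=.
      by move/(_ i); rewrite eqxx.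
    by move=> Cx j; case: eqP => // ->.
  apply: smallest_sub; first exact: sigma_algebra_measurable.
  by move=> _ [A mA <-]; exact: measurable_rV_box.
- move=> _ _ [A mA <-] [B mB <-]; exists (fun i => A i `&` B i) => /=.
    by move=> i; exact: measurableI.
  apply/seteqP; split => x /=.
    by move=> h; split=> i; case: (h i).
  by move=> [h1 h2] i; split.
- by move=> k; exists (fun=> `[- k%:R, k%:R]%classic).
- rewrite -subTset => x _; exists (Num.bound (\sum_i `|x 0 i|)) => // i /=.
  rewrite in_itv/= -ler_norml.
  apply: (@le_trans _ _ (\sum_i `|x 0 i|)).
    by rewrite (bigD1 i)//= lerDl sumr_ge0.
  by apply/ltW/archi_boundP/sumr_ge0.
- by move=> _ [A mA <-]; rewrite mbox//; exact: lebesgue_rV_boxE.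
- by move=> k; rewrite [X in (X < _)%E]lebesgue_rV_cube ?ltry.
Qed.

End lebesgue_rV_theory.

(** * Splitting off an arbitrary coordinate, and scaling *)

Section lebesgue_rV_fubini.
Context {R : realType}.

(** The measure is built by splitting off the first coordinate; integration by parts in direction
    [i] needs coordinate [i] to be the one split off. *)
Definition rV_ins n (i : 'I_n.+1) (p : measurableTypeR R * 'rV[R]_n) :
    'rV[R]_n.+1 :=
  \row_j if unlift i j is Some k then p.2 0 k else p.1.

Lemma measurable_rV_ins n (i : 'I_n.+1) : measurable_fun setT (rV_ins i).
Proof.
apply: measurable_fun_rV => j; rewrite /rV_ins.
under eq_fun do rewrite mxE.
case: (unlift i j) => [k|]; last exact: measurable_fst.
exact: (measurableT_comp (measurable_rV_coord k) measurable_snd).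
Qed.

Lemma lebesgue_rV_ins n (i : 'I_n.+1) X : measurable X ->
  lebesgue_rV n.+1 X =
  pushforward (lebesgue_measure \x lebesgue_rV n)%E (rV_ins i) X.
Proof.
pose mi := isMeasurableFun.Build _ _ _ _ _ (measurable_rV_ins i).
pose ins : {mfun _ >-> _} := HB.pack (rV_ins i) mi.
apply: (@lebesgue_rV_unique R n.+1
  (pushforward (lebesgue_measure \x lebesgue_rV n)%E ins)) => A mA.
have E : rV_ins i @^-1` rV_box A = A i `*` rV_box (A \o lift i).
  apply/seteqP; split => -[t x]/=.
    move=> h; split => [|j].
      by have := h i; rewrite mxE unlift_none.
    by have := h (lift i j); rewrite mxE liftK.
  by move=> [h0 h] j; rewrite mxE; case: unliftP => [k|] ->//; exact: h.
transitivity ((lebesgue_measure \x lebesgue_rV n)%E (rV_ins i @^-1` rV_box A)) => //.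
rewrite E (product_measure1E lebesgue_measure)//; last first.
  by apply: measurable_rV_box => j; exact: mA.
rewrite (bigD1_ord i)//=; congr (_ * _)%E.
by apply: lebesgue_rV_boxE => j; exact: mA.
Qed.

Lemma integral_rV_ins_eq0 n (i : 'I_n.+1) (f : 'rV[R]_n.+1 -> R) :
  (lebesgue_rV n.+1).-integrable setT (EFin \o f) ->
  (forall x, \int[lebesgue_measure]_t (f (rV_ins i (t, x)))%:E = 0)%E ->
  (\int[lebesgue_rV n.+1]_x (f x)%:E = 0)%E.
Proof.
move=> intf f0.
have mi := measurable_rV_ins i.
have mf := measurable_int _ intf.
have intf' : (lebesgue_measure \x lebesgue_rV n)%E.-integrable setT
    ((EFin \o f) \o rV_ins i).
  apply/integrableP; split; first exact: measurableT_comp.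
  move/integrableP : intf => [_]; apply: le_lt_trans.
  rewrite (eq_measure_integral (pushforward (lebesgue_measure \x lebesgue_rV n)%E (rV_ins i))).
    by rewrite ge0_integral_pushforward//; exact: measurableT_comp.
  by move=> A mA _; exact: lebesgue_rV_ins.
rewrite (eq_measure_integral (pushforward (lebesgue_measure \x lebesgue_rV n)%E (rV_ins i))).
  rewrite integral_pushforward//=.
  rewrite preimage_setT -integral21_prod_meas1//.
  by rewrite /fubini_G/=; under eq_integral do rewrite f0; rewrite integral0.
by move=> A mA _; exact: lebesgue_rV_ins.
Qed.

Lemma lebesgue_measure_scale (r : R) (A : set (measurableTypeR R)) : 0 < r -> measurable A ->
  lebesgue_measure A = (r%:E * lebesgue_measure (( *%R r) @^-1` A))%E.
Proof.
move=> r0 mA.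
have mr : measurable_fun setT (( *%R r) : measurableTypeR R -> measurableTypeR R).
  exact: mulrl_measurable.
pose mi := isMeasurableFun.Build _ _ _ _ _ mr.
pose f : {mfun measurableTypeR R >-> measurableTypeR R} :=
  HB.pack (( *%R r) : measurableTypeR R -> measurableTypeR R) mi.
apply: (lebesgue_measure_unique (mu := mscale (NngNum (ltW r0)) (pushforward lebesgue_measure f))) => //.
move=> _ [[a b] _ <-].
transitivity (r%:E * lebesgue_measure (( *%R r) @^-1` `]a, b]))%E => //.
rewrite (_ : _ @^-1` _ = `](a / r), (b / r)]%classic); last first.
  apply/seteqP; split => x /=; rewrite !in_itv/= ltr_pdivrMr// ler_pdivlMr//;
  by rewrite mulrC.
rewrite !lebesgue_measure_itv/= !lte_fin ltr_pM2r ?invr_gt0//.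
case: ifP => _; last by rewrite mule0.
by rewrite -!EFinD -EFinM -mulrBl mulrC divfK// gt_eqF.
Qed.

Lemma lebesgue_rV_scale n (r : R) X : 0 < r -> measurable X ->
  lebesgue_rV n X = ((r ^+ n)%:E * lebesgue_rV n (( *:%R r) @^-1` X))%E.
Proof.
move=> r0 mX.
have mr : measurable_fun setT (( *:%R r) : 'rV[R]_n -> 'rV[R]_n).
  apply: measurable_fun_rV => i; under eq_fun do rewrite mxE.
  by apply: measurable_funM => //; exact: measurable_rV_coord.
pose mi := isMeasurableFun.Build _ _ _ _ _ mr.
pose f : {mfun _ >-> _} := HB.pack ( *:%R r) mi.
have rn0 : 0 <= r ^+ n by rewrite exprn_ge0// ltW.
apply: (@lebesgue_rV_unique R n (mscale (NngNum rn0) (pushforward (lebesgue_rV n) f))) => //.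
move=> A mA.
transitivity ((r ^+ n)%:E * lebesgue_rV n (( *:%R r) @^-1` rV_box A))%E => //.
rewrite (_ : _ @^-1` _ = rV_box (fun i => ( *%R r) @^-1` (A i))); last first.
  by apply/seteqP; split => x /= h i; have := h i; rewrite /= mxE.
rewrite [X in (_ * X)%E]lebesgue_rV_boxE; last first.
  move=> i; rewrite -[X in measurable X]setTI.
  have mr1 : measurable_fun setT
      (( *%R r) : measurableTypeR R -> measurableTypeR R).
    exact: mulrl_measurable.
  exact: mr1.
under [RHS]eq_bigr do rewrite (lebesgue_measure_scale r0)//.
rewrite big_split/= prodEFin prodr_const card_ord//.
Qed.

End lebesgue_rV_fubini.

(** * Measurability and integrability of continuous functions *)

Section continuous_rV.
Context {R : realType} {n : nat}.
Local Notation mu := (@lebesgue_rV R n).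

(** The sigma-algebra comes from the coordinates, the topology from the sup norm. They meet because
    an open set is the union of the countably many boxes with rational centre and half-side 1/(k+1)
    that it contains. *)
Lemma open_measurable_rV (U : set 'rV[R]_n) : open U -> measurable U.
Proof.
move=> oU.
pose B (p : 'rV[rat]_n * nat) : set 'rV[R]_n :=
  rV_box (fun i => `](ratr (p.1 0 i) - p.2.+1%:R^-1), (ratr (p.1 0 i) + p.2.+1%:R^-1)[%classic).
have mB p : measurable (B p) by apply: measurable_rV_box.
rewrite (_ : U = \bigcup_(p : 'rV[rat]_n * nat) (if `[< B p `<=` U >] then B p else set0)).
  apply: countable_bigcupT_measurable => // p.
  by case: ifP.
apply/seteqP; split => [x Ux|x [p _]]; last by case: asboolP => // BU /BU.
have /nbhs_ballP[e/= e0 xU] := open_nbhs_nbhs (conj oU Ux).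
(* The centre is within [d] of [x] and the box has half-side [d], so its points are within [2 * d]
   of [x]. *)
have [k ke] : exists k : nat, k.+1%:R^-1 + k.+1%:R^-1 < e.
  have e20 : 0 < e / 2 by rewrite divr_gt0.
  exists (Num.bound (e / 2)^-1).
  have : (Num.bound (e / 2)^-1).+1%:R^-1 < e / 2.
    rewrite invf_plt ?posrE// ?ltr0n//.
    rewrite (lt_le_trans (archi_boundP _))// ?invr_ge0 ?(ltW e20)//.
    by rewrite ler_nat.
  by move=> h; rewrite [ltRHS]splitr ltrD.
pose d : R := k.+1%:R^-1.
have d0 : 0 < d by rewrite invr_gt0 ltr0n.
have cE i : exists q : rat, x 0 i - d < ratr q < x 0 i + d.
  have /rat_in_itvoo[q] : x 0 i - d < x 0 i + d by lra.
  by rewrite in_itv/= => qx; exists q.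
pose c : 'rV[rat]_n := \row_i sval (cid (cE i)).
exists (c, k) => //.
have BU : B (c, k) `<=` U.
  move=> y By; apply: xU; split => // i j; rewrite (ord1 i).
  have := By j; rewrite /= in_itv/= !mxE -/d.
  move: (svalP (cid (cE j))) => /andP[h1 h2] /andP[h3 h4].
  by rewrite /ball/= ltr_distlC; apply/andP; split; rewrite -/d in ke; lra.
rewrite asboolT// => i /=; rewrite in_itv/= !mxE -/d.
move: (svalP (cid (cE i))) => /andP[h1 h2].
by apply/andP; split; lra.
Qed.

Lemma continuous_measurable_rV (f : 'rV[R]_n -> R) :
  continuous f -> measurable_fun setT f.
Proof.
move=> /continuousP cf; apply: (measurability _ (RGenOpens.measurableE R)).
move=> _ [_ [a [b ->] <-]]; rewrite setTI; apply: open_measurable_rV.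
exact/cf/interval_open.
Qed.

(** An explicit cube instead of a compact closure: it has a known finite measure and passes to
    products and partial derivatives unchanged. *)
Definition supported_in_cube (M : R) (f : 'rV[R]_n -> R) : Prop :=
  forall x, ~ rV_box (fun=> `[- M, M]%classic) x -> f x = 0.

Lemma supported_compact (M : R) (f : 'rV[R]_n -> R) : supported_in_cube M f ->
  compact (closure [set x | f x != 0]).
Proof.
move=> fM.
have cM : compact (rV_box (fun=> `[- M, M]%classic) : set 'rV[R]_n).
  apply: (@rV_compact _ _ (fun=> `[- M, M]%classic)).
  by move=> _; exact: segment_compact.
apply: (subclosed_compact _ cM); first exact: closed_closure.
have clM : closed (rV_box (fun=> `[- M, M]%classic) : set 'rV[R]_n).
  by apply: compact_closed => //; exact: norm_hausdorff.
rewrite [X in _ `<=` X](closure_id _).1//; apply: closure_subset => x /= fx.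
by apply: contrapT => /fM /eqP; apply/negP.
Qed.

Lemma continuous_supported_bounded (f : 'rV[R]_n -> R) M :
  continuous f -> supported_in_cube M f -> exists2 C, 0 <= C & forall x, `|f x| <= C.
Proof.
move=> cf fM.
have cM : compact (rV_box (fun=> `[- M, M]%classic) : set 'rV[R]_n).
  apply: (@rV_compact _ _ (fun=> `[- M, M]%classic)).
  by move=> _; exact: segment_compact.
have := continuous_compact (continuous_subspaceT cf) cM.
move=> /compact_bounded[C [_ /(_ (`|C| + 1))]] h.
exists (`|C| + 1); first by rewrite addr_ge0.
move=> x; have [xM|/fM->] := pselect (rV_box (fun=> `[- M, M]%classic) x); last first.
  by rewrite normr0 addr_ge0.
apply: h; first by rewrite (le_lt_trans (ler_norm _))// ltrDl.
by exists x.
Qed.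

Lemma continuous_supported_integrable (f : 'rV[R]_n -> R) M : 0 <= M ->
  continuous f -> supported_in_cube M f -> mu.-integrable setT (EFin \o f).
Proof.
move=> M0 cf fM.
have mB : measurable (rV_box (fun=> `[- M, M]%classic) : set 'rV[R]_n).
  exact: measurable_rV_box.
have -> : EFin \o f = (EFin \o f) \_ (rV_box (fun=> `[- M, M]%classic)).
  apply/funext => x; rewrite patchE; case: ifPn => //.
  by move/negP; rewrite inE => /fM /= ->.
apply: (integrable_mkcond _ mB).1.
apply: measurable_bounded_integrable => //.
- by rewrite [X in (X < _)%E]lebesgue_rV_cube// ltry.
- by apply: measurable_funTS; exact: continuous_measurable_rV.
- have [C C0 fC] := continuous_supported_bounded cf fM.
  by exists C; split; [exact: num_real|] => y Cy x _ /=; rewrite (le_trans (fC x))// ltW.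
Qed.

End continuous_rV.

(** * Integration by parts *)

Section integration_by_parts_rV.
Context {R : realType}.

Lemma rV_insD n (i : 'I_n.+1) (h t : R) (x : 'rV[R]_n) :
  rV_ins i (h + t, x) = h *: delta_mx 0 i + rV_ins i (t, x).
Proof.
apply/rowP => j; rewrite !mxE eqxx/=.
case: unliftP => [k|] ->/=; last by rewrite eqxx mulr1.
by rewrite eq_sym (negbTE (neq_lift _ _)) mulr0 add0r.
Qed.

Lemma closed_rV_box n (a b : 'I_n -> R) :
  closed (rV_box (fun i => `[a i, b i]%classic) : set 'rV[R]_n).
Proof.
apply: compact_closed; first exact: norm_hausdorff.
apply: (@rV_compact _ _ (fun i => `[a i, b i]%classic)).
by move=> i; exact: segment_compact.
Qed.

Lemma partial_eq0_outside n (i : 'I_n) (K : set 'rV[R]_n) (f : 'rV[R]_n -> R) :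
  closed K -> (forall x, ~ K x -> f x = 0) -> forall x, ~ K x -> partial i f x = 0.
Proof.
move=> clK fK x xK; rewrite /partial.
rewrite (_ : 0 = 'D_(delta_mx 0 i) (cst 0 : 'rV[R]_n -> R) x); last first.
  by rewrite derive_cst.
apply: near_eq_derive.
have : nbhs x (~` K).
  by apply: open_nbhs_nbhs; split => //; exact: closed_openC.
by apply: filterS => y /fK.
Qed.

Lemma partial_supported n (i : 'I_n) (f : 'rV[R]_n -> R) M :
  supported_in_cube M f -> supported_in_cube M (partial i f).
Proof. by move=> fM; apply: partial_eq0_outside fM; exact: closed_rV_box. Qed.

(** On each line in direction [i] the integrand is the derivative of a compactly supported C^1
    function, so its integral vanishes; Fubini does the rest. *)
Lemma integral_partial_eq0 n (i : 'I_n) (w : 'rV[R]_n -> R) M : 0 <= M ->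
  continuous w -> (forall x, derivable w x (delta_mx 0 i)) ->
  continuous (partial i w) -> supported_in_cube M w ->
  (\int[lebesgue_rV n]_x (partial i w x)%:E = 0)%E.
Proof.
case: n i w => [[]//|n] i w M0 cw dw cpw wM.
have pM := @partial_supported _ i _ _ wM.
apply: (@integral_rV_ins_eq0 _ _ i).
  exact: continuous_supported_integrable M0 cpw pM.
move=> x; pose W (t : R) := w (rV_ins i (t, x)).
have quotE (t : R) : (fun h : R => h^-1 *: ((W \o shift t) (h *: 1) - W t)) =
    (fun h : R => h^-1 *: ((w \o shift (rV_ins i (t, x))) (h *: delta_mx 0 i)
                          - w (rV_ins i (t, x)))).
  by apply/funext => h /=; rewrite /W -rV_insD /GRing.scale/= mulr1.
have dW (t : R) : derivable W t 1.
  by rewrite /derivable quotE; exact: dw.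
have W'E : derive1 W = (fun t => partial i w (rV_ins i (t, x))).
  by apply/funext => t; rewrite derive1E /derive quotE.
have cins : continuous (fun t : R => rV_ins i (t, x) : 'rV[R]_n.+1).
  move=> t; apply/cvgrPdist_lt => e e0.
  have := nbhsx_ballx t e e0; apply: filterS => s; rewrite -ball_normE /= => ts.
  have -> : rV_ins i (t, x) - rV_ins i (s, x) = (t - s) *: delta_mx 0 i.
    by rewrite -{1}(subrK s t) rV_insD addrK.
  rewrite normrZ (le_lt_trans _ ts)//.
  rewrite ler_piMr// [leLHS]/Num.norm/= mx_normrE.
  by apply/bigmax_leP; split => // -[a b] _ /=; rewrite mxE; case: andP => _; rewrite ?normr1 ?normr0.
(* The interval is one unit longer than the support so that its endpoints lie strictly outside,
   where [W] is zero. *)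
have outE t : ~ `[- (M + 1), M + 1]%classic t -> W t = 0 /\ partial i w (rV_ins i (t, x)) = 0.
  move=> tM; suff : ~ rV_box (fun=> `[- M, M]%classic) (rV_ins i (t, x)).
    by move=> h; split; [exact: wM|exact: pM].
  move=> /(_ i); rewrite mxE unlift_none /= in_itv/= => /andP[h1 h2].
  by apply: tM; rewrite /= in_itv/=; apply/andP; split; lra.
have W0 t : M < `|t| -> W t = 0.
  move=> tM; apply: wM => /(_ i); rewrite mxE unlift_none /= in_itv/=.
  by rewrite -ler_norml leNgt tM.
transitivity (\int[lebesgue_measure]_(t in `[(- (M + 1))%R, (M + 1)%R]) (partial i w (rV_ins i (t, x)))%:E)%E.
  rewrite [RHS]integral_mkcond; apply: eq_integral => t _.
  by rewrite patchE; case: ifPn => // /negP; rewrite inE => /outE[_ ->].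
rewrite (@continuous_FTC2 _ _ W).
- rewrite !W0 ?subee//.
  + by rewrite normrN ger0_norm; lra.
  + by rewrite ger0_norm; lra.
- by lra.
- apply: continuous_subspaceT => t.
  apply: (@continuous_comp _ _ _ (fun t : R => rV_ins i (t, x) : 'rV[R]_n.+1)); first exact: cins.
  exact: cpw.
- have cW : continuous W.
    move=> t; apply: (@continuous_comp _ _ _ (fun t : R => rV_ins i (t, x) : 'rV[R]_n.+1)); first exact: cins.
    exact: cw.
  split; first by move=> t _; exact: dW.
  + by apply: cvg_at_right_filter; exact: cW.
  + by apply: cvg_at_left_filter; exact: cW.
- by move=> t _; rewrite W'E.
Qed.

End integration_by_parts_rV.

Lemma is_derive_near_eq {R : numFieldType} {V W : normedModType R}
    (f g : V -> W) (a v : V) (d : W) :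
  {near a, f =1 g} -> is_derive a v f d -> is_derive a v g d.
Proof.
move=> fg [df <-]; split; first exact: near_eq_derivable fg df.
by rewrite -(near_eq_derive _ fg).
Qed.

(** * The flat exponential exp(-1/t) and its derivatives *)

Section flat_exponential.
Context {R : realType}.

(** Differentiating exp(-1/t) produces powers of 1/t. Carrying such a power as an index makes the
    derivative of a member a combination of members. *)
Definition flat (m : nat) (t : R) : R :=
  if 0 < t then t^-1 ^+ m * expR (- t^-1) else 0.

Lemma flat_ge0 m t : 0 <= flat m t.
Proof.
rewrite /flat; case: ifPn => // t0.
by rewrite mulr_ge0 ?expR_ge0// exprn_ge0// invr_ge0 ltW.
Qed.

Lemma flat_le0 m t : t <= 0 -> flat m t = 0.
Proof. by rewrite /flat ltNge => ->. Qed.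

Lemma flat_gt0 m t : 0 < t -> 0 < flat m t.
Proof. by move=> t0; rewrite /flat t0 mulr_gt0 ?expR_gt0// exprn_gt0// invr_gt0. Qed.

Lemma expXn_expRN_le (m : nat) (x : R) : 0 <= x -> x ^+ m * expR (- x) <= m`!%:R.
Proof.
move=> x0; rewrite expRN ler_pdivrMr ?expR_gt0//.
case: m => [|m]; first by rewrite expr0 fact0 mul1r -expR0 ler_expR.
have f0 : 0 < (m.+1)`!%:R :> R by rewrite ltr0n fact_gt0.
rewrite mulrC -ler_pdivrMr//; apply: le_trans (expR_ge1Dxn m x0).
by rewrite lerDr.
Qed.

Lemma flat_le m t : flat m t <= m`!%:R.
Proof.
rewrite /flat; case: ifPn => // t0.
by apply: expXn_expRN_le; rewrite invr_ge0 ltW.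
Qed.

(** For t > 0, [flat m t] is [t ^+ 2] times the bounded [flat m.+2 t]. Quadratic decay makes the
    difference quotient at 0 tend to 0. *)
Lemma flat_le_sqr m t : flat m t <= (m.+2)`!%:R * t ^+ 2.
Proof.
have [t0|t0] := ltP 0 t; last by rewrite flat_le0// mulr_ge0// sqr_ge0.
rewrite -ler_pdivrMr ?exprn_gt0// (le_trans _ (flat_le m.+2 t))//.
by rewrite /flat t0 -exprVn mulrAC -exprD addn2.
Qed.

Lemma flat_derive m (t : R) :
  is_derive t 1 (flat m) (flat m.+2 t - m%:R * flat m.+1 t).
Proof.
have [t0|t0|t0] := ltgtP t 0.
- rewrite !(flat_le0 _ (ltW t0)) mulr0 subr0.
  have E : {near t, cst 0 =1 flat m}.
    have : \forall z \near t, z < 0 := lt_nbhsl t0.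
    by apply: filterS => z /ltW z0; rewrite flat_le0.
  by apply: is_derive_near_eq E _; exact: is_derive_cst.
- have E : {near t, (fun z => z^-1 ^+ m * expR (- z^-1)) =1 flat m}.
    have : \forall z \near t, 0 < z by exact: lt_nbhsr.
    by apply: filterS => z z0; rewrite /flat z0.
  have tn0 : t != 0 by rewrite gt_eqF.
  have dV : is_derive t 1 (fun z : R => z^-1) (- t ^- 2).
    have := @is_deriveV R id t 1 1 tn0 (is_derive_id _ _).
    by rewrite /GRing.scale/= mulr1.
  have dN : is_derive t 1 (fun z : R => - z^-1) (t ^- 2).
    by have := is_deriveN dV; rewrite opprK.
  have dE := is_derive1_comp (is_derive_expR _) dN.
  have dX := is_deriveX m dV.
  have dM := is_deriveM dX dE.
  suff h : is_derive t 1 (fun z => z^-1 ^+ m * expR (- z^-1))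
      (flat m.+2 t - m%:R * flat m.+1 t).
    exact: is_derive_near_eq E h.
  have -> : (fun z => z^-1 ^+ m * expR (- z^-1)) =
      ((fun z : R => z^-1) ^+ m) * (expR \o (fun z : R => - z^-1)).
    by apply/funext => z; rewrite !fctE.
  apply: is_derive_eq dM _.
  rewrite /flat t0 /GRing.scale/= -exprVn.
  have -> : ((fun z : R => z^-1) ^+ m) t = t^-1 ^+ m by rewrite fctE.
  case: m {E dX} => [|m]; first by rewrite /= !expr0; ring.
  rewrite /= !exprS; ring.
- rewrite t0 !flat_le0// mulr0 subr0.
  have cv : (fun h : R => h^-1 *: ((flat m \o shift 0) (h *: 1) - flat m 0)) @ 0^' --> (0 : R).
    apply/cvgrPdist_le => e e0.
    pose C : R := (m.+2)`!%:R.
    have C0 : 0 < C by rewrite ltr0n fact_gt0.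
    have : \forall h \near (0:R)^', `|h| < e / C.
      apply: nbhs_dnbhs; have := nbhsx_ballx (0 : R) (e / C).
      rewrite divr_gt0// => /(_ isT); apply: filterS => h.
      by rewrite -ball_normE/= sub0r normrN.
    apply: filterS => h hC /=.
    rewrite sub0r normrN (flat_le0 _ (lexx 0)) subr0 /GRing.scale/= mulr1 addr0.
    rewrite normrM normfV (ger0_norm (flat_ge0 _ _)).
    have [->|h0] := eqVneq h 0; first by rewrite normr0 invr0 mul0r ltW.
    rewrite mulrC ler_pdivrMr ?normr_gt0// (le_trans (flat_le_sqr _ _))//.
    rewrite -/C -real_normK ?num_real// expr2 mulrA ler_wpM2r//.
    by rewrite mulrC -ler_pdivlMr// ltW.
  split; first by apply/cvg_ex; exists 0.
  by apply/cvg_lim.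
Qed.

Lemma flat_continuous m : continuous (flat m).
Proof.
move=> t; apply: differentiable_continuous; apply/derivable1_diffP.
by have [] := flat_derive m t.
Qed.

(** The derivative of [flat 0] is [flat 2], which [flat_le] bounds by 2! = 2. *)
Lemma flat_lipschitz (s t : R) : `|flat 0 s - flat 0 t| <= 2 * `|s - t|.
Proof.
wlog st : s t / s <= t => [h|].
  by have [/h//|/ltW/h] := leP s t; rewrite (distrC (flat 0 t)) (distrC t).
have cf : {within `[s, t], continuous (flat 0)}.
  by apply: continuous_subspaceT => x; exact: flat_continuous.
have [c _ E] := MVT_segment st (fun x _ => flat_derive 0 x) cf.
rewrite distrC E mul0r subr0 normrM ger0_norm ?flat_ge0// (distrC s).
by rewrite ler_wpM2r// (le_trans (flat_le _ _)).
Qed.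

End flat_exponential.

(** * A class of explicit smooth functions *)

Section elementary_functions.
Context {R : realType} {n : nat}.
Implicit Types f g : 'rV[R]_n -> R.

(* Closed under partial derivatives, hence consisting of smooth functions. *)
Inductive elementary : ('rV[R]_n -> R) -> Prop :=
| elementary_cst c : elementary (fun=> c)
| elementary_coord i : elementary (fun x => x 0 i)
| elementary_add f g : elementary f -> elementary g ->
    elementary (fun x => f x + g x)
| elementary_mul f g : elementary f -> elementary g ->
    elementary (fun x => f x * g x)
| elementary_flat m f : elementary f -> elementary (fun x => flat m (f x)).

(** Directional derivatives become derivatives in one real variable, where the chain rule needs no
    total differentiability. *)
Lemma is_derive_line f (x v : 'rV[R]_n) (d : R) :
  is_derive x v f d <-> is_derive (0 : R) 1 (fun h => f (h *: v + x)) d.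
Proof.
pose F (h : R) := f (h *: v + x); rewrite -/F.
have E : (fun h : R => h^-1 *: ((F \o shift 0) (h *: 1) - F 0)) =
    (fun h : R => h^-1 *: ((f \o shift x) (h *: v) - f x)).
  by apply/funext => h /=; rewrite /F scale0r add0r addr0 /GRing.scale/= mulr1.
have DE : 'D_1 F 0 = 'D_v f x by rewrite /derive E.
have dE : derivable F 0 1 = derivable f x v by rewrite /derivable E.
split=> -[df <-].
  split; [by rewrite dE|by rewrite DE].
by split; [rewrite -dE|rewrite DE].
Qed.

Lemma is_derive_comp_line f (F : R -> R) (x v : 'rV[R]_n) (d e : R) :
  is_derive (f x) 1 F e -> is_derive x v f d -> is_derive x v (F \o f) (e * d).
Proof.
move=> dF /is_derive_line df; apply/is_derive_line.
apply: (@is_derive1_comp _ F (fun h => f (h *: v + x))) => //.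
by rewrite scale0r add0r.
Qed.

Lemma elementary_derive f : elementary f -> continuous f /\
  forall i, exists2 f', elementary f' & forall x, is_derive x (delta_mx 0 i) f (f' x).
Proof.
elim=> {f}[c|i|f g ef [cf df] eg [cg dg]|f g ef [cf df] eg [cg dg]|m f ef [cf df]].
- split; first exact: cst_continuous.
  move=> i; exists (fun=> 0); first exact: elementary_cst.
  by move=> x; exact: is_derive_cst.
- split; first by move=> x; exact: coord_continuous.
  move=> j; exists (fun=> (i == j)%:R); first exact: elementary_cst.
  move=> x; apply/is_derive_line.
  rewrite (_ : (fun h => _) = (fun h : R => h * (i == j)%:R + x 0 i)); last first.
    by apply/funext => h; rewrite !mxE eqxx.
  have d1 := is_deriveM (is_derive_id (0 : R) 1) (is_derive_cst ((i == j)%:R : R) (0 : R) (1 : R)).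
  have d2 := is_deriveD d1 (is_derive_cst (x 0 i) (0 : R) (1 : R)).
  apply: is_derive_eq d2 _.
  by rewrite /GRing.scale/= mul0r mulr1 add0r addr0.
- split; first by move=> x; exact: (cvgD (cf x) (cg x)).
  move=> i; have [f' ef' dff'] := df i; have [g' eg' dgg'] := dg i.
  exists (fun x => f' x + g' x); first exact: elementary_add.
  by move=> x; exact: is_deriveD.
- split; first by move=> x; exact: (cvgM (cf x) (cg x)).
  move=> i; have [f' ef' dff'] := df i; have [g' eg' dgg'] := dg i.
  exists (fun x => f x * g' x + g x * f' x).
    by apply: elementary_add; exact: elementary_mul.
  by move=> x; exact: is_deriveM.
- split.
    move=> x; apply: (@continuous_comp _ _ _ f (flat m)); first exact: cf.
    exact: flat_continuous.
  move=> i; have [f' ef' dff'] := df i.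
  exists (fun x => (flat m.+2 (f x) + - m%:R * flat m.+1 (f x)) * f' x).
    apply: elementary_mul => //; apply: elementary_add; first exact: elementary_flat.
    by apply: elementary_mul; [exact: elementary_cst|exact: elementary_flat].
  move=> x; rewrite mulNr.
  exact: (is_derive_comp_line (flat_derive m (f x)) (dff' x)).
Qed.

Lemma elementary_continuous f : elementary f -> continuous f.
Proof. by move/elementary_derive => []. Qed.

Lemma elementary_derivable f i x : elementary f -> derivable f x (delta_mx 0 i).
Proof. by move/elementary_derive => [_ /(_ i)[f' _ /(_ x)[]]]. Qed.

Lemma elementary_partial f i : elementary f -> elementary (partial i f).
Proof.
move/elementary_derive => [_ /(_ i)[f' ef' df]].
rewrite (_ : partial i f = f')//; apply/funext => x.
by rewrite /partial; have [_ ->] := df x.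
Qed.

Lemma elementary_smooth f : elementary f -> smooth f.
Proof.
move=> ef l; have efl : elementary (foldr partial f l).
  by elim: l => //= i l; exact: elementary_partial.
by split=> [|i x]; [exact: elementary_continuous|exact: elementary_derivable].
Qed.

Lemma elementary_test_function f M :
  elementary f -> supported_in_cube M f -> test_function f.
Proof. by move=> ef fM; split; [exact: elementary_smooth|exact: supported_compact fM]. Qed.

Lemma elementary_measurable f : elementary f -> measurable_fun setT f.
Proof. by move=> ef; apply: continuous_measurable_rV; exact: elementary_continuous. Qed.

Lemma elementary_opp f : elementary f -> elementary (fun x => - f x).
Proof.
move=> ef; rewrite (_ : (fun x => _) = (fun x => -1 * f x)).
  by apply: elementary_mul => //; exact: elementary_cst.
by apply/funext => x; rewrite mulN1r.
Qed.

Lemma elementary_sum (I : Type) (r : seq I) (F : I -> 'rV[R]_n -> R) :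
  (forall i, elementary (F i)) -> elementary (fun x => \sum_(i <- r) F i x).
Proof.
move=> eF; elim: r => [|i r IH].
  rewrite (_ : (fun x => _) = (fun=> 0)); first exact: elementary_cst.
  by apply/funext => x; rewrite big_nil.
rewrite (_ : (fun x => _) = (fun x => F i x + \sum_(i <- r) F i x)).
  exact: elementary_add.
by apply/funext => x; rewrite big_cons.
Qed.

Lemma elementary_prod (I : Type) (r : seq I) (F : I -> 'rV[R]_n -> R) :
  (forall i, elementary (F i)) -> elementary (fun x => \prod_(i <- r) F i x).
Proof.
move=> eF; elim: r => [|i r IH].
  rewrite (_ : (fun x => _) = (fun=> 1)); first exact: elementary_cst.
  by apply/funext => x; rewrite big_nil.
rewrite (_ : (fun x => _) = (fun x => F i x * \prod_(i <- r) F i x)).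
  exact: elementary_mul.
by apply/funext => x; rewrite big_cons.
Qed.

End elementary_functions.

Section elementary_weak_gradient.
Context {R : realType} {n : nat}.
Local Notation mu := (@lebesgue_rV R n).

Lemma Lfun2_measurable d (T : measurableType d) (m : {measure set T -> \bar R})
    (f : T -> R) : f \in Lfun m 2%:E -> measurable_fun [set: T] f.
Proof. by rewrite inE => /andP[+ _]; rewrite inE. Qed.

Lemma integrable_sqr_Lfun2 d (T : measurableType d) (m : {measure set T -> \bar R})
    (f : T -> R) : measurable_fun [set: T] f ->
  m.-integrable [set: T] (EFin \o (fun x => f x ^+ 2)) -> f \in Lfun m 2%:E.
Proof.
move=> mf /integrableP[_ fi]; rewrite inE; apply/andP; split; first by rewrite inE.
rewrite inE/= /finite_norm unlock/= poweR_lty//; apply: le_lt_trans fi.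
apply: ge0_le_integral => //=.
- apply/measurable_EFinP.
  apply/(@measurableT_comp _ _ _ _ _ _ (fun x : R => x `^ 2)%R) => //.
  exact/measurableT_comp.
- apply/measurable_EFinP; apply: measurableT_comp => //; exact: measurable_funX.
- by move=> x _; rewrite lee_fin normrX powR_mulrn.
Qed.

Lemma continuous_supported_Lfun (f : 'rV[R]_n -> R) M : 0 <= M ->
  continuous f -> supported_in_cube M f -> f \in Lfun mu 2%:E.
Proof.
move=> M0 cf fM; apply: integrable_sqr_Lfun2; first exact: continuous_measurable_rV.
apply: continuous_supported_integrable M0 _ _; last first.
  by move=> x /fM ->; rewrite expr0n.
rewrite (_ : (fun x => _) = (fun x => f x * f x)); last by apply/funext => x; rewrite expr2.
by move=> x; exact: (cvgM (cf x) (cf x)).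
Qed.

(** The product of [f] with a test function inherits the support cube of [f], so its partial
    derivative integrates to zero; the Leibniz rule gives the identity. *)
Lemma elementary_weak_gradient (f : 'rV[R]_n -> R) M : 0 <= M ->
  elementary f -> supported_in_cube M f ->
  weak_gradient f (fun x => \row_i partial i f x).
Proof.
move=> M0 ef fM i; split.
  rewrite (_ : (fun x => _) = partial i f); last by apply/funext => x; rewrite mxE.
  apply: continuous_supported_Lfun M0 _ _.
    exact/elementary_continuous/elementary_partial.
  exact: partial_supported.
move=> phi [sphi cphi].
have cf := elementary_continuous ef.
have cp : continuous phi by case: (sphi [::]).
have cpp : continuous (partial i phi) by case: (sphi [:: i]).
have cpf : continuous (partial i f).
  exact/elementary_continuous/elementary_partial.
pose w x := f x * phi x.
have wM : supported_in_cube M w by move=> x /fM; rewrite /w => ->; rewrite mul0r.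
have dw x : is_derive x (delta_mx 0 i) w (f x * partial i phi x + phi x * partial i f x).
  apply: is_deriveM; split => //; first exact: elementary_derivable.
  by case: (sphi [::]).
have pwE : partial i w = (fun x => f x * partial i phi x + partial i f x * phi x).
  by apply/funext => x; rewrite /partial; case: (dw x) => _ ->; rewrite [X in _ + X]mulrC.
have i1 : mu.-integrable setT (EFin \o (fun x => f x * partial i phi x)).
  apply: continuous_supported_integrable M0 _ _.
    by move=> x; exact: (cvgM (cf x) (cpp x)).
  by move=> x /fM ->; rewrite mul0r.
have i2 : mu.-integrable setT (EFin \o (fun x => partial i f x * phi x)).
  apply: continuous_supported_integrable M0 _ _.
    by move=> x; exact: (cvgM (cpf x) (cp x)).
  by move=> x /(@partial_supported _ _ i _ _ fM) ->; rewrite mul0r.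
have := @integral_partial_eq0 _ _ i w M M0.
rewrite pwE => /(_ _ _ _ wM) h.
under [X in (_ = - X)%E]eq_integral do rewrite mxE.
have {}h : (\int[mu]_x (f x * partial i phi x)%:E +
    \int[mu]_x (partial i f x * phi x)%:E = 0)%E.
  rewrite -integralD//; under eq_integral do rewrite -EFinD.
  apply: h => //.
  - by move=> x; exact: (cvgM (cf x) (cp x)).
  - by move=> x; exact: (cvgD (cvgM (cf x) (cpp x)) (cvgM (cpf x) (cp x))).
move: (integrable_fin_num measurableT i1) (integrable_fin_num measurableT i2) h.
rewrite /=; case: (\int[mu]_x _)%E => // a _; case: (\int[mu]_x _)%E => // b _.
by move=> /eqP; rewrite -EFinD eqe addr_eq0 => /eqP ->.
Qed.

End elementary_weak_gradient.

(** * The distribution of the Euclidean norm *)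

Section radial_law.
Context {R : realType}.

(** Unlike [enorm], this is polynomial in the coordinates, hence elementary and smooth at the
    origin. *)
Definition sqnorm n (x : 'rV[R]_n) : R := \sum_(i < n) x 0 i ^+ 2.

Lemma sqnorm_ge0 n (x : 'rV[R]_n) : 0 <= sqnorm x.
Proof. by apply: sumr_ge0 => i _; exact: sqr_ge0. Qed.

Lemma enorm_ge0 n (x : 'rV[R]_n) : 0 <= enorm x.
Proof. exact: sqrtr_ge0. Qed.

Lemma sqr_enorm n (x : 'rV[R]_n) : enorm x ^+ 2 = sqnorm x.
Proof. by rewrite sqr_sqrtr// sqnorm_ge0. Qed.

Lemma sqr_coord_le n (x : 'rV[R]_n) i : x 0 i ^+ 2 <= sqnorm x.
Proof.
by rewrite /sqnorm (bigD1 i)//= lerDl sumr_ge0// => j _; exact: sqr_ge0.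
Qed.

Lemma coord_le_enorm n (x : 'rV[R]_n) i : `|x 0 i| <= enorm x.
Proof.
by rewrite -(@ler_pXn2r _ 2%N)// ?nnegrE ?enorm_ge0// sqr_enorm real_normK ?num_real// sqr_coord_le.
Qed.

Lemma enormZ n (r : R) (x : 'rV[R]_n) : 0 <= r -> enorm (r *: x) = r * enorm x.
Proof.
move=> r0; rewrite /enorm.
under eq_bigr do rewrite mxE exprMn.
by rewrite -mulr_sumr sqrtrM ?sqr_ge0// sqrtr_sqr ger0_norm.
Qed.

Lemma elementary_sqnorm n : elementary (@sqnorm n).
Proof.
apply: elementary_sum => i.
rewrite (_ : (fun x => _) = (fun x : 'rV[R]_n => x 0 i * x 0 i)).
  by apply: elementary_mul; exact: elementary_coord.
by apply/funext => x; rewrite expr2.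
Qed.

Lemma measurable_enorm n : measurable_fun setT (@enorm R n).
Proof.
apply: (@measurableT_comp _ _ _ _ _ _ (@Num.sqrt R)).
  by apply: continuous_measurable_fun; exact: sqrt_continuous.
exact: (elementary_measurable (@elementary_sqnorm n)).
Qed.

Lemma enorm_lt1 n (x : 'rV[R]_n) : (enorm x < 1) = (sqnorm x < 1).
Proof.
by rewrite -sqr_enorm -[X in _ = (_ < X)](expr1n _ 2%N) ltr_pXn2r// ?nnegrE ?enorm_ge0.
Qed.

Lemma measurable_unit_ball n : measurable (@unit_ball R n).
Proof.
have -> : @unit_ball R n = [set: 'rV[R]_n] `&` @enorm R n @^-1` `]-oo, 1[%classic.
  by apply/seteqP; split => x /=; rewrite in_itv//= => -[].
exact: measurable_enorm.
Qed.

Definition ballvol n : R := fine (lebesgue_rV n (@unit_ball R n)).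

Lemma lebesgue_unit_ball n : lebesgue_rV n (@unit_ball R n) = (ballvol n)%:E.
Proof.
rewrite /ballvol fineK// ge0_fin_numE//.
apply: (@le_lt_trans _ _ (lebesgue_rV n (rV_box (fun=> `[- 1, 1]%classic)))).
  apply: le_measure; rewrite ?inE//; first exact: measurable_unit_ball.
    exact: measurable_rV_box.
  move=> x xB i /=; rewrite in_itv/= -ler_norml.
  by rewrite (le_trans (coord_le_enorm x i))// ltW.
by rewrite lebesgue_rV_cube// ltry.
Qed.

Lemma ballvol_gt0 n : 0 < ballvol n.
Proof.
rewrite -lte_fin -lebesgue_unit_ball.
(* On the cube of half-side [d] the squared norm is at most n d^2 <= n d < 1. *)
pose d : R := n.+1%:R^-1.
have d0 : 0 < d by rewrite invr_gt0 ltr0n.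
apply: (@lt_le_trans _ _ (lebesgue_rV n (rV_box (fun=> `[- d, d]%classic)))).
  by rewrite lebesgue_rV_cube ?(ltW d0)// lte_fin exprn_gt0// mulr_gt0.
apply: le_measure; rewrite ?inE//; [exact: measurable_rV_box|exact: measurable_unit_ball|].
move=> x xd; rewrite /unit_ball/= enorm_lt1.
apply: (@le_lt_trans _ _ (\sum_(i < n) d)).
  apply: ler_sum => i _; rewrite -real_normK ?num_real//.
  have := xd i; rewrite /= in_itv/= -ler_norml => xi.
  apply: (@le_trans _ _ (d ^+ 2)); first by rewrite ler_pXn2r// ?nnegrE ?normr_ge0 ?(ltW d0).
  by rewrite expr2 ler_piMl ?(ltW d0)// invf_le1 ?ltr0n// ler1n.
rewrite sumr_const card_ord -mulr_natl /d ltr_pdivrMr ?ltr0n// mul1r.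
by rewrite ltr_nat.
Qed.

Lemma lebesgue_ball n (r : R) : 0 < r ->
  lebesgue_rV n [set x | enorm x < r] = (r ^+ n * ballvol n)%:E.
Proof.
move=> r0.
have mB : measurable [set x : 'rV[R]_n | enorm x < r].
  rewrite (_ : mkset _ = [set: 'rV[R]_n] `&` @enorm R n @^-1` `]-oo, r[%classic).
    exact: measurable_enorm.
  by apply/seteqP; split => x /=; rewrite in_itv//= => -[].
rewrite (lebesgue_rV_scale r0 mB) EFinM -lebesgue_unit_ball.
congr (_ * lebesgue_rV n _)%E; apply/seteqP; split => x /=.
  by rewrite enormZ ?(ltW r0)// gtr_pMr.
by rewrite /unit_ball/= enormZ ?(ltW r0)// gtr_pMr.
Qed.

Section radius_pow.
Variable n : nat.
Hypothesis n0 : (0 < n)%N.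
Local Notation mu := (lebesgue_rV n).

(* This map pushes Lebesgue measure on R^n to a multiple of Lebesgue measure on
   [0, +oo), which makes polar coordinates unnecessary. *)
Definition radius_pow (x : 'rV[R]_n) : measurableTypeR R := enorm x ^+ n.

Lemma radius_pow_ge0 x : 0 <= radius_pow x.
Proof. by rewrite exprn_ge0// enorm_ge0. Qed.

Lemma measurable_radius_pow : measurable_fun setT radius_pow.
Proof. by apply: measurable_funX; exact: measurable_enorm. Qed.

(** Both sides are measures in [A] once Lebesgue measure is restricted to the half-line, so it
    suffices to compare them on []-oo, t[]: for t > 0 the preimage is the ball of radius t^(1/n),
    whose volume is [t * ballvol n] by homogeneity. *)
Lemma lebesgue_radius_pow (A : set (measurableTypeR R)) : measurable A ->
  A `<=` `[0, +oo[%classic ->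
  mu (radius_pow @^-1` A) = ((ballvol n)%:E * lebesgue_measure A)%E.
Proof.
move=> mA A0.
have m0 : measurable (`[0, +oo[%classic : set (measurableTypeR R)) by [].
pose m1_ : {measure set (measurableTypeR R) -> \bar R} := pushforward mu radius_pow.
pose m1 := m1_ measurable_radius_pow.
have c0 : 0 <= ballvol n by exact/ltW/ballvol_gt0.
pose m2 : {measure set (measurableTypeR R) -> \bar R} :=
  mscale (NngNum c0) (mrestr lebesgue_measure m0).
suff E : m1 A = m2 A.
  transitivity (m1 A) => //; rewrite E.
  transitivity ((ballvol n)%:E * lebesgue_measure (A `&` `[0%R, +oo[%classic))%E => //.
  by rewrite setIidl.
have m1E (t : R) : m1 `]-oo, t[%classic = (ballvol n * Num.max 0 t)%:E.
  have [t0|t0] := leP t 0.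
    rewrite mulr0; transitivity (mu (set0 : set 'rV[R]_n)); last by rewrite measure0.
    congr (lebesgue_rV n _); apply/seteqP; split => x //=.
    by rewrite in_itv/= => xt; have := le_lt_trans (radius_pow_ge0 x) xt; rewrite ltNge t0.
  pose r := t `^ n%:R^-1.
  have rt : r ^+ n = t.
    rewrite -powR_mulrn ?powR_ge0// -powRrM mulVf ?pnatr_eq0 -?lt0n//.
    by rewrite powRr1// ltW.
  have r0 : 0 < r by rewrite powR_gt0.
  rewrite mulrC -rt -lebesgue_ball//.
  congr (lebesgue_rV n _); apply/seteqP; split => x /=;
  by rewrite in_itv/= /radius_pow ltr_pXn2r// nnegrE ?enorm_ge0// ltW.
have m2E (t : R) : m2 `]-oo, t[%classic = (ballvol n * Num.max 0 t)%:E.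
  transitivity ((ballvol n)%:E * lebesgue_measure (`]-oo, t[%classic `&` `[0%R, +oo[%classic))%E => //.
  rewrite EFinM; congr (_ * _)%E.
  rewrite (_ : _ `&` _ = `[0, t[%classic); last first.
    apply/seteqP; split => x /=; rewrite !in_itv/= ?andbT.
      by move=> [-> ->].
    by move=> /andP[-> ->].
  rewrite lebesgue_measure_itv/= lte_fin.
  by case: leP => // _; rewrite oppr0 adde0.
apply: (@measure_unique _ R (measurableTypeR R) (@RGenInftyO.G R)
  (fun k => `]-oo, k%:R[%classic) _ _ _ _ m1 m2 _ _ A mA).
- exact: RGenInftyO.measurableE.
- move=> _ _ [a ->] [b ->]; exists (Num.min a b); apply/seteqP; split => x /=;
  by rewrite !in_itv/= lt_min => /andP.
- by move=> k; exists k%:R.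
- rewrite -subTset => x _; exists (Num.bound `|x|) => //=; rewrite in_itv/=.
  by rewrite (le_lt_trans (ler_norm x))// archi_boundP.
- by move=> _ [t ->]; rewrite m1E m2E.
- by move=> k; rewrite m1E ltry.
Qed.

Lemma ge0_integral_radius_pow (f : measurableTypeR R -> \bar R) :
  measurable_fun setT f -> (forall t, 0 <= f t)%E ->
  (\int[mu]_x f (radius_pow x) =
   (ballvol n)%:E * \int[lebesgue_measure]_(t in `[0%R, +oo[) f t)%E.
Proof.
move=> mf f0.
have c0 : 0 <= ballvol n by exact/ltW/ballvol_gt0.
have m0 : measurable (`[0, +oo[%classic : set (measurableTypeR R)) by [].
rewrite -(ge0_integral_mscale _ m0 (NngNum c0))//; last exact: measurable_funTS.
pose m1_ : {measure set (measurableTypeR R) -> \bar R} := pushforward mu radius_pow.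
pose m1 := m1_ measurable_radius_pow.
transitivity (\int[m1]_(t in `[0%R, +oo[) f t)%E; last first.
  by apply: eq_measure_integral => A mA A0; exact: lebesgue_radius_pow.
rewrite [RHS]ge0_integral_pushforward//; [|exact: measurable_radius_pow|exact: measurable_funTS].
congr (integral _ _ _); apply/seteqP; split => x //= _.
by rewrite in_itv/= andbT radius_pow_ge0.
Qed.

End radius_pow.

End radial_law.

Lemma measureU_eq0 d (T : measurableType d) (R : realType)
    (m : {measure set T -> \bar R}) (A B : set T) :
  measurable A -> measurable B -> m A = 0%E -> m B = 0%E -> m (A `|` B) = 0%E.
Proof. by move=> mA mB A0 B0; rewrite measureU0. Qed.

(** * Null sets, rays and measurable radial profiles *)

Section rays.
Context {R : realType} {n : nat}.
Local Notation mu := (@lebesgue_rV R n).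
Local Notation leb := (@lebesgue_measure R).

Definition ray_times (x : 'rV[R]_n) (A : set 'rV[R]_n) : set (measurableTypeR R) :=
  [set l | 0 < l /\ A (l *: x)].

(** Tonelli is applied to this set for the product of Lebesgue measure on the line with [mu]. Its
    section at l > 0 is a dilate of [A], which is null exactly when [A] is; its section at [x] is
    [ray_times x A]. *)
Let cone (A : set 'rV[R]_n) : set (measurableTypeR R * 'rV[R]_n) :=
  [set p | 0 < p.1 /\ A (p.1 *: p.2)].

Let measurable_cone (A : set 'rV[R]_n) : measurable A -> measurable (cone A).
Proof.
move=> mA.
have m1 : measurable_fun setT (fun p : measurableTypeR R * 'rV[R]_n => p.1 *: p.2).
  apply: measurable_fun_rV => i; under eq_fun do rewrite mxE.
  apply: measurable_funM; first exact: measurable_fst.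
  exact: (measurableT_comp (measurable_rV_coord i) measurable_snd).
rewrite (_ : cone A = (fst @^-1` `]0, +oo[%classic) `&`
    ((fun p : measurableTypeR R * 'rV[R]_n => p.1 *: p.2) @^-1` A)); last first.
  by apply/seteqP; split=> p /=; rewrite in_itv/= andbT.
apply: measurableI.
  by rewrite -[X in measurable X]setTI; exact: measurable_fst.
by rewrite -[X in measurable X]setTI; exact: m1.
Qed.

Let charc A (p : measurableTypeR R * 'rV[R]_n) : \bar R := (\1_(cone A) p)%:E.

Let measurable_charc (A : set 'rV[R]_n) : measurable A -> measurable_fun setT (charc A).
Proof.
move=> mA; apply/measurable_EFinP; apply: measurable_indic.
exact: measurable_cone.
Qed.

Let charc_l (A : set 'rV[R]_n) (l : R) : measurable A ->
  (\int[mu]_x charc A (l, x) = if (0 < l)%R then mu (( *:%R l) @^-1` A) else 0)%E.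
Proof.
move=> mA; case: ifPn => l0.
  rewrite -[X in mu X]setIT -integral_indic//.
    apply: eq_integral => x _; rewrite /charc !indicE.
    by congr ((nat_of_bool _)%:R)%:E; apply/idP/idP; rewrite !inE /cone/=; tauto.
  have ml : measurable_fun setT (( *:%R l) : 'rV[R]_n -> 'rV[R]_n).
    apply: measurable_fun_rV => i; under eq_fun do rewrite mxE.
    by apply: measurable_funM => //; exact: measurable_rV_coord.
  by rewrite -[X in measurable X]setTI; exact: ml.
rewrite integral0_eq// => x _; rewrite /charc indicE memNset//.
by move=> [/=]; rewrite (negbTE l0).
Qed.

Lemma measurable_ray_times x (A : set 'rV[R]_n) : measurable A -> measurable (ray_times x A).
Proof.
move=> mA; have := measurable_ysection x (measurable_cone mA).
rewrite (_ : ysection _ _ = ray_times x A)//.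
by apply/seteqP; split => l; rewrite /ysection/= inE.
Qed.

Let charc_x (A : set 'rV[R]_n) x : measurable A ->
  (\int[leb]_l charc A (l, x) = leb (ray_times x A))%E.
Proof.
move=> mA; transitivity (\int[leb]_l (\1_(ray_times x A) l)%:E)%E; last first.
  by rewrite integral_indic ?setIT//; exact: measurable_ray_times.
apply: eq_integral => l _; rewrite /charc !indicE.
by congr ((nat_of_bool _)%:R)%:E; apply/idP/idP; rewrite !inE /cone/=; tauto.
Qed.

Let scale_null (A : set 'rV[R]_n) (l : R) : measurable A -> 0 < l ->
  (mu (( *:%R l) @^-1` A) == 0%E) = (mu A == 0%E).
Proof.
move=> mA l0; rewrite [in RHS](lebesgue_rV_scale l0 mA) mule_eq0.
suff -> : ((l ^+ n)%:E == 0)%E = false by [].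
by apply: gt_eqF; rewrite lte_fin exprn_gt0.
Qed.

Lemma null_ray_times (A : set 'rV[R]_n) : measurable A -> mu A = 0%E ->
  {ae mu, forall x, leb (ray_times x A) = 0%E}.
Proof.
move=> mA A0.
have mc := measurable_charc mA.
have c0 p : (0 <= charc A p)%E by rewrite lee_fin.
have E := fubini_tonelli (m1 := leb) (m2 := mu) _ mc c0.
have mG := measurable_fun_fubini_tonelli_G (m1 := leb) _ mc c0.
have : (\int[mu]_x `|\int[leb]_l charc A (l, x)| = 0)%E.
  under eq_integral do rewrite gee0_abs ?integral_ge0//.
  rewrite -E; apply: integral0_eq => l _; rewrite charc_l//; case: ifPn => // l0.
  by apply/eqP; rewrite scale_null// A0.
move/(ae_eq_integral_abs mu measurableT mG).
by apply: filterS => x /(_ I) h; rewrite -charc_x.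
Qed.

(** If [A] had positive measure so would all its dilates, and the inner integrals would be nonzero
    for every [l] in []0, 1[], although they vanish almost everywhere. *)
Lemma ray_times_null (A : set 'rV[R]_n) : measurable A ->
  (forall x, leb (ray_times x A) = 0%E) -> mu A = 0%E.
Proof.
move=> mA A0.
have mc := measurable_charc mA.
have c0 p : (0 <= charc A p)%E by rewrite lee_fin.
have E := fubini_tonelli (m1 := leb) (m2 := mu) _ mc c0.
have mF := measurable_fun_fubini_tonelli_F (m2 := mu) _ mc c0.
have : (\int[leb]_l `|\int[mu]_x charc A (l, x)| = 0)%E.
  under eq_integral do rewrite gee0_abs ?integral_ge0//.
  by rewrite E; apply: integral0_eq => x _; rewrite charc_x.
move/(ae_eq_integral_abs leb measurableT mF) => [N [mN N0 NS]].
apply/eqP; apply: contrapT => /negP muA.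
have : leb `]0, 1[%classic = 0%E.
  apply: (subset_measure0 _ mN _ N0) => //.
  move=> l /=; rewrite in_itv/= => /andP[l0 _]; apply: NS => /= /(_ I) /eqP.
  rewrite [fubini_F _ _ _]charc_l// l0 scale_null//; exact/negP.
by rewrite lebesgue_measure_itv/= lte_fin ltr01 oppr0 adde0 => /eqP; rewrite eqe oner_eq0.
Qed.

Lemma null_enorm_eq0 : (0 < n)%N -> mu [set x | enorm x = 0] = 0%E.
Proof.
move=> n0.
rewrite (_ : [set x | enorm x = 0] = @radius_pow R n @^-1` [set 0]).
  rewrite lebesgue_radius_pow//; first by rewrite lebesgue_measure_set1 mule0.
  by move=> _ ->; rewrite /= in_itv/= lexx.
apply/seteqP; split => x /=; rewrite /radius_pow.
  by move=> ->; rewrite expr0n gtn_eqF.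
by move/eqP; rewrite expf_eq0 n0 => /eqP.
Qed.

(* The profile in the definition of [radial] need not be measurable; a measurable
   one is read off along a ray that meets the exceptional set in a null set. *)
Lemma radial_representative (u : 'rV[R]_n -> R) : (0 < n)%N ->
  measurable_fun setT u -> radial u ->
  exists2 G : measurableTypeR R -> R, measurable_fun setT G &
    {ae mu, forall x, u x = G (radius_pow x)}.
Proof.
move=> n0 mu_ [g [N [mN N0 NS]]].
have mE0 : measurable [set x : 'rV[R]_n | enorm x = 0].
  rewrite (_ : mkset _ = [set: 'rV[R]_n] `&` @enorm R n @^-1` [set 0]) ?setTI//.
  by rewrite -[X in measurable X]setTI; exact: measurable_enorm.
have uN x : ~ N x -> u x = g (enorm x).
  by move=> Nx; apply: contrapT => ux; apply: Nx; apply: NS.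
have [N2 [mN2 N20 N2S]] := null_ray_times mN N0.
(* [N2] and the origin are null while the ball is not, so some reference ray meets [N] in a null
   set. *)
have [x1 [x1N2 x10]] : exists x1, ~ N2 x1 /\ 0 < enorm x1.
  apply: contrapT => h.
  have mE : measurable [set x : 'rV[R]_n | enorm x = 0] by exact: mE0.
  have : @unit_ball R n `<=` N2 `|` [set x | enorm x = 0].
    move=> x _; have [|xN2] := pselect (N2 x); [by left|right].
    apply/eqP; rewrite eq_le enorm_ge0 andbT leNgt; apply/negP => x0.
    by apply: h; exists x.
  have NE0 : mu (N2 `|` [set x | enorm x = 0]) = 0%E.
    by apply: measureU_eq0 => //; exact: null_enorm_eq0.
  move=> /(@subset_measure0 _ _ _ mu _ _ (@measurable_unit_ball R n) (measurableU _ _ mN2 mE)).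
  move=> /(_ NE0) /eqP; rewrite [X in X == _]lebesgue_unit_ball gt_eqF//.
  by rewrite lte_fin ballvol_gt0.
pose r1 := enorm x1.
pose L := ray_times x1 N.
have L0 : leb L = 0%E.
  by apply: contrapT => h; apply: x1N2; apply: N2S.
have mL : measurable L by exact: measurable_ray_times.
(* Points whose radius is that of an exceptional point on the reference ray. A ray off the origin
   meets [W] in a dilate of the null set [L], so [W] is null. *)
pose W : set 'rV[R]_n := [set x | L (enorm x / r1)].
have mdiv : measurable_fun setT (fun x : 'rV[R]_n => enorm x / r1 : measurableTypeR R).
  by apply: measurable_funM => //; exact: measurable_enorm.
have mW : measurable W.
  by rewrite (_ : W = [set: 'rV[R]_n] `&` (fun x => enorm x / r1) @^-1` L) ?setTI//;
    rewrite -[X in measurable X]setTI; exact: mdiv.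
have W0 : mu W = 0%E.
  apply: ray_times_null => // x.
  have [x0|] := eqVneq (enorm x) 0.
    rewrite (_ : ray_times x W = set0) ?measure0//.
    apply/seteqP; split => l //= [l0]; rewrite /W/= enormZ ?(ltW l0)// x0 mulr0 mul0r.
    by move=> []; rewrite ltxx.
  rewrite neq_lt ltNge enorm_ge0/= => x0.
  have rr0 : 0 < enorm x / r1 by rewrite divr_gt0.
  have pre0 : leb (( *%R (enorm x / r1)) @^-1` L) = 0%E.
    have := lebesgue_measure_scale rr0 mL; rewrite L0 => /esym/eqP.
    rewrite mule_eq0 => /orP[|/eqP//].
    by rewrite gt_eqF// lte_fin.
  rewrite (_ : ray_times x W = ( *%R (enorm x / r1)) @^-1` L)//.
  apply/seteqP; split => l /=.
    move=> [l0]; rewrite /W/= enormZ ?(ltW l0)//.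
    by rewrite [_ / r1 * l]mulrC mulrA.
  move=> Ll; have l0 : 0 < l by case: Ll; rewrite pmulr_rgt0.
  split=> //; rewrite /W/= enormZ ?(ltW l0)//.
  by move: Ll; rewrite [_ / r1 * l]mulrC mulrA.
(* For t >= 0 this is the value of [u] at the point of the reference ray with norm t^(1/n). *)
exists (fun t => u ((t `^ n%:R^-1 / r1) *: x1)).
  apply: (@measurableT_comp _ _ _ _ _ _ u _
    (fun t : measurableTypeR R => (t `^ n%:R^-1 / r1) *: x1)) => //.
  apply: (@measurable_fun_rV R n _ (measurableTypeR R)) => i; under eq_fun do rewrite mxE.
  apply: measurable_funM => //; apply: measurable_funM => //.
exists (N `|` [set x | enorm x = 0] `|` W); split.
- by apply: measurableU => //; exact: measurableU.
- apply: measureU_eq0 => //; first exact: measurableU.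
  by apply: measureU_eq0 => //; exact: null_enorm_eq0.
- move=> x /= ux; apply: contrapT => /not_orP[/not_orP[xN x0] xW]; apply: ux.
  have {}x0 : 0 < enorm x by rewrite lt_neqAle enorm_ge0 andbT eq_sym; exact/eqP.
  have E : radius_pow x `^ n%:R^-1 = enorm x.
    rewrite /radius_pow -powR_mulrn ?enorm_ge0// -powRrM mulfV ?pnatr_eq0 -?lt0n//.
    by rewrite powRr1// enorm_ge0.
  rewrite E (uN x)// uN.
    by rewrite enormZ ?divr_ge0 ?enorm_ge0// divfK// gt_eqF.
  move=> Nl; apply: xW; split => //; exact: divr_gt0.
Qed.

End rays.

(** * Pointwise bound for radial functions *)

Section smooth_step.
Context {R : realType}.

Lemma flat_nondecreasing (s t : R) : s <= t -> flat 0 s <= flat 0 t.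
Proof.
move=> st; have [s0|s0] := leP s 0; first by rewrite (flat_le0 _ s0) flat_ge0.
have t0 := lt_le_trans s0 st.
by rewrite /flat s0 t0 !expr0 !mul1r ler_expR lerN2 lef_pV2.
Qed.

(* [flat 0 1 - flat 0 (1 - t)] is nonpositive for [t <= 0] and constant for
   [1 <= t], so no integration is needed to build a step. *)
Definition smooth_step (t : R) : R :=
  flat 0 (flat 0 1 - flat 0 (1 - t)) / flat 0 (flat 0 1).

Let flat01 : 0 < flat 0 (flat 0 (1 : R)).
Proof. by rewrite !flat_gt0. Qed.

Lemma smooth_step_le0 t : t <= 0 -> smooth_step t = 0.
Proof.
move=> t0; rewrite /smooth_step flat_le0 ?mul0r// subr_le0.
by apply: flat_nondecreasing; rewrite lerBrDl gerDr.
Qed.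

Lemma smooth_step_ge1 t : 1 <= t -> smooth_step t = 1.
Proof.
move=> t1; rewrite /smooth_step [flat 0 (1 - t)]flat_le0 ?subr_le0// subr0.
by rewrite divff// gt_eqF.
Qed.

Lemma smooth_step_ge0 t : 0 <= smooth_step t.
Proof. by rewrite divr_ge0 ?flat_ge0. Qed.

Lemma smooth_step_le1 t : smooth_step t <= 1.
Proof.
rewrite ler_pdivrMr// mul1r; apply: flat_nondecreasing.
by rewrite gerBl flat_ge0.
Qed.

Lemma smooth_step_lipschitz : exists2 C, 0 < C &
  forall s t, `|smooth_step s - smooth_step t| <= C * `|s - t|.
Proof.
(* Two nested uses of [flat_lipschitz] cost a factor 2 each. *)
exists (4 / flat 0 (flat 0 1)) => [|s t]; first by rewrite divr_gt0.
rewrite /smooth_step -mulrBl normrM [`|_^-1|]gtr0_norm ?invr_gt0//.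
rewrite [leRHS]mulrAC ler_wpM2r ?invr_ge0 ?(ltW flat01)//.
apply: le_trans (flat_lipschitz _ _) _.
have -> : flat 0 1 - flat 0 (1 - s) - (flat 0 1 - flat 0 (1 - t)) =
  flat 0 (1 - t) - flat 0 (1 - s) by ring.
have := flat_lipschitz (1 - t) (1 - s).
have -> : 1 - t - (1 - s) = s - t by ring.
by move=> h; lra.
Qed.

Lemma elementary_smooth_step n (f : 'rV[R]_n -> R) :
  elementary f -> elementary (fun x => smooth_step (f x)).
Proof.
move=> ef; apply: elementary_mul; last exact: elementary_cst.
apply: elementary_flat; apply: elementary_add; first exact: elementary_cst.
apply: elementary_opp; apply: elementary_flat.
by apply: elementary_add; [exact: elementary_cst|exact: elementary_opp].
Qed.

End smooth_step.

Section radial_test_field.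
Context {R : realType} {n : nat}.
Hypothesis n0 : (0 < n)%N.
Implicit Types x : 'rV[R]_n.

(* The square of [radius_pow], which is polynomial in the coordinates for every [n]. *)
Definition sqradius_pow x : R := sqnorm x ^+ n.

Lemma sqradius_powE x : sqradius_pow x = radius_pow x ^+ 2.
Proof. by rewrite /sqradius_pow /radius_pow -sqr_enorm -!exprM mulnC. Qed.

Lemma elementary_sqradius_pow : elementary sqradius_pow.
Proof.
rewrite (_ : sqradius_pow = fun x => \prod_(i < n) sqnorm x); last first.
  by apply/funext => x; rewrite prodr_const card_ord.
by apply: elementary_prod => i; exact: elementary_sqnorm.
Qed.

Lemma is_derive_sqradius_pow x i : is_derive x (delta_mx 0 i) sqradius_pow
  (n%:R * sqnorm x ^+ n.-1 * (2 * x 0 i)).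
Proof.
have ds : is_derive x (delta_mx 0 i) (@sqnorm R n) (2 * x 0 i).
  apply/is_derive_line.
  rewrite (_ : (fun h => _) = (fun h : R => h * h + h * (2 * x 0 i) + sqnorm x)); last first.
    apply/funext => h; rewrite /sqnorm (bigD1 i)//= [in RHS](bigD1 i)//= !mxE !eqxx/=.
    rewrite (eq_bigr (fun j => x 0 j ^+ 2)); first by ring.
    by move=> j ji; rewrite !mxE eqxx/= (negbTE ji) mulr0 add0r.
  have d0 := is_derive_id (0 : R) 1.
  have d1 := is_deriveM d0 d0.
  have d2 := is_deriveM d0 (is_derive_cst (2 * x 0 i : R) (0 : R) (1 : R)).
  have d3 := is_deriveD (is_deriveD d1 d2) (is_derive_cst (sqnorm x) (0 : R) (1 : R)).
  apply: is_derive_eq d3 _.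
  by rewrite /GRing.scale/=; ring.
rewrite (_ : sqradius_pow = (@sqnorm R n) ^+ n); first exact: is_deriveX ds.
by apply/funext => y; rewrite fctE.
Qed.

(** In the variable s = |x|^(2n), the first factor starts at [a] and grows at rate 1/h for s between
    a + h and a + 2h. The second is 1 for s <= 1 and 0 for s >= 1 + d, so the truncation happens
    outside the ball. *)
Definition radial_cutoff (a h d s : R) : R :=
  flat 0 ((s - a) / h) * smooth_step ((1 + d - s) / d).

Definition radial_test (a h d : R) (i : 'I_n) x : R :=
  x 0 i * radial_cutoff a h d (sqradius_pow x).

Lemma elementary_radial_test a h d i : elementary (radial_test a h d i).
Proof.
apply: elementary_mul; first exact: elementary_coord.
apply: elementary_mul.
  apply: elementary_flat; apply: elementary_mul; last exact: elementary_cst.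
  by apply: elementary_add; [exact: elementary_sqradius_pow|exact: elementary_cst].
apply: elementary_smooth_step; apply: elementary_mul; last exact: elementary_cst.
apply: elementary_add; first exact: elementary_cst.
exact/elementary_opp/elementary_sqradius_pow.
Qed.

Lemma radial_test_supported a h d i : 0 < d <= 1 ->
  supported_in_cube 2 (radial_test a h d i).
Proof.
move=> /andP[d0 d1] x xM; rewrite /radial_test /radial_cutoff smooth_step_le0 ?mulr0//.
rewrite pmulr_lle0 ?invr_gt0// subr_le0.
have [j xj] : exists j, 2 < `|x 0 j|.
  apply: contrapT => hx; apply: xM => j /=; rewrite in_itv/= -ler_norml leNgt.
  by apply/negP => xj; apply: hx; exists j.
apply: (@le_trans _ _ (sqnorm x)).
  apply: le_trans (sqr_coord_le x j).
  rewrite -real_normK ?num_real// (@le_trans _ _ (2 ^+ 2))//; first by lra.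
  by rewrite ler_pXn2r// ?nnegrE// ltW.
rewrite /sqradius_pow -[leLHS]expr1 ler_weXn2l//.
apply: le_trans (sqr_coord_le x j).
rewrite -real_normK ?num_real// (@le_trans _ _ (2 ^+ 2))//; first by lra.
by rewrite ler_pXn2r// ?nnegrE// ltW.
Qed.

Lemma partial_radial_test a h d i x : 0 < d -> sqradius_pow x < 1 ->
  partial i (radial_test a h d i) x = flat 0 ((sqradius_pow x - a) / h) +
    x 0 i ^+ 2 * (2 * n%:R / h * sqnorm x ^+ n.-1 * flat 2 ((sqradius_pow x - a) / h)).
Proof.
move=> d0 x1; rewrite /partial.
pose f x : R := x 0 i * flat 0 ((sqradius_pow x - a) / h).
(* The set |x|^(2n) < 1 is open and the outer factor is constantly 1 there, so it does not
   contribute to the derivative. *)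
have E : {near x, f =1 radial_test a h d i}.
  have cs := elementary_continuous elementary_sqradius_pow.
  have : \forall y \near x, sqradius_pow y < 1.
    have : nbhs (sqradius_pow x) [set t : R | t < 1] by exact: lt_nbhsl.
    exact: cs.
  apply: filterS => y y1; rewrite /f /radial_test /radial_cutoff smooth_step_ge1 ?mulr1//.
  by rewrite ler_pdivlMr//; lra.
rewrite -(near_eq_derive _ E).
have dc : is_derive x (delta_mx 0 i) (fun x : 'rV[R]_n => x 0 i) 1.
  apply/is_derive_line.
  rewrite (_ : (fun h => _) = (fun h : R => h + x 0 i)); last first.
    by apply/funext => k; rewrite !mxE !eqxx/= mulr1.
  have d3 := is_deriveD (is_derive_id (0 : R) 1) (is_derive_cst (x 0 i) (0 : R) (1 : R)).
  by apply: is_derive_eq d3 _; rewrite addr0.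
have ds : is_derive x (delta_mx 0 i) (fun x => (sqradius_pow x - a) / h)
    (n%:R * sqnorm x ^+ n.-1 * (2 * x 0 i) / h).
  have d1 := is_deriveD (is_derive_sqradius_pow x i) (is_derive_cst (- a : R) x (delta_mx 0 i)).
  have d2 := is_deriveM d1 (is_derive_cst (h^-1 : R) x (delta_mx 0 i)).
  by apply: is_derive_eq d2 _; rewrite /GRing.scale/=; ring.
have df := is_derive_comp_line (flat_derive 0 _) ds.
have [_ ->] := is_deriveM dc df.
by rewrite /GRing.scale/=; ring.
Qed.

(** For h > 0 both terms of the divergence are nonnegative, the first coming from the divergence of
    [x] and the second from the growth of the cutoff; the second is of size 1/h on the shell. *)
Lemma sum_partial_radial_test a h d x : 0 < d -> sqradius_pow x < 1 ->
  \sum_i partial i (radial_test a h d i) x =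
  n%:R * flat 0 ((sqradius_pow x - a) / h) +
  2 * n%:R / h * sqradius_pow x * flat 2 ((sqradius_pow x - a) / h).
Proof.
move=> d0 x1; under eq_bigr do rewrite partial_radial_test//.
rewrite big_split/= sumr_const card_ord -mulr_suml -/(sqnorm x); congr (_ + _).
  by rewrite mulr_natl.
have -> : sqradius_pow x = sqnorm x * sqnorm x ^+ n.-1.
  by rewrite -exprS prednK.
ring.
Qed.

End radial_test_field.

Lemma integrable_indic_lty d (T : measurableType d) (R : realType)
    (m : {measure set T -> \bar R}) (A : set T) : measurable A -> (m A < +oo)%E ->
  m.-integrable setT (EFin \o (\1_A : T -> R)).
Proof.
move=> mA Aoo; apply/integrableP; split.
  by apply/measurable_EFinP; exact: measurable_indic.
under eq_integral do rewrite /= ger0_norm//.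
by rewrite integral_indic// setIT.
Qed.

Lemma integrable_scale d (T : measurableType d) (R : realType)
    (m : {measure set T -> \bar R}) (k : R) (f : T -> R) :
  m.-integrable setT (EFin \o f) -> m.-integrable setT (EFin \o (fun x => k * f x)).
Proof. exact: integrableZl. Qed.

Section weak_divergence.
Context {R : realType} {n : nat}.
Local Notation mu := (@lebesgue_rV R n).
Implicit Types (u : 'rV[R]_n -> R) (Du : 'rV[R]_n -> 'rV[R]_n).

Lemma Lfun2_mul_integrable u v : u \in Lfun mu 2%:E -> v \in Lfun mu 2%:E ->
  mu.-integrable setT (EFin \o (fun x => u x * v x)).
Proof. by move=> hu hv; apply/Lfun1_integrable; exact: Lfun2_mul_Lfun1. Qed.

Lemma weak_divergence u Du M (Phi : 'I_n -> 'rV[R]_n -> R) : 0 <= M ->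
  u \in Lfun mu 2%:E -> weak_gradient u Du ->
  (forall i, elementary (Phi i)) -> (forall i, supported_in_cube M (Phi i)) ->
  [/\ mu.-integrable setT (EFin \o (fun x => u x * \sum_i partial i (Phi i) x)),
      mu.-integrable setT (EFin \o (fun x => \sum_i Du x 0 i * Phi i x)) &
      \int[mu]_x (u x * \sum_i partial i (Phi i) x) =
      - \int[mu]_x (\sum_i Du x 0 i * Phi i x)].
Proof.
move=> M0 hu hDu eP sP.
have i1 i : mu.-integrable setT (EFin \o (fun x => u x * partial i (Phi i) x)).
  apply: Lfun2_mul_integrable => //; apply: (continuous_supported_Lfun M0).
    exact/elementary_continuous/elementary_partial.
  exact: partial_supported.
have i2 i : mu.-integrable setT (EFin \o (fun x => Du x 0 i * Phi i x)).
  apply: Lfun2_mul_integrable; first by case: (hDu i).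
  by apply: (continuous_supported_Lfun M0) => //; exact: elementary_continuous.
pose F1 i : 'rV[R]_n -> \bar R := EFin \o (fun x => u x * partial i (Phi i) x).
pose F2 i : 'rV[R]_n -> \bar R := EFin \o (fun x => Du x 0 i * Phi i x).
have E1 : EFin \o (fun x => u x * \sum_i partial i (Phi i) x) =
    fun x => (\sum_i F1 i x)%E.
  by apply/funext => x; rewrite /= mulr_sumr sumEFin.
have E2 : EFin \o (fun x => \sum_i Du x 0 i * Phi i x) = fun x => (\sum_i F2 i x)%E.
  by apply/funext => x; rewrite /= sumEFin.
split.
- by rewrite E1; apply: (@integrable_sum _ _ _ mu setT measurableT _ _ xpredT F1) => // i _; exact: i1.
- by rewrite E2; apply: (@integrable_sum _ _ _ mu setT measurableT _ _ xpredT F2) => // i _; exact: i2.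
rewrite /Rintegral -fineN; congr fine.
rewrite (_ : (fun x => _) = fun x => (\sum_i F1 i x)%E)//.
rewrite [in RHS](_ : (fun x => _) = fun x => (\sum_i F2 i x)%E)//.
rewrite !integral_sum// -sumeN; last first.
  by move=> i j _ _; apply: fin_num_adde_defl; apply: integrable_fin_num => //; exact: i2.
apply: eq_bigr => i _; have [_ /(_ (Phi i))] := hDu i.
by apply; exact: (elementary_test_function (eP i) (sP i)).
Qed.

Lemma integrable_sqnorm_weak_gradient u Du : weak_gradient u Du ->
  mu.-integrable setT (EFin \o (fun x => sqnorm (Du x))).
Proof.
move=> hDu; pose F i : 'rV[R]_n -> \bar R := EFin \o (fun x => Du x 0 i ^+ 2).
rewrite (_ : _ \o _ = fun x => (\sum_i F i x)%E).
  apply: (@integrable_sum _ _ _ mu setT measurableT _ _ xpredT F) => // i _.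
  by apply: Lfun2_integrable_sqr; case: (hDu i).
by apply/funext => x; rewrite /= sumEFin.
Qed.

End weak_divergence.

(** * Integral of u over a spherical shell *)

Section annulus_estimate.
Context {R : realType} {n : nat}.
Hypothesis n0 : (0 < n)%N.
Local Notation mu := (@lebesgue_rV R n).

Lemma unit_ball_sqradius_pow (x : 'rV[R]_n) : unit_ball x <-> sqradius_pow x < 1.
Proof. by rewrite /unit_ball/= enorm_lt1 /sqradius_pow expr_lt1// sqnorm_ge0. Qed.

Lemma measurable_radius_pow_itv (i : interval R) :
  measurable [set x : 'rV[R]_n | radius_pow x \in i].
Proof.
rewrite (_ : mkset _ = [set: 'rV[R]_n] `&` @radius_pow R n @^-1` [set` i]) ?setTI//.
by rewrite -[X in measurable X]setTI; exact: measurable_radius_pow.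
Qed.

Lemma lebesgue_radius_pow_itv (a b : R) (b0 b1 : bool) : 0 <= a -> a <= b ->
  mu [set x : 'rV[R]_n | radius_pow x \in Interval (BSide b0 a) (BSide b1 b)] =
  (ballvol n * (b - a))%:E.
Proof.
move=> a0 ab.
transitivity ((ballvol n)%:E * lebesgue_measure
  ([set` Interval (BSide b0 a) (BSide b1 b)] : set (measurableTypeR R)))%E.
  rewrite -lebesgue_radius_pow// => x /=; rewrite !in_itv/= andbT => /andP[+ _].
  by case: b0 => //=; [exact: le_trans|move=> /ltW; exact: le_trans].
rewrite lebesgue_measure_itv/= lte_fin EFinM; congr (_ * _)%E.
move: ab; rewrite le_eqVlt => /predU1P[->|ab]; last by rewrite ab EFinB.
by rewrite ltxx subrr.
Qed.

Definition sq_annulus (a b : R) : set 'rV[R]_n := [set x | a < sqradius_pow x < b].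

Lemma measurable_sq_annulus a b : measurable (sq_annulus a b).
Proof.
rewrite (_ : sq_annulus a b = [set: 'rV[R]_n] `&` @sqradius_pow R n @^-1` `]a, b[%classic).
  rewrite setTI -[X in measurable X]setTI.
  by apply: (elementary_measurable (@elementary_sqradius_pow R n)).
by rewrite setTI; apply/seteqP; split => x /=; rewrite in_itv.
Qed.

(** A lower bound for the growth rate of the cutoff in the middle of the shell, where its argument
    runs over [1, 2]. *)
Lemma flat2_ge (t : R) : 1 <= t <= 2 -> flat 0 1 / 4 <= flat 2 t.
Proof.
move=> /andP[t1 t2]; have t0 : 0 < t by lra.
have -> : flat 2 t = flat 0 t * t^-1 ^+ 2.
  by rewrite /flat t0 expr0 mul1r mulrC.
apply: ler_pM; rewrite ?flat_ge0//; first exact: flat_nondecreasing.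
rewrite exprVn lef_pV2 ?posrE ?exprn_gt0//.
rewrite (_ : 4 = 2 ^+ 2); last by ring.
by rewrite ler_pXn2r// ?nnegrE// ltW.
Qed.

Variables (u : 'rV[R]_n -> R) (Du : 'rV[R]_n -> 'rV[R]_n).
Hypothesis u_ge0 : forall x, 0 <= u x.
Hypothesis u_out : forall x, ~ unit_ball x -> u x = 0.
Hypothesis u_L2 : u \in Lfun mu 2%:E.
Hypothesis u_Du : weak_gradient u Du.

Let D := \int[mu]_(x in unit_ball) sqnorm (Du x).

Lemma integrable_supported_ball : mu.-integrable setT (EFin \o u).
Proof.
have -> : EFin \o u = EFin \o (fun x => u x * \1_(@unit_ball R n) x).
  apply/funext => x /=; rewrite indicE.
  have [xB|xB] := boolP (x \in unit_ball); first by rewrite mulr1.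
  by rewrite mulr0 u_out//; move/negP: xB; rewrite inE.
apply: Lfun2_mul_integrable => //; apply: integrable_sqr_Lfun2.
  by apply: measurable_indic; exact: measurable_unit_ball.
rewrite (_ : (fun x => _) = \1_unit_ball); last first.
  by apply/funext => x; rewrite indicE; case: (_ \in _); rewrite ?expr1n ?expr0n.
apply: integrable_indic_lty; first exact: measurable_unit_ball.
by rewrite [X in (X < _)%E]lebesgue_unit_ball ltry.
Qed.

Let integrable_Du : mu.-integrable setT (EFin \o (fun x => sqnorm (Du x))).
Proof. exact: integrable_sqnorm_weak_gradient u_Du. Qed.

Lemma integrable_patch d (T : measurableType d) (m : {measure set T -> \bar R})
    (A : set T) (f : T -> R) : measurable A ->
  m.-integrable setT (EFin \o f) -> m.-integrable setT (EFin \o (f \_ A)).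
Proof.
move=> mA fi; rewrite -restrict_EFin; apply: (integrable_mkcond _ mA).1.
exact: integrableS fi.
Qed.

Lemma radial_cutoff_neq0 (a h d s : R) : 0 < h -> 0 < d ->
  radial_cutoff a h d s != 0 -> a < s < 1 + d.
Proof.
move=> h0 d0; rewrite /radial_cutoff mulf_eq0 negb_or => /andP[h1 h2].
apply/andP; split; rewrite ltNge; apply/negP => sa.
  move: h1; rewrite flat_le0 ?eqxx//.
  by rewrite pmulr_lle0 ?invr_gt0// subr_le0.
move: h2; rewrite smooth_step_le0 ?eqxx//.
by rewrite pmulr_lle0 ?invr_gt0// subr_le0.
Qed.

Lemma radial_cutoff_bounds (a h d s : R) : 0 <= radial_cutoff a h d s <= 1.
Proof.
rewrite mulr_ge0 ?flat_ge0 ?smooth_step_ge0//=.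
rewrite -[leRHS](mul1r 1) ler_pM ?flat_ge0 ?smooth_step_ge0 ?smooth_step_le1//.
exact: (flat_le 0).
Qed.

Let sq_ball d : set 'rV[R]_n := [set x | sqradius_pow x < d].

Let measurable_sq_ball d : measurable (sq_ball d).
Proof.
rewrite (_ : sq_ball d = [set: 'rV[R]_n] `&` @sqradius_pow R n @^-1` `]-oo, d[%classic).
  rewrite setTI -[X in measurable X]setTI.
  by apply: (elementary_measurable (@elementary_sqradius_pow R n)).
by rewrite setTI; apply/seteqP; split => x /=; rewrite in_itv.
Qed.

(** Weak divergence identity for [radial_test]. On the left, [u] vanishes off the ball and the
    divergence is nonnegative inside, so only the shell is kept. On the right, minus the scalar
    product of [Du] with the field is at most e |Du|^2 / 2 + |x|^2 / (2 e), and |x|^2 <= 1 + d on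
    the support of the field. *)
Let annulus_estimate_aux a h d e : 0 < a < 1 -> 0 < h -> 0 < d <= 1 -> 0 < e ->
  2 * n%:R / h * a * (flat 0 1 / 4) * \int[mu]_(x in sq_annulus (a + h) (a + 2 * h)) u x <=
  e / 2 * (\int[mu]_(x in sq_ball (1 + d)) sqnorm (Du x)) +
  (1 + d) / (2 * e) * (ballvol n * (1 + d - Num.sqrt a)).
Proof.
move=> /andP[a0 a1] h0 /andP[d0 d1] e0.
have d01 : 0 < d <= 1 by rewrite d0.
set A := sq_annulus _ _; set k := _ * (flat 0 1 / 4).
have k0 : 0 <= k.
  by rewrite /k !mulr_ge0 ?invr_ge0 ?flat_ge0 ?(ltW a0) ?(ltW h0).
have mA : measurable A by exact: measurable_sq_annulus.
have [i1 i2 E] := @weak_divergence _ _ u Du 2 (radial_test a h d) (ler0n _ _) u_L2 u_Du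
  (elementary_radial_test a h d) (fun i => radial_test_supported n0 a h i d01).
apply: (@le_trans _ _ (\int[mu]_x (u x * \sum_i partial i (radial_test a h d i) x))).
  rewrite Rintegral_mkcond -RintegralZl//; last first.
    by apply: integrable_patch => //; exact: integrable_supported_ball.
  apply: le_Rintegral => //.
    apply: integrable_scale.
    by apply: integrable_patch => //; exact: integrable_supported_ball.
  move=> x _; have [x1|x1] := ltP (sqradius_pow x) 1; last first.
    rewrite patchE u_out ?mul0r; first by case: ifP; rewrite mulr0.
    by move=> /unit_ball_sqradius_pow; rewrite ltNge x1.
  rewrite sum_partial_radial_test//.
  have s0 : 0 <= sqradius_pow x by rewrite exprn_ge0// sqnorm_ge0.
  rewrite patchE; case: ifPn => [|_]; last first.
    rewrite mulr0 mulr_ge0// addr_ge0 ?mulr_ge0 ?flat_ge0//.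
    by rewrite invr_ge0 ltW.
  rewrite inE => /andP[xa xb]; rewrite mulrC ler_wpM2l//.
  apply: (@le_trans _ _ (2 * n%:R / h * sqradius_pow x * flat 2 ((sqradius_pow x - a) / h))); last first.
    by rewrite lerDr mulr_ge0 ?flat_ge0.
  have -> : k = 2 * n%:R / h * (a * (flat 0 1 / 4)) by rewrite /k -!mulrA.
  rewrite -[leRHS]mulrA; apply: ler_wpM2l; first by rewrite !mulr_ge0 ?invr_ge0 ?(ltW h0).
  apply: ler_pM; rewrite ?(ltW a0) ?mulr_ge0 ?flat_ge0//; first by lra.
  by apply: flat2_ge; rewrite ler_pdivlMr// ler_pdivrMr//; apply/andP; split; lra.
rewrite E.
(* Contains the support of the field; the upper end [1 + d] replaces its square root, which is
   smaller. *)
pose C : set 'rV[R]_n := [set x | radius_pow x \in `]Num.sqrt a, (1 + d)[].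
have mC : measurable C by exact: measurable_radius_pow_itv.
have sa1 : Num.sqrt a <= 1 + d.
  by rewrite (@le_trans _ _ 1) ?lerDl ?(ltW d0)// -[leRHS]sqrtr1 ler_wsqrtr// ltW.
have muC : mu C = (ballvol n * (1 + d - Num.sqrt a))%:E.
  by rewrite lebesgue_radius_pow_itv// sqrtr_ge0.
pose g1 x : R := e / 2 * ((fun x => sqnorm (Du x)) \_ (sq_ball (1 + d))) x.
pose g2 x : R := (1 + d) / (2 * e) * (\1_C x : R).
have ig1 : mu.-integrable setT (EFin \o g1).
  by apply: integrable_scale; exact: integrable_patch.
have iC : mu.-integrable setT (EFin \o (\1_C : _ -> R)).
  by apply: integrable_indic_lty => //; rewrite [X in (X < _)%E]muC ltry.
have ig2 : mu.-integrable setT (EFin \o g2) by exact: integrable_scale.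
have -> : e / 2 * (\int[mu]_(x in sq_ball (1 + d)) sqnorm (Du x)) +
    (1 + d) / (2 * e) * (ballvol n * (1 + d - Num.sqrt a)) =
    \int[mu]_x (g1 x + g2 x).
  rewrite RintegralD// RintegralZl//; last exact: integrable_patch.
  rewrite RintegralZl// -Rintegral_mkcond; congr (_ + _ * _).
  by rewrite /Rintegral integral_indic// setIT [X in fine X]muC.
rewrite -mulN1r -RintegralZl//; apply: le_Rintegral => //.
- exact: integrable_scale.
- by apply/(integrableD measurableT ig1 ig2).
move=> x _; rewrite mulN1r /g1 /g2.
have g10 : 0 <= e / 2 * ((fun x => sqnorm (Du x)) \_ (sq_ball (1 + d))) x.
  rewrite mulr_ge0 ?divr_ge0 ?(ltW e0)// patchE; case: ifP => // _.
  exact: sqnorm_ge0.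
have ed0 : 0 <= (1 + d) / (2 * e) by rewrite divr_ge0 ?mulr_ge0 ?addr_ge0 ?(ltW e0) ?(ltW d0).
have [p0|p0] := eqVneq (radial_cutoff a h d (sqradius_pow x)) 0.
  rewrite big1 ?oppr0; last by move=> i _; rewrite /radial_test p0 !mulr0.
  by rewrite addr_ge0// mulr_ge0.
have /andP[xa xd] := radial_cutoff_neq0 h0 d0 p0.
rewrite patchE mem_set// indicE mem_set; last first.
  rewrite /C/= in_itv/= sqradius_powE in xa xd *.
  apply/andP; split.
    rewrite -(@ltr_pXn2r _ 2%N)// ?nnegrE ?sqrtr_ge0 ?radius_pow_ge0//.
    by rewrite sqr_sqrtr// ltW.
  rewrite ltNge; apply/negP => dx; move: xd; rewrite ltNge => /negP; apply.
  apply: (le_trans dx); rewrite -[leLHS]expr1 ler_weXn2l//.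
  by rewrite (le_trans _ dx)// lerDl ltW.
rewrite mulr1.
have x2 : sqnorm x <= 1 + d.
  rewrite leNgt; apply/negP => dx; move: xd; rewrite ltNge => /negP; apply.
  apply: (le_trans (ltW dx)); rewrite /sqradius_pow -[leLHS]expr1 ler_weXn2l//.
  by rewrite (le_trans _ (ltW dx))// lerDl ltW.
apply: (@le_trans _ _ (e / 2 * sqnorm (Du x) + sqnorm x / (2 * e))); last first.
  rewrite lerD2l; apply: ler_wpM2r => //.
  by rewrite invr_ge0 mulr_ge0// ltW.
have /andP[p1 p2] := radial_cutoff_bounds a h d (sqradius_pow x).
rewrite /radial_test; move: p1 p2; set p := radial_cutoff _ _ _ _ => p1 p2.
rewrite -sumrN /sqnorm mulr_sumr mulr_suml -big_split/=; apply: ler_sum => i _.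
(* The square behind Young's inequality with weight [e]. *)
have : 0 <= (e * Du x 0 i + x 0 i * p) ^+ 2 by exact: sqr_ge0.
have pp : (x 0 i * p) ^+ 2 <= x 0 i ^+ 2.
  by rewrite exprMn ler_piMr ?sqr_ge0// exprn_ile1.
move=> sq.
rewrite -subr_ge0.
have -> : e / 2 * Du x 0 i ^+ 2 + x 0 i ^+ 2 / (2 * e) - - (Du x 0 i * (x 0 i * p)) =
  ((e * Du x 0 i + x 0 i * p) ^+ 2 + (x 0 i ^+ 2 - (x 0 i * p) ^+ 2)) / (2 * e).
  by field; rewrite gt_eqF.
by rewrite divr_ge0 ?mulr_ge0 ?(ltW e0)// addr_ge0// subr_ge0.
Qed.

(** Limit d -> 0 of the preceding estimate. In the layer outside the unit sphere nothing has been
    established about [Du], but its squared norm is integrable, so absolute continuity of the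
    integral makes that contribution small. *)
Lemma annulus_estimate a h e : 0 < a < 1 -> 0 < h -> 0 < e ->
  2 * n%:R / h * a * (flat 0 1 / 4) * \int[mu]_(x in sq_annulus (a + h) (a + 2 * h)) u x <=
  e / 2 * D + ballvol n * (1 - Num.sqrt a) / (2 * e).
Proof.
move=> a01 h0 e0; have /andP[a0 a1] := a01.
apply/ler_addgt0Pr => z z0.
have c0 := @ballvol_gt0 R n.
have [d0 [d00 Hd]] := integral_normr_continuous integrable_Du (divr_gt0 z0 e0).
(* The second bound keeps the volume of the layer below [d0]; the third gives
   [3 * ballvol n * d <= z * e]. The energy and the volume term then each lose at most z/2. *)
pose d := Num.min 1 (Num.min (d0 / (2 * ballvol n)) (z * e / (3 * ballvol n))).
have dpos : 0 < d by rewrite !lt_min ltr01 !divr_gt0 ?mulr_gt0.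
have d1 : d <= 1 by rewrite ge_min lexx.
have dd0 : d <= d0 / (2 * ballvol n) by rewrite !ge_min lexx orbT.
have dz : d <= z * e / (3 * ballvol n) by rewrite !ge_min lexx !orbT.
apply: (le_trans (@annulus_estimate_aux a h d e a01 h0 _ e0)); first by rewrite dpos.
pose F : set 'rV[R]_n := [set x | radius_pow x \in `[1, (1 + d)[].
have mF : measurable F by exact: measurable_radius_pow_itv.
have muF : mu F = (ballvol n * d)%:E.
  by rewrite lebesgue_radius_pow_itv ?lerDl ?(ltW dpos)// addrAC subrr add0r.
have F_small : \int[mu]_(x in F) sqnorm (Du x) <= z / e.
  have Fd : ballvol n * d < d0.
    apply: (@le_lt_trans _ _ (ballvol n * (d0 / (2 * ballvol n)))).
      by rewrite ler_pM2l.
    have -> : ballvol n * (d0 / (2 * ballvol n)) = d0 / 2 by field; rewrite gt_eqF.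
    by rewrite ltr_pdivrMr// ltr_pMr// ltr1n.
  have := Hd F mF; rewrite [X in (X < _)%E]muF lte_fin => /(_ Fd)/ltW.
  apply: le_trans; rewrite le_eqVlt; apply/orP; left; apply/eqP.
  by apply: eq_Rintegral => x _; rewrite ger0_norm// sqnorm_ge0.
have ball_le : \int[mu]_(x in sq_ball (1 + d)) sqnorm (Du x) <= D + z / e.
  apply: (@le_trans _ _ (\int[mu]_(x in unit_ball `|` F) sqnorm (Du x))); last first.
    rewrite Rintegral_setU//; first by rewrite lerD2l.
    - exact: measurable_unit_ball.
    - by apply: integrableS integrable_Du => //; apply: measurableU => //; exact: measurable_unit_ball.
    apply/disj_setPS => x [/unit_ball_sqradius_pow]; rewrite sqradius_powE => x1.
    rewrite /F/= in_itv/= => /andP[x2 _]; move: x1; rewrite ltNge => /negP; apply.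
    by rewrite exprn_ege1.
  have mU : measurable (@unit_ball R n `|` F) by apply: measurableU => //; exact: measurable_unit_ball.
  rewrite fine_le//.
  - by apply: integrable_fin_num => //; exact: integrableS integrable_Du.
  - by apply: integrable_fin_num => //; exact: integrableS integrable_Du.
  apply: ge0_subset_integral => //.
  - apply: measurable_funTS; exact: measurable_int integrable_Du.
  - by move=> x _; rewrite lee_fin sqnorm_ge0.
  move=> x xd; have [x1|x1] := ltP (sqradius_pow x) 1; first by left; apply/unit_ball_sqradius_pow.
  right; rewrite /F/= in_itv/=; move: x1 xd; rewrite /sq_ball/= sqradius_powE => x1 xd.
  apply/andP; split.
    by rewrite leNgt; apply/negP => x2; move: x1; rewrite leNgt expr_lt1 ?radius_pow_ge0// x2.
  rewrite ltNge; apply/negP => dx; move: xd; rewrite ltNge => /negP; apply.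
  apply: (le_trans dx); rewrite -[leLHS]expr1 ler_weXn2l//.
  by rewrite (le_trans _ dx)// lerDl ltW.
have s0 : 0 <= Num.sqrt a by exact: sqrtr_ge0.
set s := Num.sqrt a in s0 *; set c := ballvol n in c0 dd0 dz *.
apply: (@le_trans _ _ (e / 2 * (D + z / e) + (1 + d) / (2 * e) * (c * (1 + d - s)))).
  by rewrite lerD2r ler_wpM2l// divr_ge0// ltW.
have -> : e / 2 * (D + z / e) = e / 2 * D + z / 2 by field; rewrite gt_eqF.
rewrite -!addrA lerD2l.
suff : (1 + d) / (2 * e) * (c * (1 + d - s)) <= c * (1 - s) / (2 * e) + z / 2 by lra.
rewrite -subr_ge0.
have -> : c * (1 - s) / (2 * e) + z / 2 - (1 + d) / (2 * e) * (c * (1 + d - s)) =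
  (z * e - c * d * (2 + d - s)) / (2 * e) by field; rewrite gt_eqF.
rewrite divr_ge0 ?mulr_ge0 ?(ltW e0)// subr_ge0.
move: dz; rewrite ler_pdivlMr ?mulr_gt0// => dz.
apply: le_trans dz; rewrite [leRHS]mulrCA [leRHS]mulrC -mulrA.
have : c * d * (2 + d - s) <= c * d * 3 by rewrite ler_wpM2l ?mulr_ge0 ?(ltW c0) ?(ltW dpos)//; lra.
lra.
Qed.

End annulus_estimate.

Section lebesgue_point.
Context {R : realType}.
Local Notation leb := (@lebesgue_measure R).

(** Average the inequality |G t| <= |G s - G t| + |G s| over the ball: at a Lebesgue point the first
    average tends to 0. *)
Lemma lebesgue_pt_le_avg (G : R -> R) (t z : R) :
  leb.-integrable setT (EFin \o G) -> lebesgue_pt G t -> 0 < z ->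
  exists2 e0, 0 < e0 & forall e, 0 < e < e0 ->
    `|G t| <= z + (2 * e)^-1 * (\int[leb]_(s in ball t e) `|G s|).
Proof.
move=> iG /fine_cvgP[fin cvgt] z0.
have := cvgt => /cvgrPdist_lt/(_ z z0) near_lt.
have [e0 /= e00 H] := filterI fin near_lt.
exists e0 => // e /andP[e1 e2].
have [/= davg_fin] : davg G t e \is a fin_num /\ `|0 - fine (davg G t e)| < z.
  by apply: H => //=; rewrite sub0r normrN gtr0_norm.
rewrite sub0r normrN => davg_lt.
have mB : measurable (ball t e : set (measurableTypeR R)) by exact: measurable_ball.
have iB f : leb.-integrable setT (EFin \o f) -> leb.-integrable (ball t e) (EFin \o f).
  by move=> fi; exact: integrableS fi.
have muB : leb (ball t e) = (2 * e)%:E.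
  by rewrite lebesgue_measure_ball ?(ltW e1)// mulr_natl.
have muBoo : (leb (ball t e) < +oo)%E by rewrite muB ltry.
have ic : leb.-integrable (ball t e) (EFin \o cst (G t)).
  apply: measurable_bounded_integrable => //.
  exists `|G t|; split; first exact: num_real.
  by move=> y yG s _; exact: ltW.
have ia : leb.-integrable (ball t e) (EFin \o (fun s => `|G s - G t|)).
  have := integrableB mB (iB _ iG) ic.
  by move/integrable_abse.
have iabs : leb.-integrable (ball t e) (EFin \o (fun s => `|G s|)).
  by have := integrable_abse (iB _ iG).
have davgE : fine (davg G t e) = (2 * e)^-1 * (\int[leb]_(s in ball t e) `|G s - G t|).
  rewrite /davg /iavg muB fineM//.
  - rewrite inver mulf_eq0 pnatr_eq0/= gt_eqF//.
  - by rewrite inver mulf_eq0 pnatr_eq0/= gt_eqF.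
  - exact: integrable_fin_num ia.
have e20 : 0 < 2 * e by rewrite mulr_gt0.
have : 2 * e * `|G t| <= \int[leb]_(s in ball t e) `|G s - G t| + \int[leb]_(s in ball t e) `|G s|.
  rewrite -RintegralD//.
  have -> : 2 * e * `|G t| = \int[leb]_(s in ball t e) `|G t|.
    by rewrite Rintegral_cst// [X in fine X]muB mulrC.
  apply: le_Rintegral => //.
  - by have := integrable_abse ic.
  - exact: (integrableD mB ia iabs).
  move=> s _; rewrite -lerBlDr distrC.
  by rewrite (le_trans _ (lerB_dist _ _))// lerB_dist.
rewrite -ler_pdivlMl// mulrDr -davgE => h.
apply: le_trans h _; rewrite lerD2r (le_trans (ler_norm _))//; exact: ltW.
Qed.

End lebesgue_point.

Section radial_pointwise.
Context {R : realType} {n : nat}.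
Hypothesis n0 : (0 < n)%N.
Local Notation mu := (@lebesgue_rV R n).
Local Notation leb := (@lebesgue_measure R).

(** Equals [P ^+ 2 * ballvol n * t ^+ 2] for the factor [P] introduced in the proof of
    [radial_pointwise_bound]. *)
Definition radial_cst : R := 4 / (n%:R * (flat 0 1 / 4)) ^+ 2 / ballvol n.

Lemma radial_cst_gt0 : 0 < radial_cst.
Proof.
by rewrite divr_gt0 ?ballvol_gt0// divr_gt0// exprn_gt0// mulr_gt0 ?ltr0n// divr_gt0// flat_gt0.
Qed.

(** The optimal choice is e = sqrt(B / A). As [e] must be positive, the cases A = 0 and B = 0 are
    handled by letting it grow or shrink. *)
Lemma le_amgm (X A B : R) : 0 <= X -> 0 <= A -> 0 <= B ->
  (forall e, 0 < e -> X <= e * A + B / e) -> X ^+ 2 <= 4 * A * B.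
Proof.
move=> X0; rewrite le_eqVlt => /predU1P[<- B0 H|A0].
  have : X <= 0.
    apply/ler_addgt0Pr => z z0; rewrite add0r.
    have := H ((B + 1) / z); rewrite divr_gt0 ?ltr_wpDl// => /(_ isT).
    rewrite mulr0 add0r invf_div => /le_trans; apply.
    rewrite mulrA ler_pdivrMr ?ltr_wpDl//; nra.
  move=> X00; have -> : X = 0 by apply/eqP; rewrite eq_le X00.
  by rewrite expr0n mulr0 mul0r.
rewrite le_eqVlt => /predU1P[<- H|B0 H].
  have : X <= 0.
    apply/ler_addgt0Pr => z z0; rewrite add0r.
    have := H (z / A); rewrite divr_gt0// => /(_ isT).
    by rewrite mul0r addr0 divfK// gt_eqF.
  move=> X00; have -> : X = 0 by apply/eqP; rewrite eq_le X00.
  by rewrite expr0n mulr0.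
pose s := Num.sqrt (B / A).
have s0 : 0 < s by rewrite sqrtr_gt0 divr_gt0.
have sE : B = A * s ^+ 2.
  by rewrite sqr_sqrtr ?divr_ge0 ?ltW// mulrC divfK// gt_eqF.
have := H s s0.
have -> : s * A + B / s = 2 * (A * s) by rewrite sE; field; rewrite gt_eqF.
move=> XA.
have -> : 4 * A * B = (2 * (A * s)) ^+ 2 by rewrite sE; ring.
by rewrite ler_pXn2r// nnegrE ?mulr_ge0 ?ltW.
Qed.

Variables (u : 'rV[R]_n -> R) (Du : 'rV[R]_n -> 'rV[R]_n).
Hypothesis u_ge0 : forall x, 0 <= u x.
Hypothesis u_out : forall x, ~ unit_ball x -> u x = 0.
Hypothesis u_L2 : u \in Lfun mu 2%:E.
Hypothesis u_Du : weak_gradient u Du.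
Hypothesis u_radial : radial u.

Let D := \int[mu]_(x in unit_ball) sqnorm (Du x).

Lemma radial_pointwise_bound : {ae mu, forall x, 0 < radius_pow x < 1 ->
  u x ^+ 2 <= radial_cst * D * (1 - radius_pow x) / radius_pow x ^+ 2}.
Proof.
have mu_u := Lfun2_measurable u_L2.
have iu := integrable_supported_ball u_out u_L2.
have [G mG uG] := radial_representative n0 mu_u u_radial.
have D0 : 0 <= D by apply: Rintegral_ge0 => x _; exact: sqnorm_ge0.
have c0 := @ballvol_gt0 R n.
pose I0 : set (measurableTypeR R) := `]0, +oo[%classic.
have mI0 : measurable I0 by exact: measurable_itv.
(* The profile matters only at positive values of [radius_pow]; extension by zero makes it
   integrable on the line, as Lebesgue differentiation requires. *)
pose G1 : measurableTypeR R -> R := G \_ I0.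
have mG1 : measurable_fun setT G1.
  by apply/(measurable_restrictT _ _).1 => //; exact: measurable_funTS.
have uG1 : {ae mu, forall x, u x = G1 (radius_pow x)}.
  have mE : measurable [set x : 'rV[R]_n | radius_pow x \in `[0, 0]].
    exact: measurable_radius_pow_itv.
  have E0 : {ae mu, forall x : 'rV[R]_n, 0 < radius_pow x}.
    exists [set x : 'rV[R]_n | radius_pow x \in `[0, 0]]; split => //.
      by rewrite lebesgue_radius_pow_itv// subrr mulr0.
    move=> x /= /negP; rewrite -leNgt => x0; rewrite in_itv/= x0 andbT.
    exact: radius_pow_ge0.
  apply: filterS2 uG E0 => x -> x0.
  by rewrite /G1 patchE mem_set// /I0/= in_itv/= andbT.
(* [G1] matches the nonnegative [u] only almost everywhere, hence the absolute value. *)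
have transfer (B : set (measurableTypeR R)) : measurable B ->
    (\int[mu]_(x in @radius_pow R n @^-1` B) (u x)%:E =
     (ballvol n)%:E * \int[leb]_(t in B) `|G1 t|%:E)%E.
  move=> mB.
  pose f : measurableTypeR R -> \bar R := (fun t => `|G1 t|%:E) \_ B.
  have mf : measurable_fun setT f.
    apply/(measurable_restrictT _ _).1 => //; apply/measurable_EFinP.
    apply: measurableT_comp => //; exact: measurable_funTS.
  have f0 t : (0 <= f t)%E by rewrite /f patchE; case: ifP; rewrite ?lee_fin.
  have mpre : measurable (@radius_pow R n @^-1` B).
    by rewrite -[X in measurable X]setTI; exact: measurable_radius_pow.
  rewrite integral_mkcond.
  transitivity (\int[mu]_x f (radius_pow x))%E.
    apply: ge0_ae_eq_integral => //.
    - apply/(measurable_restrictT _ _).1 => //; apply/measurable_EFinP.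
      exact: measurable_funTS.
    - by apply: (measurableT_comp mf); exact: measurable_radius_pow.
    - by move=> x _; rewrite patchE; case: ifP; rewrite ?lee_fin.
    - apply: filterS uG1 => x ux _; rewrite /f !patchE.
      rewrite (_ : (x \in _) = (radius_pow x \in B)); last by apply/idP/idP; rewrite !inE.
      by case: ifP => // _; rewrite -ux ger0_norm.
  rewrite ge0_integral_radius_pow//; congr (_ * _)%E.
  rewrite [LHS]integral_mkcond [RHS]integral_mkcond; apply: eq_integral => t _.
  rewrite /f !patchE; case: ifPn => // /negP; rewrite inE/= in_itv/= andbT => t0.
  case: ifP => // _; rewrite /G1 patchE memNset ?normr0// /I0/= in_itv/= andbT => t1.
  by apply: t0; exact: ltW.
have iG1 : leb.-integrable setT (EFin \o G1).
  apply/integrableP; split; first exact/measurable_EFinP.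
  have := transfer setT measurableT; rewrite preimage_setT => E.
  have : (\int[mu]_x (u x)%:E < +oo)%E.
    have := integrable_fin_num measurableT iu.
    by rewrite ge0_fin_numE// integral_ge0// => x _; rewrite lee_fin.
  rewrite E => /= h; rewrite ltNge; apply/negP; rewrite leye_eq => /eqP hy.
  by move: h; rewrite hy gt0_muley// lte_fin.
have transferR (B : set (measurableTypeR R)) : measurable B ->
    \int[mu]_(x in @radius_pow R n @^-1` B) u x = ballvol n * (\int[leb]_(t in B) `|G1 t|).
  move=> mB; rewrite {1}/Rintegral transfer// fineM//.
  apply: integrable_fin_num => //; apply: integrableS (integrable_abse iG1) => //.
have key t : 0 < t < 1 -> lebesgue_pt G1 t ->
    G1 t ^+ 2 <= radial_cst * D * (1 - t) / t ^+ 2.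
  move=> /andP[t0 t1] lt.
  pose k : R := flat 0 1 / 4.
  have k0 : 0 < k by rewrite divr_gt0// flat_gt0.
  have nR0 : 0 < n%:R :> R by rewrite ltr0n.
  (* The factor that turns the shell quantity bounded in [est2] into the average of |G1| over
     [ball t w]; see [avgE]. *)
  pose P : R := 2 / (n%:R * k * t * ballvol n).
  have P0 : 0 < P by apply: divr_gt0 => //; do 3 apply: mulr_gt0 => //.
  have -> : radial_cst * D * (1 - t) / t ^+ 2 =
      4 * (P * D / 2) * (P * (ballvol n * (1 - t)) / 2).
    rewrite /radial_cst /P -/k; field.
    by rewrite (gt_eqF c0) (gt_eqF t0) (gt_eqF k0) (gt_eqF nR0).
  rewrite -(real_normK (num_real (G1 t))); apply: le_amgm => //.
  - by apply: divr_ge0 => //; apply: mulr_ge0 => //; exact: ltW.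
  - apply: divr_ge0 => //; apply: mulr_ge0; first exact: ltW.
    by apply: mulr_ge0; [exact: ltW|rewrite subr_ge0 ltW].
  move=> e e0; apply/ler_addgt0Pr => z z0.
  have z20 : 0 < z / 2 by rewrite divr_gt0.
  have [e1 e10 He] := lebesgue_pt_le_avg iG1 lt z20.
  (* [w < e1] serves the Lebesgue point, [w <= t / 12] yields a >= t^2 / 2 below, and the last bound
     makes the excess [6 * w] in the volume cost at most z/2. *)
  pose w := Num.min (e1 / 2) (Num.min (t / 12) (Num.min ((1 - t) / 2) (z * e / (6 * P * ballvol n)))).
  have w0 : 0 < w.
    rewrite !lt_min; apply/and4P; split; apply: divr_gt0 => //.
    - by rewrite subr_gt0.
    - exact: mulr_gt0.
    - by do 2 apply: mulr_gt0 => //.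
  have we1 : w < e1 by rewrite gt_min ltr_pdivrMr// ltr_pMr// ltr1n.
  have wt : w <= t / 12 by rewrite !ge_min lexx orbT.
  have wt1 : w <= (1 - t) / 2 by rewrite !ge_min lexx !orbT.
  have wz : w <= z * e / (6 * P * ballvol n) by rewrite !ge_min lexx !orbT.
  have := He w; rewrite w0 we1 => /(_ isT)/le_trans; apply.
  have mB : measurable (ball t w : set (measurableTypeR R)) by exact: measurable_ball.
  have := transferR _ mB.
  have -> : @radius_pow R n @^-1` ball t w = sq_annulus ((t - w) ^+ 2) ((t + w) ^+ 2).
    apply/seteqP; split => x /=; rewrite /ball/= /sq_annulus/= sqradius_powE ltr_distlC;
    by rewrite !ltr_pXn2r// ?nnegrE ?radius_pow_ge0//; lra.
  set J := \int[mu]_(x in _) _; set J1 := \int[leb]_(s in _) _ => JE.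
  pose h := 4 * t * w; pose a := (t - w) ^+ 2 - h.
  have h0 : 0 < h by rewrite !mulr_gt0.
  have a_ge : t ^+ 2 / 2 <= a by rewrite /a /h; nra.
  have a0 : 0 < a by rewrite (lt_le_trans _ a_ge)// divr_gt0// exprn_gt0.
  have a1 : a < 1 by rewrite /a /h; nra.
  have sa : t - 6 * w <= Num.sqrt a.
    rewrite -(@ler_pXn2r _ 2%N)// ?nnegrE ?sqrtr_ge0//; first by rewrite sqr_sqrtr ?(ltW a0)// /a /h; nra.
    by lra.
  have a01 : 0 < a < 1 by rewrite a0.
  have := annulus_estimate n0 u_ge0 u_out u_L2 u_Du a01 h0 e0.
  have -> : a + h = (t - w) ^+ 2 by rewrite /a subrK.
  have -> : a + 2 * h = (t + w) ^+ 2 by rewrite /a /h; ring.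
  rewrite -/J -/D -/k => est.
  have J0 : 0 <= J by apply: Rintegral_ge0.
  have est2 : n%:R * k * t / (4 * w) * J <= e / 2 * D + ballvol n * (1 - t + 6 * w) / (2 * e).
    apply: (@le_trans _ _ (2 * n%:R / h * a * k * J)).
      apply: ler_wpM2r => //.
      have -> : n%:R * k * t / (4 * w) = 2 * n%:R / h * (t ^+ 2 / 2) * k.
        by rewrite /h; field; rewrite (gt_eqF w0) (gt_eqF t0).
      apply: ler_wpM2r; first exact: ltW.
      apply: ler_wpM2l => //; apply: divr_ge0; last exact: ltW.
      by apply: mulr_ge0.
    apply: (le_trans est); rewrite lerD2l; apply: ler_wpM2r.
      by rewrite invr_ge0; apply: mulr_ge0 => //; exact: ltW.
    by apply: ler_wpM2l; [exact: ltW|lra].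
  have avgE : (2 * w)^-1 * J1 = P * (n%:R * k * t / (4 * w) * J).
    by rewrite JE /P; field; rewrite (gt_eqF c0) (gt_eqF t0) (gt_eqF k0) (gt_eqF nR0) (gt_eqF w0).
  rewrite avgE.
  apply: (@le_trans _ _ (z / 2 + P * (e / 2 * D + ballvol n * (1 - t + 6 * w) / (2 * e)))).
    by rewrite lerD2l; apply: ler_wpM2l => //; exact: ltW.
  have wz2 : P * (ballvol n * (6 * w) / (2 * e)) <= z / 2.
    have pc0 : 0 < 6 * P * ballvol n by do 2 apply: mulr_gt0 => //.
    move: wz; rewrite ler_pdivlMr// => wz.
    have -> : P * (ballvol n * (6 * w) / (2 * e)) = w * (6 * P * ballvol n) / (2 * e).
      by field; rewrite (gt_eqF e0).
    by rewrite ler_pdivrMr ?mulr_gt0//; lra.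
  have -> : P * (e / 2 * D + ballvol n * (1 - t + 6 * w) / (2 * e)) =
    e * (P * D / 2) + P * (ballvol n * (1 - t)) / 2 / e + P * (ballvol n * (6 * w) / (2 * e)).
    by field; rewrite (gt_eqF e0).
  lra.
have locG : locally_integrable setT G1 by apply: open_integrable_locally => //; exact: openT.
have [N [mN N0 NS]] := lebesgue_differentiation locG.
have N0' : mu (@radius_pow R n @^-1` (N `&` `[0, +oo[%classic)) = 0%E.
  rewrite lebesgue_radius_pow//.
  - by rewrite (subset_measure0 _ mN _ N0) ?mule0//; exact: measurableI.
  - exact: measurableI.
have Nae : {ae mu, forall x, ~ N (radius_pow x)}.
  exists (@radius_pow R n @^-1` (N `&` `[0, +oo[%classic)); split => //.
    by rewrite -[X in measurable X]setTI; apply: measurable_radius_pow => //; exact: measurableI.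
  by move=> x /= /contrapT Nx; split => //=; rewrite in_itv/= andbT radius_pow_ge0.
apply: filterS2 uG1 Nae => x -> Nx x01; apply: key => //.
by apply: contrapT => h; apply: Nx; exact: NS.
Qed.

End radial_pointwise.

(** * Weighted integral of a radial function *)

Section radial_integral.
Context {R : realType}.
Local Notation leb := (@lebesgue_measure R).

Lemma powR_le_expn (t a : R) N : 0 <= t <= 1 -> N%:R <= a -> t `^ a <= t ^+ N.
Proof.
move=> /andP[t0 t1] Na; rewrite -powR_mulrn//.
move: t0; rewrite le_eqVlt => /predU1P[<-|t0].
  have [a0|a0] := eqVneq a 0; last by rewrite powR0// powR_ge0.
  by have -> : N%:R = a by apply/eqP; rewrite eq_le Na a0 ler0n.
rewrite /powR gt_eqF// ler_expR; apply: ler_wnM2r => //.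
by rewrite -ln1 ler_ln// posrE.
Qed.

(** t^b <= exp(- b (1 - t)) <= 1 / (1 + b (1 - t)). This expresses that the weight sees only a layer
    of width 1/b. *)
Lemma powR_onem_le (t b : R) : 0 < t <= 1 -> 0 < b -> t `^ b * (1 - t) <= b^-1.
Proof.
move=> /andP[t0 t1] b0.
have lnt : ln t <= t - 1.
  have := @le_ln1Dx R (t - 1); rewrite (_ : 1 + (t - 1) = t); last by ring.
  by apply; lra.
have s0 : 0 <= b * (1 - t) by rewrite mulr_ge0 ?(ltW b0)// subr_ge0.
have h1 : t `^ b <= (1 + b * (1 - t))^-1.
  rewrite /powR gt_eqF//.
  apply: (@le_trans _ _ (expR (- (b * (1 - t))))).
    by rewrite ler_expR -mulrN opprB ler_wpM2l// ltW.
  by rewrite expRN lef_pV2 ?posrE ?expR_gt0 ?ltr_wpDr// expR_ge1Dx.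
apply: (@le_trans _ _ ((1 + b * (1 - t))^-1 * (1 - t))).
  by rewrite ler_wpM2r// subr_ge0.
rewrite mulrC ler_pdivrMr ?ltr_wpDr//.
by rewrite mulrDr mulr1 mulrA mulVf ?gt_eqF// mul1r lerDr invr_ge0 ltW.
Qed.

Lemma integral_expn01 N :
  (\int[leb]_(t in `[0%R, 1%R]) (t ^+ N)%:E = (N.+1%:R^-1)%:E)%E.
Proof.
pose F (t : R) := N.+1%:R^-1 * t ^+ N.+1.
have dF (t : R) : is_derive t 1 F (t ^+ N).
  have d1 := is_deriveM (is_derive_cst (N.+1%:R^-1 : R) t (1 : R)) (is_deriveX N.+1 (is_derive_id t (1 : R))).
  have h : is_derive t 1 (cst N.+1%:R^-1 * id ^+ N.+1 : R -> R) (t ^+ N).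
    apply: is_derive_eq d1 _; rewrite /GRing.scale/=.
    have : N.+1%:R != 0 :> R by rewrite pnatr_eq0.
    by move: (N.+1%:R : R) => k k0; field.
  by rewrite (_ : F = cst N.+1%:R^-1 * id ^+ N.+1)//; apply/funext => s; rewrite /F !fctE.
have cF : continuous F.
  by move=> t; apply: differentiable_continuous; apply/derivable1_diffP; have [] := dF t.
rewrite (@continuous_FTC2 _ _ F).
- by rewrite /F expr1n expr0n/= mulr0 mulr1 -EFinB subr0.
- exact: ltr01.
- by apply: continuous_subspaceT => t; exact: exprn_continuous.
- split; first by move=> t _; have [] := dF t.
  + by apply: cvg_at_right_filter; exact: cF.
  + by apply: cvg_at_left_filter; exact: cF.
- by move=> t _; rewrite derive1E; have [] := dF t.
Qed.

(** Write t^A = (t^p)^(q/2) with p = 2A/q and split t^p into three powers: t^(p/4) absorbs 1 - t and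
    leaves 4/p = 2q/A, t^(p/2) absorbs the singularity t^(-2) because p >= 4, and the remaining
    t^(p/4) becomes t^(A/4) <= t^N, kept for integration. *)
Lemma weighted_powR_le (M A q t : R) (N : nat) : 0 <= M -> 0 < q -> 2 * q <= A ->
  N%:R <= A / 4 -> 0 < t < 1 ->
  t `^ A * (M * (1 - t) / t ^+ 2) `^ (q / 2) <= (M * (2 * q / A)) `^ (q / 2) * t ^+ N.
Proof.
move=> M0 q0 qA NA /andP[t0 t1].
have A0 : 0 < A by rewrite (lt_le_trans _ qA)// mulr_gt0.
have q20 : 0 < q / 2 by rewrite divr_gt0.
pose p : R := A * 2 / q.
have p4 : 4 <= p by rewrite /p ler_pdivlMr//; lra.
have -> : t `^ A = (t `^ p) `^ (q / 2).
  by rewrite -powRrM; congr (_ `^ _); rewrite /p; field; rewrite gt_eqF.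
have onet : 0 <= 1 - t by rewrite subr_ge0 ltW.
rewrite -powRM ?powR_ge0//; last by rewrite divr_ge0 ?sqr_ge0 ?mulr_ge0//.
have tt : t `^ (A / 4) <= t ^+ N.
  by apply: powR_le_expn => //; rewrite !ltW.
apply: le_trans (ler_wpM2l (powR_ge0 _ _) tt).
have -> : t `^ (A / 4) = (t `^ (p / 4)) `^ (q / 2).
  by rewrite -powRrM; congr (_ `^ _); rewrite /p; field; rewrite gt_eqF.
have MqA : 0 <= M * (2 * q / A) by rewrite mulr_ge0// divr_ge0 ?mulr_ge0// ltW.
rewrite -powRM ?powR_ge0//; apply: ge0_ler_powR.
- exact: ltW.
- by rewrite nnegrE mulr_ge0 ?powR_ge0// divr_ge0 ?sqr_ge0 ?mulr_ge0//.
- by rewrite nnegrE mulr_ge0 ?powR_ge0.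
have E : t `^ p = t `^ (p / 4) * t `^ (p / 4) * t `^ (p / 2).
  by rewrite -!powRD ?(gt_eqF t0) ?implybT//; congr (_ `^ _); field.
have t2 : t `^ (p / 2) <= t ^+ 2.
  by apply: powR_le_expn; [rewrite !ltW|lra].
have b0 : 0 < p / 4 by rewrite divr_gt0// (lt_le_trans _ p4).
have onem : t `^ (p / 4) * (1 - t) <= 2 * q / A.
  have := @powR_onem_le t (p / 4); rewrite t0 (ltW t1) b0 => /(_ isT isT)/le_trans; apply.
  by rewrite /p le_eqVlt; apply/orP; left; apply/eqP; field; rewrite !gt_eqF.
rewrite E.
have -> : t `^ (p / 4) * t `^ (p / 4) * t `^ (p / 2) * (M * (1 - t) / t ^+ 2) =
  (M * t `^ (p / 4)) * (t `^ (p / 4) * (1 - t)) * (t `^ (p / 2) / t ^+ 2).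
  by field; rewrite gt_eqF.
apply: (@le_trans _ _ ((M * t `^ (p / 4)) * (2 * q / A) * 1)).
  apply: ler_pM.
  - by rewrite !mulr_ge0 ?powR_ge0.
  - by rewrite divr_ge0 ?sqr_ge0 ?powR_ge0//.
  - by rewrite ler_wpM2l// mulr_ge0 ?powR_ge0.
  - by rewrite ler_pdivrMr ?exprn_gt0// mul1r.
by rewrite mulr1 mulrAC.
Qed.

Context {n : nat}.
Hypothesis n0 : (0 < n)%N.
Local Notation mu := (@lebesgue_rV R n).

Lemma enorm_powR (x : 'rV[R]_n) (alpha : R) :
  enorm x `^ alpha = radius_pow x `^ (alpha / n%:R).
Proof.
rewrite /radius_pow -powR_mulrn ?enorm_ge0// -powRrM mulrC divfK//.
by rewrite pnatr_eq0 -lt0n.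
Qed.

Lemma radial_weighted_integral (u : 'rV[R]_n -> R) (M A q : R) :
  measurable_fun setT u -> 0 <= M -> 0 < q -> 2 * q <= A ->
  {ae mu, forall x, 0 < radius_pow x < 1 ->
    u x ^+ 2 <= M * (1 - radius_pow x) / radius_pow x ^+ 2} ->
  (\int[mu]_(x in unit_ball) (radius_pow x `^ A * `|u x| `^ q)%:E <=
   (ballvol n * (4 / A) * (M * (2 * q / A)) `^ (q / 2))%:E)%E.
Proof.
move=> mu_u M0 q0 qA bnd.
have A0 : 0 < A by rewrite (lt_le_trans _ qA)// mulr_gt0.
have c0 := @ballvol_gt0 R n.
(* An integer exponent gives the explicit integral 1/(N+1), which is at most 4/A as A/4 < N + 1. *)
pose N := Num.truncn (A / 4).
have NA : N%:R <= A / 4 by rewrite truncn_le// divr_ge0// ltW.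
have AN : A / 4 < N.+1%:R by exact: truncnS_gt.
pose K := (M * (2 * q / A)) `^ (q / 2).
pose I01 : set (measurableTypeR R) := `[0, 1]%classic.
have mI01 : measurable I01 by exact: measurable_itv.
pose f : measurableTypeR R -> \bar R := (fun t => (K * t ^+ N)%:E) \_ I01.
have mKt : measurable_fun setT (fun t : measurableTypeR R => (K * t ^+ N)%:E).
  by apply/measurable_EFinP; apply: measurable_funM => //; exact: measurable_funX.
have mf : measurable_fun setT f.
  by apply/(measurable_restrictT _ _).1 => //; exact: measurable_funTS.
have Kt0 (t : R) : 0 <= t -> 0 <= K * t ^+ N.
  by move=> t0; rewrite mulr_ge0 ?powR_ge0// exprn_ge0.
have f0 t : (0 <= f t)%E.
  rewrite /f patchE; case: ifP => //; rewrite inE /I01/= in_itv/= => /andP[t0 _].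
  by rewrite lee_fin Kt0.
have posae : {ae mu, forall x : 'rV[R]_n, 0 < radius_pow x}.
  exists [set x : 'rV[R]_n | radius_pow x \in `[0, 0]]; split => //.
  - exact: measurable_radius_pow_itv.
  - by rewrite lebesgue_radius_pow_itv// subrr mulr0.
  move=> x /= /negP; rewrite -leNgt => x0; rewrite in_itv/= x0 andbT.
  exact: radius_pow_ge0.
have mr := @measurable_radius_pow R n.
rewrite integral_mkcond.
apply: (@le_trans _ _ (\int[mu]_x f (radius_pow x))%E).
  apply: ae_ge0_le_integral => //.
  - by move=> x _; rewrite patchE; case: ifP => // _; rewrite lee_fin mulr_ge0 ?powR_ge0.
  - apply/(measurable_restrictT _ _).1; first exact: measurable_unit_ball.
    apply: measurable_funTS; apply/measurable_EFinP; apply: measurable_funM.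
      apply: (@measurableT_comp _ _ _ _ _ _ (fun t : R => t `^ A)) => //.
    apply: (@measurableT_comp _ _ _ _ _ _ (fun t : R => t `^ q)).
      exact: measurable_powR.
    exact: measurableT_comp.
  - exact: (measurableT_comp mf).
  apply: filterS2 posae bnd => x x0 ux _.
  rewrite [leLHS]patchE; case: ifPn => [|_]; last exact: f0.
  rewrite inE => /(unit_ball_sqradius_pow n0); rewrite sqradius_powE => x1.
  have {}x1 : radius_pow x < 1 by rewrite -(expr_lt1 _ (radius_pow_ge0 x) (n := 2)).
  rewrite /f patchE mem_set ?lee_fin; last by rewrite /I01/= in_itv/= !ltW.
  have x01 : 0 < radius_pow x < 1 by rewrite x0.
  apply: le_trans (weighted_powR_le M0 q0 qA NA x01).
  apply: ler_wpM2l; first exact: powR_ge0.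
  have -> : `|u x| `^ q = (u x ^+ 2) `^ (q / 2).
    by rewrite -real_normK ?num_real// -powR_mulrn// -powRrM mulrC divfK.
  apply: ge0_ler_powR => //; [by rewrite divr_ge0// ltW| | |exact: ux].
  - by rewrite nnegrE sqr_ge0.
  - by rewrite nnegrE divr_ge0 ?sqr_ge0// mulr_ge0// subr_ge0 ltW.
rewrite ge0_integral_radius_pow// -/K.
have -> : (ballvol n * (4 / A) * K)%:E = ((ballvol n)%:E * (4 / A * K)%:E)%E.
  by rewrite -EFinM -!mulrA.
rewrite lee_pmul2l// ?lte_fin//.
have -> : (\int[leb]_(t in `[0%R, +oo[) f t = \int[leb]_(t in `[0%R, 1%R]) (K * t ^+ N)%:E)%E.
  rewrite [LHS]integral_mkcond [RHS]integral_mkcond; apply: eq_integral => t _.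
  rewrite /f !patchE; have [t01|t01] := boolP (t \in I01).
    rewrite mem_set//; move: t01; rewrite inE /I01/= !in_itv/= => /andP[-> _].
    by [].
  by case: ifP.
under eq_integral do rewrite EFinM.
rewrite ge0_integralZl//; last 3 first.
- by apply/measurable_EFinP; exact: measurable_funX.
- by move=> t; rewrite /= in_itv/= => /andP[t0 _]; rewrite lee_fin exprn_ge0.
- by rewrite lee_fin powR_ge0.
rewrite integral_expn01 -!EFinM lee_fin mulrC ler_wpM2r ?powR_ge0//.
by rewrite -[leRHS]invf_div lef_pV2 ?posrE ?divr_gt0// ltW.
Qed.

End radial_integral.

Section radial_lower_bound.
Context {R : realType} {n : nat}.
Hypothesis n0 : (0 < n)%N.
Local Notation mu := (@lebesgue_rV R n).
Implicit Types (u v : 'rV[R]_n -> R) (Du : 'rV[R]_n -> 'rV[R]_n).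

(** Sign and support of a ground state are known almost everywhere, whereas the shell estimate takes
    them everywhere; this permits a change of representative. *)
Lemma weak_gradient_ae_eq u v Du : u \in Lfun mu 2%:E -> measurable_fun setT v ->
  {ae mu, forall x, u x = v x} -> weak_gradient u Du -> weak_gradient v Du.
Proof.
move=> u2 mv uv hDu i; have [Du2 hphi] := hDu i; split => // phi tphi.
rewrite -hphi//; apply: ae_eq_integral => //.
- have [sphi _] := tphi.
  apply/measurable_EFinP; apply: measurable_funM => //.
  by apply: continuous_measurable_rV; case: (sphi [:: i]).
- have [sphi _] := tphi.
  apply/measurable_EFinP; apply: measurable_funM; first exact: (Lfun2_measurable u2).
  by apply: continuous_measurable_rV; case: (sphi [:: i]).
- by apply: filterS uv => x -> _.
Qed.

Lemma Lfun2_ae_eq u v : measurable_fun setT v -> {ae mu, forall x, u x = v x} ->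
  u \in Lfun mu 2%:E -> v \in Lfun mu 2%:E.
Proof.
move=> mv uv u2; apply: integrable_sqr_Lfun2 => //.
have := Lfun2_integrable_sqr u2; move/integrableP => [m1 f1].
have m2 : measurable_fun [set: 'rV[R]_n] (EFin \o (fun x => v x ^+ 2)).
  by apply/measurable_EFinP; exact: measurable_funX.
apply/integrableP; split => //.
apply: le_lt_trans f1; rewrite le_eqVlt; apply/orP; left; apply/eqP.
apply: ae_eq_integral => //.
- exact: measurableT_comp.
- exact: measurableT_comp.
- by apply: filterS uv => x /= -> _.
Qed.

Lemma dirichlet_unit_ball u Du : weak_gradient u Du ->
  dirichlet unit_ball Du = (\int[mu]_(x in unit_ball) sqnorm (Du x))%:E.
Proof.
move=> hDu; rewrite /dirichlet; under eq_integral do rewrite sqr_enorm.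
rewrite /Rintegral fineK//; apply: integrable_fin_num; first exact: measurable_unit_ball.
apply: integrableS (integrable_sqnorm_weak_gradient hDu) => //.
exact: measurable_unit_ball.
Qed.

(** Bounds the denominator from above, hence the quotient from below. In terms of [radius_pow] the
    weight has exponent A = alpha / n, and the constant depends on [n] and [q] alone. *)
Lemma radial_lower_bound (q : R) : 0 < q -> exists2 C : R, 0 < C &
  forall alpha u Du, 2 * q * n%:R < alpha -> X2 u ->
    {ae mu, forall x, unit_ball x -> 0 < u x} -> weak_gradient u Du -> radial u ->
    (\int[mu]_(x in unit_ball) (enorm x `^ alpha * `|u x| `^ q)%:E <=
     (C * alpha^-1 * (\int[mu]_(x in unit_ball) sqnorm (Du x) / alpha) `^ (q / 2))%:E)%E.
Proof.
move=> q0; have nR0 : 0 < n%:R :> R by rewrite ltr0n.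
have C0 := @radial_cst_gt0 R n n0.
have c0 := @ballvol_gt0 R n.
exists (ballvol n * (4 * n%:R) * (@radial_cst R n * (2 * q * n%:R)) `^ (q / 2)).
  apply: mulr_gt0; first by do 2 apply: mulr_gt0 => //.
  by apply: powR_gt0; do 3 apply: mulr_gt0 => //.
move=> alpha u Du qa [[u2 _] uout] upos hDu urad.
have mu_u := Lfun2_measurable u2.
have alpha0 : 0 < alpha by apply: lt_trans qa; do 2 apply: mulr_gt0 => //.
(* The representative that is nonnegative everywhere and zero at every point off the ball. *)
pose v : 'rV[R]_n -> R := (fun x => Num.max (u x) 0) \_ unit_ball.
have mv : measurable_fun setT v.
  apply/(measurable_restrictT _ _).1; first exact: measurable_unit_ball.
  by apply: measurable_funTS; exact: measurable_maxr.
have uv : {ae mu, forall x, u x = v x}.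
  apply: filterS2 uout upos => x ux1 ux2; rewrite /v patchE.
  have [xB|xB] := boolP (x \in unit_ball).
    by rewrite max_l// ltW// ux2//; move: xB; rewrite inE.
  by apply: ux1; move/negP: xB; rewrite inE.
have v2 := Lfun2_ae_eq mv uv u2.
have hDv := weak_gradient_ae_eq u2 mv uv hDu.
have v0 x : 0 <= v x.
  by rewrite /v patchE; case: ifP => // _; rewrite le_max lexx orbT.
have vout x : ~ unit_ball x -> v x = 0 by move=> xB; rewrite /v patchE memNset.
have vrad : radial v.
  have [g gu] := urad; exists g.
  by apply: filterS2 gu uv => x <- <-.
have bnd := radial_pointwise_bound n0 v0 vout v2 hDv vrad.
have mB := @measurable_unit_ball R n.
have mw : measurable_fun [set: 'rV[R]_n] (fun x => enorm x `^ alpha).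
  apply: (@measurableT_comp _ _ _ _ _ _ (fun t : R => t `^ alpha)) => //.
  exact: measurable_enorm.
have mpow (w : 'rV[R]_n -> R) : measurable_fun [set: 'rV[R]_n] w ->
    measurable_fun [set: 'rV[R]_n] (fun x => (enorm x `^ alpha * `|w x| `^ q)%:E).
  move=> mw'; apply/measurable_EFinP; apply: measurable_funM => //.
  apply: (@measurableT_comp _ _ _ _ _ _ (fun t : R => t `^ q)) => //.
  exact: measurableT_comp.
have -> : (\int[mu]_(x in unit_ball) (enorm x `^ alpha * `|u x| `^ q)%:E =
    \int[mu]_(x in unit_ball) (enorm x `^ alpha * `|v x| `^ q)%:E)%E.
  apply: ae_eq_integral => //.
  - by apply: measurable_funTS; exact: mpow.
  - by apply: measurable_funTS; exact: mpow.
  - by apply: filterS uv => x -> _.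
under eq_integral do rewrite (enorm_powR n0).
set D := \int[mu]_(x in _) _ in bnd *.
have D0 : 0 <= D by apply: Rintegral_ge0 => x _; exact: sqnorm_ge0.
have M0 : 0 <= @radial_cst R n * D by rewrite mulr_ge0// ltW.
have qA : 2 * q <= alpha / n%:R by rewrite ler_pdivlMr// ltW.
apply: le_trans (radial_weighted_integral n0 mv M0 q0 qA bnd) _.
rewrite lee_fin le_eqVlt; apply/orP; left; apply/eqP.
have -> : @radial_cst R n * D * (2 * q / (alpha / n%:R)) =
    @radial_cst R n * (2 * q * n%:R) * (D / alpha).
  by field; rewrite (gt_eqF nR0) (gt_eqF alpha0).
have h1 : 0 <= @radial_cst R n * (2 * q * n%:R).
  by apply: mulr_ge0; [exact: ltW|apply: mulr_ge0 => //; apply: mulr_ge0 => //; exact: ltW].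
have h2 : 0 <= D / alpha by apply: divr_ge0 => //; exact: ltW.
rewrite [LHS]mulrC powRM//.
by field; rewrite (gt_eqF nR0) (gt_eqF alpha0).
Qed.

End radial_lower_bound.

(** * The competitor near the boundary *)

Section cube_bump.
Context {R : realType}.

Definition bump1 (t : R) : R := smooth_step (2 - t) * smooth_step (2 + t).

Lemma bump1_ge0 t : 0 <= bump1 t.
Proof. by rewrite mulr_ge0 ?smooth_step_ge0. Qed.

Lemma bump1_le1 t : bump1 t <= 1.
Proof. by rewrite -[leRHS](mul1r 1) ler_pM ?smooth_step_ge0 ?smooth_step_le1. Qed.

Lemma bump1_eq1 t : `|t| <= 1 -> bump1 t = 1.
Proof.
rewrite ler_norml => /andP[t1 t2].
by rewrite /bump1 !smooth_step_ge1 ?mulr1//; lra.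
Qed.

Lemma bump1_eq0 t : 2 <= `|t| -> bump1 t = 0.
Proof.
rewrite ler_normr => /orP[] t2; rewrite /bump1.
  by rewrite [smooth_step (2 - t)]smooth_step_le0 ?mul0r//; lra.
by rewrite [smooth_step (2 + t)]smooth_step_le0 ?mulr0//; lra.
Qed.

Lemma ler_norm_mulB (a b c d : R) : 0 <= a <= 1 -> 0 <= b <= 1 ->
  0 <= c <= 1 -> 0 <= d <= 1 -> `|a * b - c * d| <= `|a - c| + `|b - d|.
Proof.
move=> /andP[a0 a1] _ _ /andP[d0 d1].
have -> : a * b - c * d = a * (b - d) + d * (a - c) by ring.
apply: le_trans (ler_normD _ _) _; rewrite addrC !normrM (ger0_norm a0) (ger0_norm d0).
by apply: lerD; rewrite ler_piMl.
Qed.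

Lemma bump1_lipschitz : exists2 L, 0 < L &
  forall s t, `|bump1 s - bump1 t| <= L * `|s - t|.
Proof.
have [C C0 HC] := @smooth_step_lipschitz R.
exists (2 * C) => [|s t]; first exact: mulr_gt0.
apply: (le_trans (ler_norm_mulB _ _ _ _));
  rewrite ?smooth_step_ge0 ?smooth_step_le1//.
have := HC (2 - s) (2 - t); have := HC (2 + s) (2 + t).
have -> : 2 + s - (2 + t) = s - t by ring.
have -> : 2 - s - (2 - t) = - (s - t) by ring.
by rewrite normrN; lra.
Qed.

Context {n : nat}.
Local Notation mu := (@lebesgue_rV R n).
Implicit Types (p x y : 'rV[R]_n) (l r : R).

Definition rV_cube p r : set 'rV[R]_n :=
  rV_box (fun i => `[p 0 i - r, p 0 i + r]%classic).

Lemma rV_cubeE p r x : rV_cube p r x <-> forall i, `|x 0 i - p 0 i| <= r.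
Proof. by split=> h i; have := h i; rewrite /= in_itv/= ler_distl. Qed.

Lemma measurable_rV_cube p r : measurable (rV_cube p r).
Proof. exact: measurable_rV_box. Qed.

Lemma lebesgue_rV_cube_at p r : 0 <= r -> mu (rV_cube p r) = ((2 * r) ^+ n)%:E.
Proof.
move=> r0; rewrite lebesgue_rV_boxE//.
rewrite (eq_bigr (fun=> (2 * r)%:E)); first by rewrite prodEFin prodr_const card_ord.
move=> i _; rewrite lebesgue_measure_itv/= lte_fin.
move: r0; rewrite le_eqVlt => /predU1P[<-|r0].
  by rewrite subr0 addr0 ltxx mulr0.
rewrite ltrBlDr -addrA ltrDl addr_gt0// -EFinB; congr EFin; ring.
Qed.

(** [l] is an inverse length: the plateau has half-side 1/l and the support half-side 2/l. The
    product form makes both sets cubes, whose volumes are explicit. *)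
Definition cube_bump l p x : R := \prod_i bump1 (l * (x 0 i - p 0 i)).

Lemma elementary_cube_bump l p : elementary (cube_bump l p).
Proof.
apply: elementary_prod => i.
have e1 : elementary (fun x : 'rV[R]_n => l * (x 0 i - p 0 i)).
  apply: elementary_mul; first exact: elementary_cst.
  by apply: elementary_add; [exact: elementary_coord|exact: elementary_cst].
apply: elementary_mul; apply: elementary_smooth_step.
  by apply: elementary_add; [exact: elementary_cst|exact: elementary_opp].
by apply: elementary_add; [exact: elementary_cst|].
Qed.

Lemma cube_bump_bounds l p x : 0 <= cube_bump l p x <= 1.
Proof.
rewrite prodr_ge0; last by move=> i _; exact: bump1_ge0.
by rewrite prodr_ile1// => i _; rewrite bump1_ge0 bump1_le1.
Qed.

Lemma cube_bump_eq1 l p x : 0 < l -> rV_cube p l^-1 x -> cube_bump l p x = 1.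
Proof.
move=> l0 /rV_cubeE px; rewrite /cube_bump big1// => i _; apply: bump1_eq1.
by rewrite normrM gtr0_norm// -ler_pdivlMl// mulr1.
Qed.

Lemma cube_bump_eq0 l p x : 0 < l -> ~ rV_cube p (2 / l) x -> cube_bump l p x = 0.
Proof.
move=> l0 px; have [i xi] : exists i, 2 / l < `|x 0 i - p 0 i|.
  apply: contrapT => h; apply: px; apply/rV_cubeE => i; rewrite leNgt.
  by apply/negP => xi; apply: h; exists i.
rewrite /cube_bump (bigD1 i)//= bump1_eq0 ?mul0r//.
by rewrite normrM gtr0_norm// -ler_pdivrMl// mulrC ltW.
Qed.

Lemma ler_norm_prodB (I : Type) (s : seq I) (f g : I -> R) :
  (forall i, 0 <= f i <= 1) -> (forall i, 0 <= g i <= 1) ->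
  `|\prod_(i <- s) f i - \prod_(i <- s) g i| <= \sum_(i <- s) `|f i - g i|.
Proof.
move=> f01 g01; elim: s => [|i s IH]; first by rewrite !big_nil subrr normr0.
rewrite !big_cons; apply: le_trans (ler_norm_mulB _ _ _ _) _ => //.
- rewrite prodr_ge0 => [|j _]; last by case/andP: (f01 j).
  by rewrite prodr_ile1// => j _; exact: f01.
- rewrite prodr_ge0 => [|j _]; last by case/andP: (g01 j).
  by rewrite prodr_ile1// => j _; exact: g01.
- by rewrite lerD2l.
Qed.

(** Factors in [0, 1] give the l^1 distance when a product is changed one factor at a time. With [L]
    uniform in [l] and [p], this controls both the gradient and the Gagliardo integrand. *)
Lemma cube_bump_lipschitz : exists2 L, 0 < L & forall l p x y, 0 < l ->
  `|cube_bump l p x - cube_bump l p y| <= L * l * \sum_i `|x 0 i - y 0 i|.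
Proof.
have [L L0 HL] := bump1_lipschitz; exists L => // l p x y l0.
apply: (le_trans (ler_norm_prodB _ _ _)).
- by move=> i; rewrite bump1_ge0 bump1_le1.
- by move=> i; rewrite bump1_ge0 bump1_le1.
rewrite mulr_sumr; apply: ler_sum => i _; apply: le_trans (HL _ _) _.
rewrite (_ : _ - _ = l * (x 0 i - y 0 i)); last by ring.
by rewrite normrM gtr0_norm// mulrA.
Qed.

Lemma norm_partial_le (f : 'rV[R]_n -> R) (i : 'I_n) x (C : R) :
  derivable f x (delta_mx 0 i) ->
  (forall y z, `|f y - f z| <= C * \sum_j `|y 0 j - z 0 j|) ->
  `|partial i f x| <= C.
Proof.
move=> df fC; rewrite /partial /derive.
have cq := @cvg_norm _ _ _ _ (dnbhs_filter (0 : R)) _ _ df; rewrite -(cvg_lim _ cq)//.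
apply: limr_le; first by apply/cvg_ex; eexists; exact: cq.
have : \forall h \near (0 : R)^', h != 0 by exact: (@nbhs_dnbhs_neq R 0).
apply: filterS => h h0 /=.
rewrite normrM normfV ler_pdivrMl ?normr_gt0//.
apply: le_trans (fC _ _) _; rewrite mulrC.
rewrite (bigD1 i)//= big1 => [|j ji]; last first.
  by rewrite !mxE (negbTE ji) andbF mulr0 add0r subrr normr0.
by rewrite !mxE !eqxx mulr1 addrK addr0.
Qed.

End cube_bump.

(** * An integrable dyadic majorant of the fractional kernel *)

Section dyadic_kernel.
Context {R : realType} {n : nat}.
Local Notation mu := (@lebesgue_rV R n).
Implicit Types (x y z : 'rV[R]_n) (a r : nat -> R).

Lemma nneseries_geometric_le (C rho : R) : 0 <= C -> 0 < rho < 1 ->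
  (\sum_(0 <= j <oo) (C * rho ^+ j)%:E <= (C / (1 - rho))%:E)%E.
Proof.
move=> C0 /andP[r0 r1]; apply: lime_le.
  by apply: is_cvg_nneseries => j _ _; rewrite lee_fin mulr_ge0// exprn_ge0// ltW.
near=> N; rewrite sumEFin lee_fin.
apply: (geometric_le_lim N C0 r0).
by rewrite ger0_norm// ltW.
Unshelve. all: by end_near. Qed.

Definition kernel_sum a r z : \bar R :=
  (\sum_(0 <= j <oo) (a j * \1_(rV_cube 0 (r j)) z)%:E)%E.

Lemma kernel_sum_ge0 a r z : (forall j, 0 <= a j) -> (0 <= kernel_sum a r z)%E.
Proof. by move=> a0; apply: nneseries_ge0 => j _ _; rewrite lee_fin mulr_ge0. Qed.

Lemma kernel_sum_ge a r z j : (forall j, 0 <= a j) -> rV_cube 0 (r j) z ->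
  ((a j)%:E <= kernel_sum a r z)%E.
Proof.
move=> a0 zj; rewrite /kernel_sum (@nneseriesD1 _ _ j)//; last first.
  by move=> k _; rewrite lee_fin mulr_ge0.
rewrite indicE mem_set// mulr1 leeDl// nneseries_ge0// => k _ _.
by rewrite lee_fin mulr_ge0.
Qed.

Lemma measurable_rV_sub d (T : measurableType d) (f g : T -> 'rV[R]_n) :
  measurable_fun setT f -> measurable_fun setT g ->
  measurable_fun setT (fun t => f t - g t).
Proof.
move=> mf mg; apply: measurable_fun_rV => i; under eq_fun do rewrite !mxE.
apply: measurable_funB.
  exact: (measurableT_comp (measurable_rV_coord i) mf).
exact: (measurableT_comp (measurable_rV_coord i) mg).
Qed.

Lemma measurable_kernel_sum a r : (forall j, 0 <= a j) ->
  measurable_fun setT (kernel_sum a r).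
Proof.
move=> a0; apply: ge0_emeasurable_sum.
  by move=> k z _ _; rewrite lee_fin mulr_ge0.
move=> k _; apply/measurable_EFinP; apply: measurable_funM => //.
by apply: measurable_indic; exact: measurable_rV_cube.
Qed.

(** The condition on [f] covers both [x - y] and [y - x], so invariance under translation and
    reflection is read off from the volume of cubes. *)
Lemma integral_kernel_sum a r (f : 'rV[R]_n -> 'rV[R]_n) x :
  (forall j, 0 <= a j) -> (forall j, 0 <= r j) ->
  measurable_fun setT f ->
  (forall y q, rV_cube 0 q (f y) <-> rV_cube x q y) ->
  (\int[mu]_y kernel_sum a r (f y) =
   \sum_(0 <= j <oo) (a j * (2 * r j) ^+ n)%:E)%E.
Proof.
move=> a0 r0 mf fE.
have mind j : measurable_fun setT (fun y : 'rV[R]_n => (a j * \1_(rV_cube 0 (r j)) (f y))%:E).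
  apply/measurable_EFinP; apply: measurable_funM => //.
  have m1 : measurable_fun setT (\1_(rV_cube 0 (r j)) : 'rV[R]_n -> R).
    by apply: measurable_indic; exact: measurable_rV_cube.
  exact: (measurableT_comp m1 mf).
rewrite /kernel_sum integral_nneseries//; last first.
  by move=> j y _; rewrite lee_fin mulr_ge0.
apply: eq_eseriesr => j _.
transitivity (\int[mu]_y ((a j)%:E * (\1_(rV_cube x (r j)) y)%:E))%E.
  apply: eq_integral => y _; rewrite -EFinM; congr (_ * _)%:E; rewrite !indicE.
  by congr ((nat_of_bool _)%:R); apply/idP/idP; rewrite !inE => /fE.
rewrite ge0_integralZl//; last 2 first.
- by apply/measurable_EFinP; apply: measurable_indic; exact: measurable_rV_cube.
- by rewrite lee_fin.
rewrite integral_indic ?setIT//; last exact: measurable_rV_cube.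
by rewrite [X in (_ * X)%E](lebesgue_rV_cube_at x (r0 j)) EFinM.
Qed.

Variable s : R.
Hypothesis s01 : 0 < s < 1.
Hypothesis n2 : (2 <= n)%N.

Let p : R := n%:R + 2 * s.
(** Inner levels: 2^-(j+1) < |z| <= 2^-j gives |z|^(2-p) <= [ap j]. Outer levels: 2^j <= |z| <=
    2^(j+1) gives |z|^(-p) <= [bp j]. The half-sides [ar j] and [br j] are the upper ends of these
    ranges. *)
Let ap j : R := 2 `^ (j.+1%:R * (p - 2)).
Let ar j : R := 2 `^ (- j%:R).
Let bp j : R := 2 `^ (- (j%:R * p)).
Let br j : R := 2 `^ j.+1%:R.

(* Dominates min(1, |z|^2) / |z|^p up to a constant (see dyadic_kernel_bound) by
   indicators of dyadic cubes, whose integrals form geometric series. *)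
Definition dyadic_kernel z : \bar R := (kernel_sum ap ar z + kernel_sum bp br z)%E.

Lemma dyadic_kernel_ge0 z : (0 <= dyadic_kernel z)%E.
Proof. by rewrite adde_ge0// kernel_sum_ge0// => j; exact: powR_ge0. Qed.

Lemma measurable_dyadic_kernel : measurable_fun setT dyadic_kernel.
Proof.
by apply: emeasurable_funD; apply: measurable_kernel_sum => j; exact: powR_ge0.
Qed.

Let p_ge2 : 2 <= p.
Proof.
have : 2 <= n%:R :> R by rewrite ler_nat.
by rewrite /p; move: s01 => /andP[]; lra.
Qed.

Lemma pow2_gt (x : R) : exists k, x < 2 `^ k%:R.
Proof.
exists (Num.bound `|x|); rewrite (le_lt_trans (ler_norm x))//.
apply: (lt_trans (archi_boundP (normr_ge0 x))).
by rewrite powR_mulrn// -natrX ltr_nat ltn_expl.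
Qed.

Lemma dyadic_kernel_bound (m B : R) z : 0 <= m -> 0 <= B ->
  m <= B -> m <= B * enorm z ^+ 2 ->
  ((m / enorm z `^ p)%:E <= B%:E * dyadic_kernel z)%E.
Proof.
move=> m0 B0 mB mBz; set N := enorm z in mBz *.
have p0 : 0 < p by apply: lt_le_trans p_ge2.
(* At z = 0 the power is 0 and the inverse of 0 is 0, so the left side vanishes. *)
have [N0|N0] := eqVneq N 0.
  rewrite N0 powR0 ?gt_eqF// invr0 mulr0; apply: mule_ge0; first by rewrite lee_fin.
  exact: dyadic_kernel_ge0.
have {}N0 : 0 < N by rewrite lt_neqAle eq_sym N0 enorm_ge0.
have ap0 j : 0 <= ap j by exact: powR_ge0.
have bp0 j : 0 <= bp j by exact: powR_ge0.
have zN q : N <= q -> rV_cube 0 q z.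
  by move=> Nq; apply/rV_cubeE => i; rewrite mxE subr0 (le_trans (coord_le_enorm z i)).
have [N1|N1] := leP N 1.
  have ex : exists k, 2 `^ (- k%:R) < N.
    have [k Nk] := pow2_gt N^-1; exists k.
    by rewrite powRN invf_plt ?posrE ?powR_gt0.
  (* Minimality puts [N] between two consecutive dyadic radii; k = 0 is excluded by N <= 1. *)
  pose k := ex_minn ex.
  have [Nk kmin] : 2 `^ (- k%:R) < N /\ forall j, 2 `^ (- j%:R) < N -> (k <= j)%N.
    by rewrite /k; case: ex_minnP => k0 ? ?; split.
  case: k Nk kmin => [|j] Nj jmin.
    by move: Nj; rewrite oppr0 powRr0 ltNge N1.
  have Nj' : N <= 2 `^ (- j%:R).
    by rewrite leNgt; apply/negP => /jmin; rewrite ltnn.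
  apply: (@le_trans _ _ (B%:E * (ap j)%:E)%E); last first.
    apply: lee_wpmul2l; first by rewrite lee_fin.
    apply: (@le_trans _ _ (kernel_sum ap ar z)); first by apply: kernel_sum_ge => //; exact: zN.
    by rewrite leeDl// kernel_sum_ge0.
  rewrite -EFinM lee_fin -powRN.
  apply: (@le_trans _ _ (B * N ^+ 2 * N `^ (- p))); first by rewrite ler_wpM2r ?powR_ge0.
  rewrite -mulrA ler_wpM2l// -powR_mulrn ?(ltW N0)// -powRD; last by rewrite (gt_eqF N0) implybT.
  have -> : 2%:R - p = - (p - 2) by ring.
  have -> : ap j = (2 `^ (- j.+1%:R)) `^ (- (p - 2)) by rewrite -powRrM /ap; congr powR; ring.
  rewrite !powRN lef_pV2 ?posrE ?powR_gt0// -powRN.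
  by apply: ge0_ler_powR; rewrite ?nnegrE ?powR_ge0 ?subr_ge0// ltW.
have ex : exists k, N <= 2 `^ k%:R.
  by have [k /ltW] := pow2_gt N; exists k.
pose k := ex_minn ex.
have [Nk kmin] : N <= 2 `^ k%:R /\ forall j, N <= 2 `^ j%:R -> (k <= j)%N.
  by rewrite /k; case: ex_minnP => k0 ? ?; split.
case: k Nk kmin => [|j] Nj jmin.
  by move: Nj; rewrite powRr0 leNgt N1.
have Nj' : 2 `^ j%:R <= N.
  by rewrite leNgt; apply/negP => /ltW /jmin; rewrite ltnn.
apply: (@le_trans _ _ (B%:E * (bp j)%:E)%E); last first.
  apply: lee_wpmul2l; first by rewrite lee_fin.
  apply: (@le_trans _ _ (kernel_sum bp br z)); first by apply: kernel_sum_ge => //; exact: zN.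
  by rewrite leeDr// kernel_sum_ge0.
rewrite -EFinM lee_fin; apply: ler_pM => //; first by rewrite invr_ge0 powR_ge0.
rewrite /bp powRN lef_pV2 ?posrE ?powR_gt0// powRrM.
by apply: ge0_ler_powR; rewrite ?nnegrE ?powR_ge0// ltW.
Qed.

Lemma dyadic_kernel_integral : exists2 S : R, 0 < S &
  forall f x, measurable_fun setT f ->
    (forall y q, rV_cube 0 q (f y) <-> rV_cube x q y) ->
    (\int[mu]_y dyadic_kernel (f y) <= S%:E)%E.
Proof.
have /andP[s0 s1] := s01.
have two0 : (2 : R) != 0 by [].
(* Ratios of the two geometric series: the inner one is below 1 because s < 1, the outer one because
   s > 0. *)
pose r1 : R := 2 `^ (2 * s - 2); pose r2 : R := 2 `^ (- (2 * s)).
pose C1 : R := 2 `^ (p - 2 + n%:R); pose C2 : R := 2 `^ (2 * n%:R).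
have r1lt : 0 < r1 < 1.
  by rewrite powR_gt0//= /r1 /r2 /powR (negbTE two0) expR_lt1 pmulr_llt0 ?ln_gt0 ?ltr1n//; lra.
have r2lt : 0 < r2 < 1.
  by rewrite powR_gt0//= /r1 /r2 /powR (negbTE two0) expR_lt1 pmulr_llt0 ?ln_gt0 ?ltr1n//; lra.
have C10 : 0 < C1 by exact: powR_gt0.
have C20 : 0 < C2 by exact: powR_gt0.
exists (C1 / (1 - r1) + C2 / (1 - r2)).
  by move: r1lt r2lt => /andP[_ ?] /andP[_ ?]; rewrite addr_gt0// divr_gt0// subr_gt0.
move=> f x mf fE.
have ap0 j : 0 <= ap j by exact: powR_ge0.
have bp0 j : 0 <= bp j by exact: powR_ge0.
have ar0 j : 0 <= ar j by exact: powR_ge0.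
have br0 j : 0 <= br j by exact: powR_ge0.
rewrite ge0_integralD//; last 4 first.
- by move=> y _; exact: kernel_sum_ge0.
- by apply: measurableT_comp mf; exact: measurable_kernel_sum.
- by move=> y _; exact: kernel_sum_ge0.
- by apply: measurableT_comp mf; exact: measurable_kernel_sum.
have E1 := integral_kernel_sum ap0 ar0 mf fE.
have E2 := integral_kernel_sum bp0 br0 mf fE.
have twoD (a b : R) : 2 `^ a * 2 `^ b = 2 `^ (a + b) by rewrite powRD ?two0 ?implybT.
have twoX (a : R) k : (2 `^ a) ^+ k = 2 `^ (a * k%:R).
  by rewrite -powR_mulrn ?powR_ge0// -powRrM.
have two1 (a : R) : 2 * 2 `^ a = 2 `^ (1 + a) by rewrite -twoD powRr1.
rewrite EFinD; apply: leeD.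
  rewrite [X in (X <= _)%E]E1 (eq_eseriesr (g := fun j => (C1 * r1 ^+ j)%:E)).
    by apply: nneseries_geometric_le => //; exact: ltW.
  move=> j _; congr EFin; rewrite /ap /ar /C1 /r1 two1 !twoX !twoD.
  by congr (2 `^ _); rewrite /p -natr1; ring.
rewrite [X in (X <= _)%E]E2 (eq_eseriesr (g := fun j => (C2 * r2 ^+ j)%:E)).
  by apply: nneseries_geometric_le => //; exact: ltW.
move=> j _; congr EFin; rewrite /bp /br /C2 /r2 two1 !twoX !twoD.
by congr (2 `^ _); rewrite /p -natr1; ring.
Qed.

End dyadic_kernel.

(** * Dirichlet and Gagliardo energies of the bump *)

Section bump_energy.
Context {R : realType} {n : nat}.
Local Notation mu := (@lebesgue_rV R n).
Implicit Types (p : 'rV[R]_n) (l : R).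

Definition bump_gradient l p (x : 'rV[R]_n) : 'rV[R]_n :=
  \row_i partial i (cube_bump l p) x.

Lemma cube_bump_supported l p : 0 < l -> exists2 M : R, 0 <= M &
  supported_in_cube M (cube_bump l p).
Proof.
move=> l0; exists (\sum_i `|p 0 i| + 2 / l).
  by rewrite addr_ge0 ?sumr_ge0// divr_ge0// ltW.
move=> x xM; apply: cube_bump_eq0 => // /rV_cubeE xp; apply: xM => i.
rewrite /= in_itv/= -ler_norml.
have -> : x 0 i = p 0 i + (x 0 i - p 0 i) by ring.
apply: le_trans (ler_normD _ _) _; apply: lerD => //.
by rewrite (bigD1 i)//= lerDl sumr_ge0.
Qed.

Lemma bump_weak_gradient l p : 0 < l ->
  weak_gradient (cube_bump l p) (bump_gradient l p).
Proof.
move=> l0; have [M M0 sM] := cube_bump_supported p l0.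
exact: elementary_weak_gradient M0 (elementary_cube_bump l p) sM.
Qed.

Lemma bump_dirichlet_le : exists2 C : R, 0 < C & forall l p (D : set 'rV[R]_n),
  0 < l -> measurable D ->
  (dirichlet D (bump_gradient l p) <= (C * (l ^+ 2 / l ^+ n))%:E)%E.
Proof.
have [L L0 HL] := @cube_bump_lipschitz R n.
(* Squared gradient at most n (L l)^2 on a cube of volume (4/l)^n; the summand 1 keeps the constant
   positive for n = 0 too. *)
exists (1 + n%:R * L ^+ 2 * 4 ^+ n) => [|l p D l0 mD].
  by rewrite ltr_pwDl// !mulr_ge0 ?exprn_ge0// ltW.
pose Q := rV_cube p (2 / l).
have mQ : measurable Q by exact: measurable_rV_cube.
pose k : R := n%:R * (L * l) ^+ 2.
have k0 : 0 <= k by rewrite mulr_ge0// sqr_ge0.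
have mgrad : measurable_fun setT (fun x => sqnorm (bump_gradient l p x)).
  rewrite (_ : (fun x => _) = (fun x => \sum_i partial i (cube_bump l p) x ^+ 2)); last first.
    by apply/funext => x; rewrite /sqnorm; apply: eq_bigr => i _; rewrite mxE.
  apply: measurable_sum => i; apply: measurable_funX.
  apply: elementary_measurable; apply: elementary_partial.
  exact: elementary_cube_bump.
rewrite /dirichlet; under eq_integral do rewrite sqr_enorm.
apply: (@le_trans _ _ (\int[mu]_x (sqnorm (bump_gradient l p x))%:E)%E).
  apply: ge0_subset_integral => //; first exact/measurable_EFinP.
  by move=> x _; rewrite lee_fin sqnorm_ge0.
apply: (@le_trans _ _ (\int[mu]_x (k%:E * (\1_Q x)%:E))%E).
  apply: ge0_le_integral => //.
  - by move=> x _; rewrite lee_fin sqnorm_ge0.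
  - exact/measurable_EFinP.
  - by apply: measurable_funeM; apply/measurable_EFinP; exact: measurable_indic.
  move=> x _; rewrite -EFinM lee_fin indicE.
  have [xQ|xQ] := boolP (x \in Q).
    rewrite mulr1 /sqnorm /k.
    apply: (@le_trans _ _ (\sum_(i < n) (L * l) ^+ 2)); last first.
      by rewrite sumr_const card_ord -[leLHS]mulr_natl.
    apply: ler_sum => i _; rewrite mxE -real_normK ?num_real//.
    rewrite ler_pXn2r ?nnegrE ?mulr_ge0 ?(ltW L0) ?(ltW l0)//.
    apply: norm_partial_le; first by apply: elementary_derivable; exact: elementary_cube_bump.
    by move=> y z; exact: HL.
  rewrite mulr0 /sqnorm big1// => i _; rewrite mxE.
  rewrite (@partial_eq0_outside _ _ _ Q)// ?expr0n//.
  - exact: closed_rV_box.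
  - by move=> y yQ; exact: cube_bump_eq0.
  - by move/negP: xQ; rewrite inE.
rewrite ge0_integralZl//; last by apply/measurable_EFinP; exact: measurable_indic.
rewrite integral_indic// setIT [X in (_ * X)%E]lebesgue_rV_cube_at; last first.
  by rewrite divr_ge0// ltW.
rewrite -EFinM lee_fin /k.
have -> : n%:R * (L * l) ^+ 2 * (2 * (2 / l)) ^+ n = n%:R * L ^+ 2 * 4 ^+ n * (l ^+ 2 / l ^+ n).
  have -> : 2 * (2 / l) = 4 / l by ring.
  by rewrite expr_div_n exprMn; ring.
apply: ler_wpM2r; last by rewrite lerDr.
by apply: divr_ge0; apply: exprn_ge0; exact: ltW.
Qed.

Lemma sum_coord_le_enorm (z : 'rV[R]_n) : \sum_i `|z 0 i| <= n%:R * enorm z.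
Proof.
apply: (@le_trans _ _ (\sum_(i < n) enorm z)).
  by apply: ler_sum => i _; exact: coord_le_enorm.
by rewrite sumr_const card_ord mulr_natl.
Qed.

Variable s : R.
Hypothesis s01 : 0 < s < 1.
Hypothesis n2 : (2 <= n)%N.

(** The integrand vanishes unless one of the two points lies in the support cube. Integrating the
    dyadic kernel over the other point leaves the volume of the cube. The factor l^2, cruder than
    the natural l^(2s), matches the Dirichlet energy. *)
Lemma bump_gagliardo_le : exists2 C : R, 0 < C & forall l p, 1 <= l ->
  (\int[mu \x mu]_z (`|cube_bump l p z.1 - cube_bump l p z.2| ^+ 2 /
      (enorm (z.1 - z.2) `^ (n%:R + 2 * s)))%:E <= (C * (l ^+ 2 / l ^+ n))%:E)%E.
Proof.
have [L L0 HL] := @cube_bump_lipschitz R n.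
have [S S0 HS] := @dyadic_kernel_integral R n s s01.
(* B0 l^2 serves both bounds of the squared difference: 1, because l >= 1, and (L n l |x - y|)^2. *)
pose B0 : R := 1 + (L * n%:R) ^+ 2.
have B00 : 0 < B0 by rewrite ltr_pwDl// sqr_ge0.
exists (2 * B0 * S * 4 ^+ n) => [|l p l1]; first by rewrite !mulr_gt0// exprn_gt0.
have l0 : 0 < l by apply: lt_le_trans l1.
pose Q := rV_cube p (2 / l).
have mQ : measurable Q by exact: measurable_rV_cube.
pose B := B0 * l ^+ 2.
have B_ge0 : 0 <= B by rewrite mulr_ge0 ?sqr_ge0// ltW.
pose v := cube_bump l p.
have mv : measurable_fun setT v by apply: elementary_measurable; exact: elementary_cube_bump.
have m1 : measurable_fun setT (fun z : 'rV[R]_n * 'rV[R]_n => z.1 - z.2).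
  by apply: measurable_rV_sub; [exact: measurable_fst|exact: measurable_snd].
pose K := @dyadic_kernel R n s.
have K0 z : (0 <= K z)%E by exact: dyadic_kernel_ge0.
have mK : measurable_fun setT (fun z : 'rV[R]_n * 'rV[R]_n => K (z.1 - z.2)).
  by apply: (measurableT_comp _ m1); exact: measurable_dyadic_kernel.
have mI : measurable_fun setT (fun x : 'rV[R]_n => (\1_Q x : R)%:E).
  by apply/measurable_EFinP; exact: measurable_indic.
pose F1 (z : 'rV[R]_n * 'rV[R]_n) : \bar R := ((\1_Q z.1)%:E * K (z.1 - z.2)%R)%E.
pose F2 (z : 'rV[R]_n * 'rV[R]_n) : \bar R := ((\1_Q z.2)%:E * K (z.1 - z.2)%R)%E.
have mF1 : measurable_fun setT F1.
  by apply: emeasurable_funM => //; exact: (measurableT_comp mI measurable_fst).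
have mF2 : measurable_fun setT F2.
  by apply: emeasurable_funM => //; exact: (measurableT_comp mI measurable_snd).
have F10 z : (0 <= F1 z)%E by rewrite mule_ge0// lee_fin.
have F20 z : (0 <= F2 z)%E by rewrite mule_ge0// lee_fin.
have muQ : mu Q = ((4 / l) ^+ n)%:E.
  rewrite lebesgue_rV_cube_at; last by rewrite divr_ge0// ltW.
  by congr ((_ ^+ _)%:E); ring.
have Q0 : (0 <= (4 / l) ^+ n :> R)%R by rewrite exprn_ge0// divr_ge0// ltW.
have intQ : (\int[mu]_x ((\1_Q x)%:E * S%:E) = ((4 / l) ^+ n * S)%:E)%E.
  rewrite ge0_integralZr//; last by rewrite lee_fin ltW.
  by rewrite integral_indic// setIT [X in (X * _)%E]muQ.
have intF1 : (\int[mu \x mu]_z F1 z <= ((4 / l) ^+ n * S)%:E)%E.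
  rewrite fubini_tonelli1// -intQ; apply: ge0_le_integral => //.
  - by move=> x _; apply: integral_ge0 => y _; exact: F10.
  - exact: measurable_fun_fubini_tonelli_F.
  - by apply: emeasurable_funM.
  move=> x _; rewrite /fubini_F /F1/=.
  have mKx : measurable_fun setT (fun y : 'rV[R]_n => K (x - y)).
    apply: (@measurableT_comp _ _ _ _ _ _ K); first exact: measurable_dyadic_kernel.
    by apply: measurable_rV_sub => //; exact: measurable_cst.
  rewrite ge0_integralZl//.
  apply: lee_wpmul2l; first by rewrite lee_fin.
  apply: (HS (fun y => x - y) x).
    by apply: measurable_rV_sub => //; exact: measurable_cst.
  by move=> y r; rewrite !rV_cubeE; split=> h i; have := h i; rewrite !mxE subr0 distrC.
have intF2 : (\int[mu \x mu]_z F2 z <= ((4 / l) ^+ n * S)%:E)%E.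
  rewrite fubini_tonelli2// -intQ; apply: ge0_le_integral => //.
  - by move=> x _; apply: integral_ge0 => y _; exact: F20.
  - exact: measurable_fun_fubini_tonelli_G.
  - by apply: emeasurable_funM.
  move=> y _; rewrite /fubini_G /F2/=.
  have mKx : measurable_fun setT (fun x : 'rV[R]_n => K (x - y)).
    apply: (@measurableT_comp _ _ _ _ _ _ K); first exact: measurable_dyadic_kernel.
    by apply: measurable_rV_sub => //; exact: measurable_cst.
  rewrite ge0_integralZl//.
  apply: lee_wpmul2l; first by rewrite lee_fin.
  apply: (HS (fun x => x - y) y).
    by apply: measurable_rV_sub => //; exact: measurable_cst.
  by move=> x r; rewrite !rV_cubeE; split=> h i; have := h i; rewrite !mxE subr0.
apply: (@le_trans _ _ (\int[mu \x mu]_z (B%:E * (F1 z + F2 z)))%E).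
  apply: ge0_le_integral => //.
  - by move=> z _; rewrite lee_fin divr_ge0 ?powR_ge0// sqr_ge0.
  - apply/measurable_EFinP; apply: measurable_funM.
      apply: measurable_funX; apply: measurableT_comp => //.
      apply: measurable_funB; first exact: (measurableT_comp mv measurable_fst).
      exact: (measurableT_comp mv measurable_snd).
    under eq_fun do rewrite -powRN.
    apply: (@measurableT_comp _ _ _ _ _ _ (fun t : R => t `^ (- (n%:R + 2 * s)))) => //.
    by apply: measurableT_comp m1; exact: measurable_enorm.
  - by apply: measurable_funeM; exact: emeasurable_funD.
  move=> [x y] _ /=; rewrite /F1 /F2/= -ge0_muleDl ?lee_fin// -EFinD.
  set w := enorm (x - y).
  have [xyQ|] := boolP ((x \in Q) || (y \in Q)); last first.
    rewrite negb_or => /andP[/negP + /negP]; rewrite !inE => xQ yQ.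
    rewrite !cube_bump_eq0// subrr normr0 expr0n/= mul0r.
    by apply: mule_ge0; rewrite ?lee_fin//; apply: mule_ge0 => //; rewrite lee_fin addr_ge0.
  apply: (@le_trans _ _ (B%:E * K (x - y)%R)%E); last first.
    apply: lee_wpmul2l; rewrite ?lee_fin//.
    rewrite -[leLHS]mul1e; apply: lee_wpmul2r; first exact: K0.
    rewrite lee_fin !indicE.
    by move: xyQ => /orP[] ->; rewrite ?lerDl ?lerDr.
  have /andP[v1 v2] := cube_bump_bounds l p x.
  have /andP[v3 v4] := cube_bump_bounds l p y.
  have d1 : `|cube_bump l p x - cube_bump l p y| <= 1 by rewrite ler_norml; lra.
  apply: (dyadic_kernel_bound s01 n2) => //.
    apply: (@le_trans _ _ 1); first by rewrite expr_le1.
    rewrite -[leLHS](mul1r 1); apply: ler_pM => //; first by rewrite lerDl sqr_ge0.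
    by rewrite expr_ge1// ltW.
  rewrite -/w; apply: (@le_trans _ _ ((L * n%:R * (l * w)) ^+ 2)).
    rewrite ler_pXn2r ?nnegrE ?mulr_ge0 ?enorm_ge0 ?(ltW L0) ?(ltW l0)//.
    apply: le_trans (HL l p x y l0) _.
    have := sum_coord_le_enorm (x - y); rewrite -/w.
    under eq_bigr do rewrite !mxE.
    move=> h; have -> : L * n%:R * (l * w) = L * l * (n%:R * w) by ring.
    by rewrite ler_wpM2l// mulr_ge0 ?ltW.
  have -> : (L * n%:R * (l * w)) ^+ 2 = (L * n%:R) ^+ 2 * l ^+ 2 * w ^+ 2 by ring.
  apply: ler_wpM2r; first exact: sqr_ge0.
  by apply: ler_wpM2r; rewrite ?sqr_ge0// lerDr.
have F12_ge0 z : setT z -> (0 <= F1 z + F2 z)%E by move=> _; rewrite adde_ge0.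
have mF12 : measurable_fun setT (fun z => F1 z + F2 z)%E by exact: emeasurable_funD.
rewrite (ge0_integralZl _ measurableT mF12 F12_ge0)//.
rewrite ge0_integralD//.
apply: (@le_trans _ _ (B%:E * (((4 / l) ^+ n * S)%:E + ((4 / l) ^+ n * S)%:E))%E).
  by apply: lee_wpmul2l; rewrite ?lee_fin//; exact: leeD.
rewrite -EFinD -EFinM lee_fin /B le_eqVlt; apply/orP; left; apply/eqP.
by rewrite expr_div_n; ring.
Qed.

End bump_energy.

(** * Position of the bump and size of its weighted integral *)

Section boundary_bump.
Context {R : realType} {n : nat}.
Local Notation mu := (@lebesgue_rV R n).
Variable i0 : 'I_n.
Implicit Types (alpha : R) (x : 'rV[R]_n).

(** For t = 4/alpha <= 1/2 one has exp(-2 t) <= 1/(1 + 2 t) <= 1 - t, and 2 t alpha = 8. *)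
Lemma expR_le_powR_onem alpha : 8 <= alpha -> expR (- 8) <= (1 - 4 / alpha) `^ alpha.
Proof.
move=> a8; have a0 : 0 < alpha by lra.
set t := 4 / alpha.
have t0 : 0 < t by rewrite divr_gt0.
have t1 : t <= 1 / 2 by rewrite /t ler_pdivrMr//; lra.
have -> : - 8 = (- (2 * t)) * alpha by rewrite /t; field; rewrite gt_eqF.
rewrite expRM ge0_ler_powR ?nnegrE ?(ltW a0) ?expR_ge0//; first by lra.
rewrite expRN invf_ple ?posrE ?expR_gt0//; last by lra.
apply: le_trans (expR_ge1Dx _).
rewrite -div1r ler_pdivrMr; last by lra.
nra.
Qed.

(** The support, of half-side 2/alpha, keeps its coordinate [i0] below 1 - 1/alpha, and on the
    plateau this coordinate is at least 1 - 4/alpha, where the weight is at least exp(-8). *)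
Definition bump_center alpha : 'rV[R]_n :=
  \row_i (if i == i0 then 1 - 3 / alpha else 0).

Definition boundary_bump alpha := cube_bump alpha (bump_center alpha).

(** With t = 1/alpha the squared norm is at most (1 - t)^2 + 4 n t^2 <= 1 - t, as (1 + 4 n) t^2 <=
    t. *)
Lemma bump_cube_sub_ball alpha : 8 <= alpha -> 1 + 4 * n%:R <= alpha ->
  rV_cube (bump_center alpha) (2 / alpha) `<=` unit_ball.
Proof.
move=> a8 an x /rV_cubeE xp; have a0 : 0 < alpha by lra.
set t := alpha^-1 in xp *; have t0 : 0 < t by rewrite invr_gt0.
have at1 : alpha * t = 1 by rewrite mulfV// gt_eqF.
rewrite /unit_ball/= enorm_lt1 /sqnorm (bigD1 i0)//=.
have x0 : x 0 i0 ^+ 2 <= (1 - t) ^+ 2.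
  have := xp i0; rewrite mxE eqxx -/t ler_norml => /andP[h1 h2].
  have t8 : 8 * t <= 1 by rewrite -at1; nra.
  by rewrite ler_pXn2r ?nnegrE//; lra.
have : \sum_(i < n | i != i0) x 0 i ^+ 2 <= n%:R * (2 * t) ^+ 2.
  apply: (@le_trans _ _ (\sum_(i < n) (2 * t) ^+ 2)); last first.
    by rewrite sumr_const card_ord -[leLHS]mulr_natl.
  rewrite [leRHS](bigD1 i0)//=; apply: ler_wpDl; first exact: sqr_ge0.
  apply: ler_sum => i /negbTE ii0; have := xp i; rewrite mxE ii0 subr0 => h.
  by rewrite -real_normK ?num_real// ler_pXn2r ?nnegrE// mulr_ge0// ltW.
have nt : (1 + 4 * n%:R) * t ^+ 2 <= t.
  rewrite expr2 mulrA -[leRHS]mul1r; apply: ler_wpM2r; first exact: ltW.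
  by rewrite -[leRHS]at1; apply: ler_wpM2r => //; exact: ltW.
move=> h; nra.
Qed.

Lemma boundary_bump_X2 alpha : 8 <= alpha -> 1 + 4 * n%:R <= alpha ->
  X2 (boundary_bump alpha).
Proof.
move=> a8 an; have a0 : 0 < alpha by lra.
have [M M0 sM] := cube_bump_supported (bump_center alpha) a0.
split; last first.
  apply: aeW => x xB; apply: cube_bump_eq0 => // xc; apply: xB.
  exact: (bump_cube_sub_ball a8 an xc).
split; last by exists (bump_gradient alpha (bump_center alpha)); exact: bump_weak_gradient.
apply: (continuous_supported_Lfun M0) sM.
by apply: elementary_continuous; exact: elementary_cube_bump.
Qed.

Lemma boundary_bump_weight_ge alpha q : 8 <= alpha -> 1 + 4 * n%:R <= alpha ->
  ((expR (- 8) * (2 / alpha) ^+ n)%:E <=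
   \int[mu]_(x in unit_ball) (enorm x `^ alpha * `|boundary_bump alpha x| `^ q)%:E)%E.
Proof.
move=> a8 an; have a0 : 0 < alpha by lra.
pose D := rV_cube (bump_center alpha) alpha^-1.
have mD : measurable D by exact: measurable_rV_cube.
have DB : D `<=` unit_ball.
  move=> x /rV_cubeE xD; apply: (bump_cube_sub_ball a8 an); apply/rV_cubeE => i.
  apply: le_trans (xD i) _; rewrite -[leLHS]mul1r ler_wpM2r//; last by lra.
  by rewrite invr_ge0 ltW.
have mf : measurable_fun setT (fun x : 'rV[R]_n =>
    (enorm x `^ alpha * `|boundary_bump alpha x| `^ q)%:E).
  apply/measurable_EFinP; apply: measurable_funM.
    exact: (measurableT_comp (measurable_powR _) (@measurable_enorm R n)).
  apply: (measurableT_comp (measurable_powR _)); apply: measurableT_comp => //.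
  by apply: elementary_measurable; exact: elementary_cube_bump.
apply: (@le_trans _ _
    (\int[mu]_(x in D) (enorm x `^ alpha * `|boundary_bump alpha x| `^ q)%:E)%E); last first.
  apply: ge0_subset_integral => //; first exact: measurable_unit_ball.
    exact: measurable_funTS.
  by move=> x _; rewrite lee_fin mulr_ge0// powR_ge0.
apply: (@le_trans _ _ (\int[mu]_(x in D) (expR (- 8))%:E)%E).
  by rewrite integral_cst// [X in (_ * X)%E]lebesgue_rV_cube_at ?invr_ge0 ?(ltW a0)// -EFinM.
apply: ge0_le_integral => //; first exact: measurable_funTS.
move=> x Dx; rewrite lee_fin /boundary_bump cube_bump_eq1// normr1 powR1 mulr1.
apply: le_trans (expR_le_powR_onem a8) _.
have e0 : 0 <= 4 / alpha <= 1.
  by rewrite divr_ge0 ?(ltW a0)//= ler_pdivrMr//; lra.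
apply: ge0_ler_powR; rewrite ?nnegrE ?enorm_ge0 ?(ltW a0)//; first by lra.
apply: le_trans (coord_le_enorm x i0); apply: le_trans (ler_norm _).
move/rV_cubeE : Dx => /(_ i0); rewrite mxE eqxx ler_norml => /andP[+ _].
by rewrite -[alpha^-1]mul1r; lra.
Qed.

Lemma boundary_bump_neq0 alpha : 8 <= alpha -> ~ {ae mu, forall x, boundary_bump alpha x = 0}.
Proof.
move=> a8 [N [mN N0 sN]]; have a0 : 0 < alpha by lra.
pose D := rV_cube (bump_center alpha) alpha^-1.
have mD : measurable D by exact: measurable_rV_cube.
have DN : D `<=` N.
  move=> x Dx; apply: sN => /=; rewrite /boundary_bump cube_bump_eq1//.
  by move/eqP; rewrite oner_eq0.
have := le_measure mu (mem_set mD) (mem_set mN) DN.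
rewrite [X in (_ <= X)%E]N0 [X in (X <= _)%E]lebesgue_rV_cube_at ?invr_ge0 ?(ltW a0)//.
by rewrite lee_fin leNgt exprn_gt0// divr_gt0.
Qed.

End boundary_bump.

(** * Comparison of the quotients *)

Section main_argument.
Context {R : realType} {n : nat}.
Local Notation mu := (@lebesgue_rV R n).

(** Off the origin, which is null, the integrand is positive almost everywhere in the ball. *)
Lemma weighted_integral_gt0 (alpha q : R) (u : 'rV[R]_n -> R) : (0 < n)%N ->
  measurable_fun setT u -> {ae mu, forall x, unit_ball x -> 0 < u x} ->
  (0 < \int[mu]_(x in unit_ball) (enorm x `^ alpha * `|u x| `^ q)%:E)%E.
Proof.
move=> n0 mu_u upos; have mB := @measurable_unit_ball R n.
pose f (x : 'rV[R]_n) : \bar R := (enorm x `^ alpha * `|u x| `^ q)%:E.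
have f0 x : (0 <= f x)%E by rewrite lee_fin mulr_ge0// powR_ge0.
have mf : measurable_fun unit_ball f.
  apply: measurable_funTS; apply/measurable_EFinP; apply: measurable_funM.
    exact: (measurableT_comp (measurable_powR _) (@measurable_enorm R n)).
  by apply: (measurableT_comp (measurable_powR _)); exact: measurableT_comp.
have I_ge0 : (0 <= \int[mu]_(x in unit_ball) f x)%E by exact: integral_ge0.
rewrite lt_neqAle I_ge0 andbT; apply/negP; rewrite eq_sym => /eqP I0.
have /(ae_eq_integral_abs _ mB mf) f_ae0 : (\int[mu]_(x in unit_ball) `|f x| = 0)%E.
  by under eq_integral do rewrite gee0_abs//.
have [Z [mZ Z0 sZ]] : {ae mu, forall x : 'rV[R]_n, unit_ball x -> enorm x = 0}.
  apply: filterS2 f_ae0 upos => x fx ux Bx; have {}ux := ux Bx.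
  have := enorm_ge0 x; rewrite le_eqVlt => /predU1P[//|x0].
  have fpos : (0 < f x)%E by rewrite lte_fin mulr_gt0 ?powR_gt0// normr_gt0 gt_eqF.
  by move: fpos; rewrite (fx Bx) ltxx.
have mE0 : measurable [set x : 'rV[R]_n | enorm x = 0].
  rewrite (_ : mkset _ = enorm @^-1` [set 0])//.
  by rewrite -[X in measurable X]setTI; exact: measurable_enorm.
have NE0 : mu (Z `|` [set x | enorm x = 0]) = 0%E.
  by apply: measureU_eq0 => //; exact: null_enorm_eq0.
have BZ : unit_ball `<=` Z `|` [set x : 'rV[R]_n | enorm x = 0].
  move=> x Bx; have [x0|x0] := eqVneq (enorm x) 0; [by right|left].
  by apply: sZ => /= /(_ Bx) /eqP; rewrite (negbTE x0).
have := @subset_measure0 _ _ _ mu _ _ mB (measurableU _ _ mZ mE0) BZ NE0.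
by move/eqP; rewrite [X in X == _]lebesgue_unit_ball gt_eqF// lte_fin ballvol_gt0.
Qed.

Lemma gagliardo_sqr (K s : R) (u : 'rV[R]_n -> R) : 0 <= K ->
  (gagliardo K s u ^+ 2 = (K ^+ 2)%:E * \int[mu \x mu]_z
      (`|u z.1 - u z.2| ^+ 2 / (enorm (z.1 - z.2) `^ (n%:R + 2 * s)))%:E)%E.
Proof.
move=> K0; rewrite /gagliardo; set I := integral _ _ _.
have I0 : (0 <= I)%E.
  by apply: integral_ge0 => z _; rewrite lee_fin divr_ge0 ?powR_ge0 ?sqr_ge0.
rewrite expe2 muleACA -EFinM -expr2; congr (_ * _)%E.
case: I I0 => [r| |]//= r0; last by rewrite gt_eqF// mulyy.
rewrite -EFinM -expr2 -powR_mulrn ?powR_ge0// -powRrM mulVf ?pnatr_eq0//.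
by rewrite powRr1.
Qed.

Lemma quotient_ge (K s beta alpha q D X : R) (u : 'rV[R]_n -> R) Du :
  0 <= K -> 0 <= beta < 1 -> dirichlet unit_ball Du = D%:E -> 0 < X ->
  (\int[mu]_(x in unit_ball) (enorm x `^ alpha * `|u x| `^ q)%:E = X%:E)%E ->
  (((1 - beta) * D / X `^ (2 / q))%:E <= quotient K s beta alpha q u Du)%E.
Proof.
move=> K0 /andP[b0 b1] uD X0 uX; rewrite /quotient uD uX poweR_EFin inver.
have Xp : 0 < X `^ (2 / q) by exact: powR_gt0.
rewrite gt_eqF// EFinM; apply: lee_wpmul2r; first by rewrite lee_fin invr_ge0 ltW.
rewrite -EFinM leeDl// gagliardo_sqr//.
apply: mule_ge0; first by rewrite lee_fin.
apply: mule_ge0; first by rewrite lee_fin sqr_ge0.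
by apply: integral_ge0 => z _; rewrite lee_fin divr_ge0 ?powR_ge0 ?sqr_ge0.
Qed.

(** Both weights [1 - beta] and [beta] are bounded by 1. A lower bound for the denominator suffices
    even if it is infinite, since its inverse is then 0. *)
Lemma quotient_le (K s beta alpha q a b c : R) (v : 'rV[R]_n -> R) Dv :
  0 < q -> 0 <= K -> 0 <= beta < 1 -> 0 <= a -> 0 <= b -> 0 < c ->
  (dirichlet unit_ball Dv <= a%:E)%E ->
  (\int[mu \x mu]_z (`|v z.1 - v z.2| ^+ 2 /
      (enorm (z.1 - z.2) `^ (n%:R + 2 * s)))%:E <= b%:E)%E ->
  (c%:E <= \int[mu]_(x in unit_ball) (enorm x `^ alpha * `|v x| `^ q)%:E)%E ->
  (quotient K s beta alpha q v Dv <= ((a + K ^+ 2 * b) / c `^ (2 / q))%:E)%E.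
Proof.
move=> q0 K0 /andP[b0 b1] a0 bb c0 va vb vc; rewrite /quotient gagliardo_sqr//.
set I := integral _ _ _ in vb *; set W := integral _ _ _ in vc *.
have I0 : (0 <= I)%E.
  by apply: integral_ge0 => z _; rewrite lee_fin divr_ge0 ?powR_ge0 ?sqr_ge0.
have D0 : (0 <= dirichlet unit_ball Dv)%E.
  by apply: integral_ge0 => x _; rewrite lee_fin sqr_ge0.
have q2 : 0 < 2 / q by rewrite divr_gt0.
have cp : 0 < c `^ (2 / q) by exact: powR_gt0.
have cW : ((W `^ (2 / q))^-1 <= ((c `^ (2 / q))^-1)%:E)%E.
  case: W vc => [w| |]//=; last by rewrite (gt_eqF q2) invey lee_fin invr_ge0 (ltW cp).
  rewrite lee_fin => cw; have w0 : 0 < w by apply: lt_le_trans cw.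
  rewrite inver gt_eqF ?powR_gt0// lee_fin lef_pV2 ?posrE ?powR_gt0//.
  by apply: ge0_ler_powR; rewrite ?nnegrE ?(ltW q2) ?(ltW c0) ?(ltW w0).
rewrite [leRHS]EFinM; apply: lee_pmul => //.
- apply: adde_ge0; apply: mule_ge0 => //; rewrite ?lee_fin ?subr_ge0 ?(ltW b1)//.
  by apply: mule_ge0; rewrite ?lee_fin ?sqr_ge0.
- by rewrite inve_ge0 poweR_ge0.
rewrite [leRHS]EFinD; apply: leeD.
  apply: le_trans va; rewrite -[leRHS]mul1e; apply: lee_wpmul2r => //.
  by rewrite lee_fin; lra.
apply: (@le_trans _ _ ((K ^+ 2)%:E * I)%E).
  rewrite -[leRHS]mul1e; apply: lee_wpmul2r; last by rewrite lee_fin ltW.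
  by apply: mule_ge0; rewrite ?lee_fin ?sqr_ge0.
by rewrite [leRHS]EFinM; apply: lee_wpmul2l; rewrite ?lee_fin ?sqr_ge0.
Qed.

End main_argument.

(* With P = alpha^(2/q), the two sides compare like alpha / (alpha^n P) and
   P^(-n), so the gap is the (n-1)-st power of alpha / P = alpha^(1 - 2/q). *)
Lemma quotient_gap {R : realType} (n : nat) (q b c C1 C2 : R) :
  (2 <= n)%N -> 2 < q -> 0 < b -> 0 < c -> 0 < C1 -> 0 < C2 ->
  exists2 A, 0 < A & forall alpha D X, A < alpha -> 0 <= D -> 0 < X ->
    X <= C1 / alpha * (D / alpha) `^ (q / 2) ->
    C2 * (alpha ^+ 2 / alpha ^+ n) / (c * (2 / alpha) ^+ n) `^ (2 / q) <
    b * D / X `^ (2 / q).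
Proof.
case: n => [|[|m]]// _ q2 b0 c0 C10 C20; set t := 2 / q.
have q0 : 0 < q by lra.
have t0 : 0 < t by rewrite divr_gt0.
have t1 : 0 < 1 - t by rewrite subr_gt0 ltr_pdivrMr// mul1r.
pose C3 := (c * 2 ^+ m.+2) `^ t.
have C30 : 0 < C3 by rewrite powR_gt0// mulr_gt0// exprn_gt0.
have C1t : 0 < C1 `^ t by exact: powR_gt0.
pose M := C2 * C1 `^ t / (b * C3).
have M0 : 0 < M by rewrite divr_gt0// mulr_gt0.
(* The power of [M] gives [M < r], and the summand 1 gives [1 <= r], so [r] is below its (n-1)-st
   power. *)
exists (1 + M `^ (1 - t)^-1) => [|alpha D X Aa D0 X0 XD].
  by rewrite ltr_pwDl// powR_ge0.
have a1 : 1 < alpha by apply: le_lt_trans Aa; rewrite lerDl powR_ge0.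
have a0 : 0 < alpha by lra.
pose P := alpha `^ t; pose r := alpha `^ (1 - t).
have P0 : 0 < P by exact: powR_gt0.
have r0 : 0 < r by exact: powR_gt0.
have arP : alpha = r * P by rewrite -powRD ?subrK ?powRr1 ?(ltW a0)//; apply/implyP => _; rewrite gt_eqF.
have Mr : M < r.
  have -> : M = (M `^ (1 - t)^-1) `^ (1 - t) by rewrite -powRrM mulVf ?gt_eqF// powRr1// ltW.
  apply: gt0_ltr_powR => //; rewrite ?nnegrE ?powR_ge0 ?(ltW a0)//.
  by apply: lt_trans Aa; rewrite ltrDr.
have r1 : 1 <= r.
  have -> : 1 = (1 : R) `^ (1 - t) by rewrite powR1.
  by apply: ge0_ler_powR; rewrite ?nnegrE ?(ltW t1) ?(ltW a1) ?(ltW a0).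
have Mr1 : M < r ^+ m.+1.
  by apply: lt_le_trans Mr _; rewrite exprS ler_peMr ?(ltW r0)// exprn_ege1.
have DX : X `^ t <= C1 `^ t / P * (D / alpha).
  apply: (@le_trans _ _ ((C1 / alpha * (D / alpha) `^ (q / 2)) `^ t)).
    apply: ge0_ler_powR; rewrite ?nnegrE ?(ltW t0) ?(ltW X0)//.
    by apply: le_trans XD; exact: ltW.
  rewrite powRM ?powR_ge0 ?divr_ge0 ?(ltW C10) ?(ltW a0)//.
  rewrite powRM ?invr_ge0 ?(ltW C10) ?(ltW a0)// -powRrM.
  rewrite (_ : q / 2 * t = 1); last by rewrite /t; field; rewrite gt_eqF.
  rewrite powRr1 ?divr_ge0 ?(ltW a0)//.
  rewrite (_ : alpha^-1 `^ t = P^-1)//.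
  by rewrite -[X in X `^ _]powR_inv1 ?(ltW a0)// -powRrM mulN1r powRN.
have Xt : 0 < X `^ t by exact: powR_gt0.
(* With D = 0 the bound [DX] would force X = 0; strictness of the conclusion rests on this. *)
have Dpos : 0 < D.
  rewrite lt_neqAle D0 andbT; apply/eqP => De.
  by move: DX; rewrite -De mul0r mulr0 leNgt Xt.
have -> : (c * (2 / alpha) ^+ m.+2) `^ t = C3 / P ^+ m.+2.
  have -> : c * (2 / alpha) ^+ m.+2 = (c * 2 ^+ m.+2) * (alpha ^+ m.+2)^-1.
    by rewrite expr_div_n mulrA.
  have c2_ge0 : 0 <= c * 2 ^+ m.+2 by apply: mulr_ge0; [exact: ltW|exact: exprn_ge0].
  have am_ge0 : 0 <= alpha ^- m.+2 by rewrite invr_ge0 exprn_ge0// ltW.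
  rewrite (powRM t c2_ge0 am_ge0); congr (_ * _).
  have -> : alpha ^- m.+2 = alpha `^ (- m.+2%:R) by rewrite powRN powR_mulrn// ltW.
  have -> : P ^+ m.+2 = alpha `^ (t * m.+2%:R) by rewrite powRrM powR_mulrn// ltW.
  by rewrite -powRrM -powRN mulNr mulrC.
rewrite ltr_pdivlMr//.
apply: (@le_lt_trans _ _ (C2 * (alpha ^+ 2 / alpha ^+ m.+2) / (C3 / P ^+ m.+2) *
    (C1 `^ t / P * (D / alpha)))).
  apply: ler_wpM2l => //; apply: divr_ge0; apply: mulr_ge0; rewrite ?(ltW C20) ?(ltW C30)//.
    by apply: divr_ge0; apply: exprn_ge0; exact: ltW.
  by rewrite invr_ge0 exprn_ge0// ltW.
(* Substituting alpha = r P cancels all powers of [P], and [M] collects the constants. *)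
have -> : C2 * (alpha ^+ 2 / alpha ^+ m.+2) / (C3 / P ^+ m.+2) *
    (C1 `^ t / P * (D / alpha)) = D * (b * (M / r ^+ m.+1)).
  rewrite arP /M !exprMn !exprS; field.
  by rewrite !gt_eqF ?exprn_gt0.
rewrite mulrC ltr_pM2r// -[ltRHS]mulr1 ltr_pM2l//.
by rewrite ltr_pdivrMr ?exprn_gt0// mul1r.
Qed.

Theorem theorem1p5 (R : realType) (n : nat) (K : nat -> R -> R) (s beta q : R)
    (hn : (3 <= n)%N)
    (hK : @gagliardo_normalization R n (K n))
    (hs : 0 < s < 1)
    (hbeta : 0 <= beta < 1)
    (hq : 2 + beta < q < 2 * n%:R / (n%:R - 2)) :
  exists2 alpha_star : R, 0 < alpha_star &
    forall alpha : R, alpha_star < alpha ->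
      forall u : 'rV[R]_n -> R,
        ground_state (K n s) s beta alpha q u -> ~ radial u.
Proof.
have n0 : (0 < n)%N by apply: leq_trans hn.
have n2 : (2 <= n)%N by apply: leq_trans hn.
have q2 : 2 < q.
  by move: hbeta hq => /andP[b0 _] /andP[bq _]; apply: le_lt_trans bq; rewrite lerDl.
have q0 : 0 < q by lra.
have b1 : 0 < 1 - beta by move: hbeta => /andP[_]; rewrite subr_gt0.
have K0 : 0 <= K n s by apply/ltW/(hK.1 s hs).
have [C1 C10 HC1] := @radial_lower_bound R n n0 q q0.
have [Ca Ca0 HCa] := @bump_dirichlet_le R n.
have [Cb Cb0 HCb] := @bump_gagliardo_le R n s hs n2.
have e8 : 0 < expR (- 8) :> R by exact: expR_gt0.
have C20 : 0 < Ca + K n s ^+ 2 * Cb.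
  by apply: ltr_pwDl => //; apply: mulr_ge0; [exact: sqr_ge0|exact: ltW].
have [A A0 HA] := quotient_gap n2 q2 b1 e8 C10 C20.
(* One summand per requirement: [A] for the gap, 8 and 1 + 4n for the bump, 2qn for the radial
   estimate. *)
exists (A + 8 + (1 + 4 * n%:R) + 2 * q * n%:R).
  by rewrite !addr_gt0 ?mulr_gt0 ?ltr0n// addr_gt0.
move=> alpha Aalpha u [uX2 upos [Du hDu umin]] urad.
have nR0 : 0 <= n%:R :> R by [].
have qn0 : 0 <= q * n%:R by apply: mulr_ge0 => //; exact: ltW.
have a8 : 8 <= alpha by lra.
have a0 : 0 < alpha by lra.
have an : 1 + 4 * n%:R <= alpha by lra.
have aA : A < alpha by lra.
have aq : 2 * q * n%:R < alpha by lra.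
pose i0 : 'I_n := Ordinal n0.
have uL : u \in Lfun (@lebesgue_rV R n) 2%:E by case: uX2 => -[].
have W0 := weighted_integral_gt0 alpha q n0 (Lfun2_measurable uL) upos.
have := HC1 alpha u Du aq uX2 upos hDu urad.
set D := Rintegral _ _ _; set W := integral _ _ _ in W0 *.
(* Positivity excludes -oo and the radial estimate excludes +oo, so the denominator is a positive
   real. *)
case EW : W W0 => [X| |]// X0 XD; rewrite lte_fin in X0; rewrite lee_fin in XD.
have D0 : 0 <= D by apply: Rintegral_ge0 => x _; exact: sqnorm_ge0.
have := umin (boundary_bump i0 alpha) (bump_gradient alpha (bump_center i0 alpha))
  (boundary_bump_X2 i0 a8 an) (boundary_bump_neq0 (i0 := i0) a8) (bump_weak_gradient _ a0).
apply/negP; rewrite -ltNge.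
have a1 : 1 <= alpha by lra.
have r0 : 0 <= alpha ^+ 2 / alpha ^+ n by apply: divr_ge0; apply: exprn_ge0; exact: ltW.
have c0 : 0 < expR (- 8) * (2 / alpha) ^+ n.
  by apply: mulr_gt0 => //; apply: exprn_gt0; exact: divr_gt0.
apply: (le_lt_trans (quotient_le q0 K0 hbeta (mulr_ge0 (ltW Ca0) r0)
  (mulr_ge0 (ltW Cb0) r0) c0 (HCa _ _ _ a0 (@measurable_unit_ball R n))
  (HCb _ _ a1) (boundary_bump_weight_ge i0 q a8 an))).
apply: (lt_le_trans _ (quotient_ge s K0 hbeta (dirichlet_unit_ball hDu) X0 EW)).
rewrite lte_fin [K n s ^+ 2 * _]mulrA -mulrDl; exact: HA.
Qed.
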